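(* Let $\mathfrak g$ be a classical Lie superalgebra over $\mathbb K$, not of type $A(1,1)$, $P(3)$, $Q(n)$, nor $D(2,1;a)$ with $a\notin\mathbb Z$, with a fixed Chevalley basis. (a) Any rational, finite dimensional, semisimple $\mathfrak g$-module $V$ contains an admissible lattice $M$. (b) Any admissible lattice $M$ as in (a) is the sum of its weight components, that is $M=\bigoplus_{\mu\in\mathfrak h^*}(M\cap V_\mu)$.
   Context: $\mathbb K$ is an algebraically closed field of characteristic $0$. A finite dimensional non-Abelian Lie superalgebra $\mathfrak g=\mathfrak g_0\oplus\mathfrak g_1$ over $\mathbb K$ is classical if it has no nontrivial homogeneous ideals and $\mathfrak g_1$ is completely reducible as a $\mathfrak g_0$-module; by Kac these are the simple Lie algebras and $A(m,n),B(m,n),C(n),D(m,n),F(4),G(3),D(2,1;a),P(n),Q(n)$ (Kac's notation), where $P(n)=\big\{\begin{pmatrix}A&B\\C&-A^t\end{pmatrix}: A\in\mathfrak{sl}(n+1),\,B^t=B,\,C^t=-C\big\}$. Roots. $\mathfrak h$ is a fixed Cartan subalgebra of $\mathfrak g_0$; $\mathfrak g_\alpha=\{x\in\mathfrak g: [h,x]=\alpha(h)x\ \forall h\in\mathfrak h\}$; $\Delta_0=\{\alpha\ne0:\mathfrak g_\alpha\cap\mathfrak g_0\neq0\}$, $\Delta_1=\{\alpha:\mathfrak g_\alpha\cap\mathfrak g_1\ne0\}$, $\Delta=\Delta_0\cup\Delta_1$; $\ell=\dim\mathfrak h$. On $\mathfrak h$ and $\mathfrak h^*$ one has a nondegenerate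 symmetric form $(\ ,\ )$: the restriction of an even nondegenerate invariant form on $\mathfrak g$ if $\mathfrak g$ is not of type $P(n)$, and the one coming from $\mathfrak g_0\cong\mathfrak{sl}(n+1)$ for $P(n)$. Fix a distinguished simple root system $\Pi$ (all its elements even except one, if $\mathfrak g_1\neq0$; every root is a sum of elements of $\Pi$, ''positive'', or the opposite of such a sum, ''negative''); $\Delta^\pm$ are the positive/negative roots, $\Delta_i^\pm=\Delta^\pm\cap\Delta_i$. Coroots. If $\mathfrak g$ is not of type $P(n)$, $H_\alpha\in\mathfrak h$ is proportional to the element dual to $\alpha$ under the form, normalized by $\alpha(H_\alpha)=2$ if $(\alpha,\alpha)\ne0$, and, if $(\alpha,\alpha)=0$, so that the numbers $\beta(H_\alpha)$ $(\beta\in\Delta)$ generate $\mathbb Z$ (unique up to an immaterial sign, with $H_{-\alpha}=-H_\alpha$). For $P(n)$, with $\varepsilon_i$ the diagonal coordinates, the even roots are $\alpha_{i,j}=\varepsilon_i-\varepsilon_j$ with usual coroots, the odd ones are $\pm\beta_{i,j}$, $\beta_{i,j}=\beta_{j,i}=\varepsilon_i+\varepsilon_j$ $(i<j)$, and $\gamma_i=2\varepsilon_i$; the positive odd roots are the $\beta_{i,j}$ and $\gamma_i$; $H_{\pm\beta_{i,j}}:=\pm H_{\alpha_{i,j}}$ $(i<j)$; sums and strings of roots of $P(n)$ are computed formally in the free $\mathbb Z$-module on $\varepsilon_1,\dots,\varepsilon_{n+1}$. The $\alpha$-string through $\beta$ is $\{\beta-r\alpha,\dots,\beta+q\alpha\}$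 with $r,q\geq0$ largest such that $\beta+j\alpha\in\Delta\cup\{0\}$ for $-r\le j\le q$. A Chevalley basis of $\mathfrak g$ is a homogeneous $\mathbb K$-basis $\{H_1,\dots,H_\ell\}\sqcup\{X_\alpha\}_{\alpha\in\Delta}$ such that: (a) $\{H_i\}$ is a $\mathbb K$-basis of $\mathfrak h$, and $\mathfrak h_{\mathbb Z}:=\mathrm{Span}_{\mathbb Z}(H_1,\dots,H_\ell)=\mathrm{Span}_{\mathbb Z}\{H_\alpha:\alpha\in\Delta\cap(-\Delta)\}$; (b) $[H_i,H_j]=0$, $[H_i,X_\alpha]=\alpha(H_i)X_\alpha$; (c) $[X_\alpha,X_{-\alpha}]=\sigma_\alpha H_\alpha$ for $\alpha\in\Delta\cap(-\Delta)$, with $\sigma_\alpha=-1$ if $\alpha\in\Delta_1^-$ and $\sigma_\alpha=1$ otherwise; (d) $[X_\alpha,X_\beta]=c_{\alpha,\beta}X_{\alpha+\beta}$ for $\alpha\ne-\beta$, where: if $\alpha+\beta\notin\Delta$, then $c_{\alpha,\beta}=0$, $X_{\alpha+\beta}:=0$; if $\alpha+\beta\in\Delta$ and $(\alpha,\alpha)\ne0$ or $(\beta,\beta)\neq0$, then $c_{\alpha,\beta}=\pm(r+1)$ with $r$ from the $\alpha$-string through $\beta$, except that $c_{\alpha,\beta}=\pm(r+2)$ if $\mathfrak g=P(n)$, $\alpha=\beta_{j,i}$, $\beta=\alpha_{i,j}$; if $\alpha+\beta\in\Delta$ and $(\alpha,\alpha)=0=(\beta,\beta)$, then $c_{\alpha,\beta}=\pm\beta(H_\alpha)$.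 Kostant superalgebra: $K_{\mathbb Z}(\mathfrak g)$ is the unital $\mathbb Z$-subsuperalgebra of $U(\mathfrak g)$ generated by all $X_\alpha^{(n)}:=X_\alpha^n/n!$ $(\alpha\in\Delta_0)$, $X_\gamma$ $(\gamma\in\Delta_1)$, $\binom{H_i}{n}:=H_i(H_i-1)\cdots(H_i-n+1)/n!$, $n\in\mathbb N$, $1\le i\le\ell$. A $\mathbb Z$-lattice of a finite dimensional $\mathbb K$-space $V$ is the $\mathbb Z$-span of a $\mathbb K$-basis of $V$. A $\mathfrak g$-module $V$ is rational if $V=\bigoplus_{\mu\in\mathfrak h^*}V_\mu$ with $V_\mu=\{v: h.v=\mu(h)v\ \forall h\in\mathfrak h\}$, and $\mu(H_i)\in\mathbb Z$ for all $i$ and all $\mu$ with $V_\mu\neq0$. A $\mathbb Z$-lattice $M$ of $V$ is admissible if it is $K_{\mathbb Z}(\mathfrak g)$-stable. *)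

(* Defs.v *)
From HB Require Import structures.
From mathcomp Require Import all_boot all_order all_algebra.
From mathcomp Require Import boolp.

Set Warnings "-redundant-canonical-projection".
Set Implicit Arguments.
Unset Strict Implicit.
Unset Printing Implicit Defensive.

Import GRing.Theory.
Local Open Scope quotient_scope.
Local Open Scope ring_scope.

Definition zspan (V : zmodType) (S : V -> Prop) (x : V) : Prop :=
  exists (n : nat) (c : 'I_n -> int) (v : 'I_n -> V),
    (forall i, S (v i)) /\ x = \sum_(i < n) v i *~ c i.

(* The index type may be infinite; only finite sums of elements of the
   members of the family F are formed. *)
Definition internal_dsum (I : eqType) (V : zmodType)
    (P : V -> Prop) (F : I -> V -> Prop) : Prop :=
  (forall v, P v <->
     exists (s : seq I) (w : I -> V),
       [/\ uniq s, (forall i, i \in s -> F i (w i))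
         & v = \sum_(i <- s) w i]) /\
  (forall (s : seq I) (w : I -> V),
     uniq s -> (forall i, i \in s -> F i (w i)) ->
     \sum_(i <- s) w i = 0 -> forall i, i \in s -> w i = 0).

(* U is the direct sum of finitely many simple objects, "subobject" being
   understood in the sense of sub; the empty sum is allowed. *)
Definition semisimple_for (K : fieldType) (V : vectType K)
    (sub : {vspace V} -> Prop) (U : {vspace V}) : Prop :=
  exists (n : nat) (W : 'I_n -> {vspace V}),
    [/\ forall i, [/\ sub (W i), W i != 0%VS
          & forall W' : {vspace V}, sub W' -> (W' <= W i)%VS ->
              W' = 0%VS \/ W' = W i],
        directv (\sum_(i < n) W i)
      & (\sum_(i < n) W i)%VS = U].

Definition homogeneous_sub (K : fieldType) (V : vectType K)
    (part : bool -> {vspace V}) (W : {vspace V}) : Prop :=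
  ((W :&: part false) + (W :&: part true))%VS = W.

(* Parities are booleans: false is even, true is odd. *)
Record lieSuperalg (K : fieldType) := LieSuperalg {
  ls_sort :> vectType K;
  lpart : bool -> {vspace ls_sort};
  br : ls_sort -> ls_sort -> ls_sort;
  lpart_full : (lpart false + lpart true)%VS = fullv;
  lpart_cap : (lpart false :&: lpart true)%VS = 0%VS;
  br_linearl : forall y, linear (fun x => br x y);
  br_linearr : forall x, linear (br x);
  br_graded : forall i j x y, x \in lpart i -> y \in lpart j ->
    br x y \in lpart (i (+) j);
  br_skew : forall i j x y, x \in lpart i -> y \in lpart j ->
    br x y = - ((-1) ^+ (i && j) *: br y x);
  br_jacobi : forall i j x y z, x \in lpart i -> y \in lpart j ->
    br x (br y z) = br (br x y) z + (-1) ^+ (i && j) *: br y (br x z)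
}.

Record superModule (K : fieldType) (G : lieSuperalg K) := SuperModule {
  sm_sort :> vectType K;
  mpart : bool -> {vspace sm_sort};
  act : G -> sm_sort -> sm_sort;
  mpart_full : (mpart false + mpart true)%VS = fullv;
  mpart_cap : (mpart false :&: mpart true)%VS = 0%VS;
  act_linearl : forall v, linear (fun x => act x v);
  act_linearr : forall x, linear (act x);
  act_graded : forall i j x v, x \in lpart G i -> v \in mpart j ->
    act x v \in mpart (i (+) j);
  act_br : forall i j x y v, x \in lpart G i -> y \in lpart G j ->
    act (br x y) v = act x (act y v) - (-1) ^+ (i && j) *: act y (act x v)
}.

Definition submodule (K : fieldType) (G : lieSuperalg K) (V : superModule G)
    (W : {vspace V}) : Prop :=
  homogeneous_sub (@mpart K G V) W /\
  forall (x : G) (w : V), w \in W -> act x w \in W.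

Definition semisimple (K : fieldType) (G : lieSuperalg K)
    (V : superModule G) : Prop :=
  semisimple_for (@submodule K G V) fullv.

Definition ideal (K : fieldType) (G : lieSuperalg K) (I : {vspace G}) : Prop :=
  forall x y : G, y \in I -> br x y \in I /\ br y x \in I.

Definition even_submodule (K : fieldType) (G : lieSuperalg K)
    (W : {vspace G}) : Prop :=
  (W <= lpart G true)%VS /\
  forall x y : G, x \in lpart G false -> y \in W -> br x y \in W.

Definition classical (K : fieldType) (G : lieSuperalg K) : Prop :=
  [/\ exists x y : G, br x y != 0,
      forall I : {vspace G}, homogeneous_sub (lpart G) I -> ideal I ->
        I = 0%VS \/ I = fullv
    & semisimple_for (@even_submodule K G) (lpart G true)].

Definition mx_part (K : fieldType) (p q : nat) (b : bool)
    (X : 'M[K]_(p + q)) : 'M[K]_(p + q) :=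
  if b then block_mx 0 (ursubmx X) (dlsubmx X) 0
  else block_mx (ulsubmx X) 0 0 (drsubmx X).

Definition mx_br (K : fieldType) (p q : nat) (X Y : 'M[K]_(p + q)) :
    'M[K]_(p + q) :=
  \sum_(i : bool) \sum_(j : bool)
    (mx_part i X *m mx_part j Y
     - (-1) ^+ (i && j) *: (mx_part j Y *m mx_part i X)).

(* G is isomorphic, as a Lie superalgebra, to S/Z where S is a homogeneous
   subalgebra of gl(p|q) and Z a homogeneous ideal of S. *)
Definition iso_quotient (K : fieldType) (p q : nat)
    (S Z : 'M[K]_(p + q) -> Prop) (G : lieSuperalg K) : Prop :=
  exists f : 'Hom('M[K]_(p + q), G),
    [/\ forall X Y, S X -> S Y -> f (mx_br X Y) = br (f X) (f Y),
        forall b X, S X -> f (mx_part b X) \in lpart G b,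
        forall x : G, exists2 X, S X & f X = x
      & forall X, S X -> (f X = 0 <-> Z X)].

Definition scalar_matrix (K : fieldType) (n : nat) (X : 'M[K]_n) : Prop :=
  exists c : K, X = c%:M.

(* sl(2|2), cut out by the vanishing of the supertrace, modulo scalars *)
Definition type_A11 (K : fieldType) (G : lieSuperalg K) : Prop :=
  @iso_quotient K 2 2
    (fun X => \tr (ulsubmx X) - \tr (drsubmx X) = 0)
    (@scalar_matrix K (2 + 2)) G.

Definition Q_matrix (K : fieldType) (n : nat)
    (X : 'M[K]_(n.+1 + n.+1)) : Prop :=
  exists a b : 'M[K]_n.+1, \tr b = 0 /\ X = block_mx a b b a.

Definition type_Q (K : fieldType) (n : nat) (G : lieSuperalg K) : Prop :=
  iso_quotient (@Q_matrix K n) (@scalar_matrix K (n.+1 + n.+1)) G.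

Definition P_matrix (K : fieldType) (n : nat)
    (X : 'M[K]_(n.+1 + n.+1)) : Prop :=
  exists A B C : 'M[K]_n.+1,
    [/\ \tr A = 0, B^T = B, C^T = - C & X = block_mx A B C (- A^T)].

Definition P_iso (K : fieldType) (n : nat) (G : lieSuperalg K)
    (phi : 'Hom(G, 'M[K]_(n.+1 + n.+1))) : Prop :=
  [/\ forall x y, phi (br x y) = mx_br (phi x) (phi y),
      forall b x, x \in lpart G b -> mx_part b (phi x) = phi x,
      injective phi
    & forall X, P_matrix X <-> exists x, phi x = X].

Definition type_P (K : fieldType) (n : nat) (G : lieSuperalg K) : Prop :=
  exists phi : 'Hom(G, 'M[K]_(n.+1 + n.+1)), P_iso phi.

(* Kac's definition of the contragredient Lie superalgebra with matrix A
   and odd generators indexed by tau: generated by a local part with basis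
   e_i, h_i, f_i, and without nonzero homogeneous ideals meeting the local
   part trivially. *)
Definition contragredient (K : fieldType) (n : nat) (A : 'M[K]_n)
    (tau : 'I_n -> bool) (G : lieSuperalg K) : Prop :=
  exists e h f : 'I_n -> G,
    let local := codom e ++ codom h ++ codom f in
    [/\ [/\ forall i, e i \in lpart G (tau i),
            forall i, f i \in lpart G (tau i),
            forall i, h i \in lpart G false
          & free local],
        forall i j, [/\ br (e i) (f j) = (if i == j then h i else 0),
                        br (h i) (h j) = 0,
                        br (h i) (e j) = A i j *: e j
                      & br (h i) (f j) = - (A i j *: f j)],
        forall U : {vspace G}, {subset local <= U} ->
          (forall x y, x \in U -> y \in U -> br x y \in U) -> U = fullv
      & forall I : {vspace G}, homogeneous_sub (lpart G) I -> ideal I ->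
          (I :&: <<local>>)%VS = 0%VS -> I = 0%VS].

Definition D21_cartan (K : fieldType) (a : K) : 'M[K]_3 :=
  \matrix_(i, j) nth 0 (nth [::] [:: [:: 0; 1; a];
                                     [:: -1; 2; 0];
                                     [:: -1; 0; 2]] i) j.

Definition type_D21 (K : fieldType) (a : K) (G : lieSuperalg K) : Prop :=
  [/\ a != 0, a != -1
    & contragredient (D21_cartan a) (fun i => i == ord0) G].

Definition br_space (K : fieldType) (G : lieSuperalg K)
    (U W : {vspace G}) : {vspace G} :=
  <<[seq br u w | u <- vbasis U, w <- vbasis W]>>%VS.

Definition cartan_subalg (K : fieldType) (G : lieSuperalg K)
    (h : {vspace G}) : Prop :=
  [/\ (h <= lpart G false)%VS,
      (br_space h h <= h)%VS,
      exists n, iter n (br_space h) h = 0%VS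
    & forall x, x \in lpart G false ->
        (forall y, y \in h -> br x y \in h) -> x \in h].

Notation hdual h := 'Hom(subvs_of h, _^o).

Definition weight_vector (K : fieldType) (G : lieSuperalg K) (h : {vspace G})
    (V : superModule G) (mu : hdual h) (v : V) : Prop :=
  forall y : subvs_of h, act (vsval y) v = mu y *: v.

Definition root_vector (K : fieldType) (G : lieSuperalg K) (h : {vspace G})
    (alpha : hdual h) (x : G) : Prop :=
  forall y : subvs_of h, br (vsval y) x = alpha y *: x.

(* The element t of h with form t y = alpha y for all y in h (when the
   bilinear form on h is nondegenerate). *)
Definition dual_elt (K : fieldType) (G : lieSuperalg K) (h : {vspace G})
    (form : subvs_of h -> subvs_of h -> K) (alpha : hdual h) : subvs_of h :=
  (linfun (fun x => linfun (fun y => form x y : K^o) : hdual h))^-1%VF alpha.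

Lemma dual_eltP (K : fieldType) (G : lieSuperalg K) (h : {vspace G})
    (form : subvs_of h -> subvs_of h -> K) (alpha : hdual h) :
  (forall y, linear (fun x => form x y : K^o)) ->
  (forall x, linear (fun y => form x y : K^o)) ->
  (forall x, (forall y, form x y = 0) -> x = 0) ->
  forall y, form (dual_elt form alpha) y = alpha y.
Proof.
move=> linl linr nondeg; rewrite /dual_elt.
set F := linfun _.
have rowE x y : linfun (fun y => form x y : K^o) y = form x y.
  pose lx := GRing.isLinear.Build K _ _ _ (fun y => form x y : K^o) (linr x).
  pose Lx : {linear subvs_of h -> K^o} := HB.pack (fun y => form x y : K^o) lx.
  exact: (lfunE Lx).
have lin : linear (fun x => linfun (fun y => form x y : K^o) : hdual h).
  move=> a u v; apply/lfunP => y.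
  by rewrite add_lfunE scale_lfunE !rowE; apply: linl.
have FE x y : F x y = form x y.
  pose lx := GRing.isLinear.Build K _ _ _
    (fun x => linfun (fun y => form x y : K^o) : hdual h) lin.
  pose L : {linear subvs_of h -> hdual h} :=
    HB.pack (fun x => linfun (fun y => form x y : K^o) : hdual h) lx.
  by rewrite -rowE; congr (fun_of_lfun _ _); apply: (lfunE L).
have kerF : lker F == 0%VS.
  apply/lker0P => u v Fuv; apply/subr0_eq/nondeg => y.
  by rewrite -FE linearB /= Fuv subrr zero_lfunE.
have imF : limg F = fullv.
  apply/eqP; rewrite eqEdim subvf /= limg_dim_eq ?(eqP kerF) ?capv0 //.
  by rewrite !dimvf /dim /= muln1.
by move=> y; rewrite -FE limg_lfunVK // imF memvf.
Qed.

(* Roots are elements of an abelian group in which sums and strings of roots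
   are computed, together with a homomorphism to the dual of h.  This group
   is the dual of h itself except for P(n), where it is the free abelian
   group on the epsilon_i. *)
Record rootData (K : fieldType) (G : lieSuperalg K) (h : {vspace G}) :=
  RootData {
    rlat : zmodType;
    rwt : rlat -> hdual h;
    proot : bool -> rlat -> Prop; (* indexed by parity *)
    hform : subvs_of h -> subvs_of h -> K;
    coroot : rlat -> subvs_of h;
    (* pairs of roots whose structure constant is +-(r+2) *)
    exceptional : rlat -> rlat -> Prop
  }.

Definition isroot (K : fieldType) (G : lieSuperalg K) (h : {vspace G})
    (D : rootData h) (alpha : rlat D) : Prop :=
  proot false alpha \/ proot true alpha.

(* the value (alpha, alpha) *)
Definition sqnorm (K : fieldType) (G : lieSuperalg K) (h : {vspace G})
    (D : rootData h) (alpha : rlat D) : K :=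
  rwt alpha (dual_elt (@hform _ _ _ D) (rwt alpha)).

Definition form_roots (K : fieldType) (G : lieSuperalg K) (h : {vspace G})
    (form : G -> G -> K) (H : hdual h -> subvs_of h) : rootData h :=
  {| rlat := hdual h;
     rwt := id;
     proot := fun b alpha => (b || (alpha != 0)) /\
       exists x : G, [/\ x \in lpart G b, x != 0 & root_vector alpha x];
     hform := fun x y => form (vsval x) (vsval y);
     coroot := H;
     exceptional := fun _ _ => False |}.

Definition invariant_form (K : fieldType) (G : lieSuperalg K)
    (form : G -> G -> K) : Prop :=
  [/\ (forall y, linear (fun x => form x y : K^o)) /\
      (forall x, linear (fun y => form x y : K^o)),
      forall x y, x \in lpart G false -> y \in lpart G true -> form x y = 0,
      forall i j x y, x \in lpart G i -> y \in lpart G j ->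
        form x y = (-1) ^+ (i && j) * form y x,
      forall x y z, form (br x y) z = form x (br y z)
    & forall x, (forall y, form x y = 0) -> x = 0].

Definition form_coroots (K : fieldType) (G : lieSuperalg K) (h : {vspace G})
    (D : rootData h) : Prop :=
  forall alpha : rlat D, isroot alpha ->
  [/\ exists c : K, coroot alpha = c *: dual_elt (@hform _ _ _ D) (rwt alpha),
      sqnorm alpha != 0 -> rwt alpha (coroot alpha) = 2
    & sqnorm alpha = 0 ->
        (forall z : K,
           zspan (fun w => exists2 beta : rlat D, isroot beta
                             & w = rwt beta (coroot alpha)) z
           <-> exists m : int, z = m%:~R) /\
        coroot (- alpha) = - coroot alpha].

Section PRoots.
Variables (K : fieldType) (G : lieSuperalg K) (h : {vspace G}) (n : nat).
Variable phi : 'Hom(G, 'M[K]_(n.+1 + n.+1)).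

Definition P_eps (i : 'I_n.+1) : 'rV[int]_n.+1 := delta_mx 0 i.
Definition P_alpha (i j : 'I_n.+1) := P_eps i - P_eps j.
Definition P_beta (i j : 'I_n.+1) := P_eps i + P_eps j.

Definition P_roots (H : 'rV[int]_n.+1 -> subvs_of h) : rootData h :=
  {| rlat := 'rV[int]_n.+1;
     rwt := fun a => linfun (fun x : subvs_of h =>
       \sum_k (a 0 k)%:~R * phi (vsval x) (lshift _ k) (lshift _ k) : K^o);
     proot := fun b a =>
       if b then
         (exists i j : 'I_n.+1, a = P_beta i j) \/
         (exists i j : 'I_n.+1, i != j /\ a = - P_beta i j)
       else exists i j : 'I_n.+1, i != j /\ a = P_alpha i j;
     hform := fun x y =>
       \tr (ulsubmx (phi (vsval x)) *m ulsubmx (phi (vsval y)));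
     coroot := H;
     exceptional := fun a b =>
       exists i j : 'I_n.+1, [/\ i != j, a = P_beta j i & b = P_alpha i j] |}.

Definition P_cartan : Prop :=
  forall x : G, x \in lpart G false ->
    (x \in h <-> is_diag_mx (ulsubmx (phi x))).

Definition P_coroots (H : 'rV[int]_n.+1 -> subvs_of h) : Prop :=
  (forall i j : 'I_n.+1, i != j ->
     ulsubmx (phi (vsval (H (P_alpha i j)))) = delta_mx i i - delta_mx j j) /\
  (forall i j : 'I_n.+1, (i < j)%N ->
     H (P_beta i j) = H (P_alpha i j) /\
     H (- P_beta i j) = - H (P_alpha i j)).

Definition P_positive (pos : pred 'rV[int]_n.+1) : Prop :=
  (forall i j : 'I_n.+1, pos (P_beta i j)) /\
  (forall i j : 'I_n.+1, i != j -> ~~ pos (- P_beta i j)).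

End PRoots.

(* D is the root data of (G, h), for some choice of the immaterial data (form,
   identification with P(n), signs of the isotropic coroots), and the set pos
   of positive roots follows the convention imposed for P(n). *)
Variant root_setting (K : fieldType) (G : lieSuperalg K) (h : {vspace G}) :
    forall D : rootData h, pred (rlat D) -> Prop :=
| RootsForm (form : G -> G -> K) (H : hdual h -> subvs_of h)
    (pos : pred (hdual h)) of
    (forall n, (1 < n)%N -> ~ type_P n G) &
    invariant_form form &
    (forall x : subvs_of h,
       (forall y : subvs_of h, form (vsval x) (vsval y) = 0) -> x = 0) &
    form_coroots (form_roots form H) :
    @root_setting K G h (form_roots form H) pos
| RootsP (n : nat) (phi : 'Hom(G, 'M[K]_(n.+1 + n.+1)))
    (H : 'rV[int]_n.+1 -> subvs_of h) (pos : pred 'rV[int]_n.+1) of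
    (1 < n)%N & P_iso phi & P_cartan h phi & P_coroots phi H &
    P_positive pos :
    @root_setting K G h (P_roots phi H) pos.

Definition sum_of (L : zmodType) (Pi : seq L) (x : L) : Prop :=
  exists2 s : seq L, {subset s <= Pi} & x = \sum_(y <- s) y.

(* In the dual of h, simple roots may satisfy a linear relation with positive
   coefficients: this happens for A(n,n).  Hence sums of simple roots do not by
   themselves determine which roots are positive, and one also requires that
   the positive (resp. negative) root vectors span a subalgebra. *)
Definition distinguished (K : fieldType) (G : lieSuperalg K) (h : {vspace G})
    (D : rootData h) (pos : pred (rlat D)) (Pi : seq (rlat D)) : Prop :=
  [/\ forall alpha, alpha \in Pi ->
        [/\ isroot alpha, pos alpha
          & forall beta gamma, isroot beta -> isroot gamma ->
              pos beta -> pos gamma -> alpha != beta + gamma],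
      forall alpha, isroot alpha ->
        if pos alpha then sum_of Pi alpha else sum_of Pi (- alpha),
      forall alpha beta (x y : G),
        isroot alpha -> isroot beta -> pos alpha = pos beta ->
        root_vector (rwt alpha) x -> root_vector (rwt beta) y ->
        br x y != 0 ->
        isroot (alpha + beta) /\ pos (alpha + beta) = pos alpha
    & lpart G true != 0%VS ->
        exists! alpha, alpha \in Pi /\ proot true alpha].

(* r is the largest natural number such that beta - j alpha is a root or zero
   for all j <= r *)
Definition string_left (K : fieldType) (G : lieSuperalg K) (h : {vspace G})
    (D : rootData h) (alpha beta : rlat D) (r : nat) : Prop :=
  (forall j, (j <= r)%N ->
     isroot (beta - alpha *+ j) \/ beta - alpha *+ j = 0) /\
  ~ (isroot (beta - alpha *+ r.+1) \/ beta - alpha *+ r.+1 = 0).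

Definition eq_sgn (K : fieldType) (c d : K) : Prop := c = d \/ c = - d.

Definition structure_constant (K : fieldType) (G : lieSuperalg K)
    (h : {vspace G}) (D : rootData h) (alpha beta : rlat D) (c : K) : Prop :=
  [/\ (sqnorm alpha != 0 \/ sqnorm beta != 0) -> ~ exceptional alpha beta ->
        exists2 r, string_left alpha beta r & eq_sgn c r.+1%:R,
      (sqnorm alpha != 0 \/ sqnorm beta != 0) -> exceptional alpha beta ->
        exists2 r, string_left alpha beta r & eq_sgn c r.+2%:R
    & sqnorm alpha = 0 -> sqnorm beta = 0 ->
        eq_sgn c (rwt beta (coroot alpha))].

(* ch_X is meaningful on roots only. *)
Record chevalley_basis (K : fieldType) (G : lieSuperalg K) (h : {vspace G})
    (D : rootData h) (pos : pred (rlat D)) := ChevalleyBasis {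
  ch_roots : seq (rlat D);
  ch_H : 'I_(\dim h) -> subvs_of h;
  ch_X : rlat D -> G;
  ch_roots_uniq : uniq ch_roots;
  mem_ch_roots : forall alpha, alpha \in ch_roots <-> isroot alpha;
  ch_basis : basis_of fullv
    ([seq vsval (ch_H i) | i : 'I_(\dim h)] ++
     [seq ch_X alpha | alpha <- ch_roots]);
  ch_homogeneous : forall alpha, isroot alpha ->
    exists b, ch_X alpha \in lpart G b;
  ch_H_basis : basis_of fullv [seq ch_H i | i : 'I_(\dim h)];
  ch_H_span : forall x : subvs_of h,
    zspan (fun y => exists i, y = ch_H i) x <->
    zspan (fun y => exists alpha : rlat D,
             [/\ isroot alpha, isroot (- alpha) & y = coroot alpha]) x;
  ch_HH : forall i j, br (vsval (ch_H i)) (vsval (ch_H j)) = 0;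
  ch_HX : forall i alpha, isroot alpha ->
    br (vsval (ch_H i)) (ch_X alpha) = rwt alpha (ch_H i) *: ch_X alpha;
  ch_XXopp : forall alpha : rlat D, isroot alpha -> isroot (- alpha) ->
    br (ch_X alpha) (ch_X (- alpha)) =
      (if `[< proot true alpha >] && ~~ pos alpha then -1 else 1 : K)
        *: vsval (coroot alpha);
  ch_XX0 : forall alpha beta : rlat D, isroot alpha -> isroot beta ->
    alpha <> - beta -> ~ isroot (alpha + beta) ->
    br (ch_X alpha) (ch_X beta) = 0;
  ch_XX : forall alpha beta : rlat D, isroot alpha -> isroot beta ->
    alpha <> - beta -> isroot (alpha + beta) ->
    exists2 c : K, structure_constant alpha beta c
      & br (ch_X alpha) (ch_X beta) = c *: ch_X (alpha + beta)
}.

Section Enveloping.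
Variables (K : fieldType) (G : lieSuperalg K).

(* U(G) is the K-algebra presented by the generators ut_gen x, for x in G, and
   the relations making ut_gen linear and sending brackets of homogeneous
   elements to supercommutators. *)
Inductive uterm : Type :=
| ut_gen of G
| ut_zero
| ut_one
| ut_add of uterm & uterm
| ut_mul of uterm & uterm
| ut_scale of K & uterm.

Inductive ueq : uterm -> uterm -> Prop :=
| ueq_refl s : ueq s s
| ueq_sym s t : ueq s t -> ueq t s
| ueq_trans s t u : ueq s t -> ueq t u -> ueq s u
| ueq_add s s' t t' : ueq s s' -> ueq t t' -> ueq (ut_add s t) (ut_add s' t')
| ueq_mul s s' t t' : ueq s s' -> ueq t t' -> ueq (ut_mul s t) (ut_mul s' t')
| ueq_scale a s s' : ueq s s' -> ueq (ut_scale a s) (ut_scale a s')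
| ueq_addA s t u : ueq (ut_add s (ut_add t u)) (ut_add (ut_add s t) u)
| ueq_addC s t : ueq (ut_add s t) (ut_add t s)
| ueq_add0 s : ueq (ut_add ut_zero s) s
| ueq_addN s : ueq (ut_add (ut_scale (-1) s) s) ut_zero
| ueq_mulA s t u : ueq (ut_mul s (ut_mul t u)) (ut_mul (ut_mul s t) u)
| ueq_mul1l s : ueq (ut_mul ut_one s) s
| ueq_mul1r s : ueq (ut_mul s ut_one) s
| ueq_mulDl s t u :
    ueq (ut_mul (ut_add s t) u) (ut_add (ut_mul s u) (ut_mul t u))
| ueq_mulDr s t u :
    ueq (ut_mul s (ut_add t u)) (ut_add (ut_mul s t) (ut_mul s u))
| ueq_scaleA a b s : ueq (ut_scale a (ut_scale b s)) (ut_scale (a * b) s)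
| ueq_scale1 s : ueq (ut_scale 1 s) s
| ueq_scaleDr a s t :
    ueq (ut_scale a (ut_add s t)) (ut_add (ut_scale a s) (ut_scale a t))
| ueq_scaleDl a b s :
    ueq (ut_scale (a + b) s) (ut_add (ut_scale a s) (ut_scale b s))
| ueq_scaleAl a s t : ueq (ut_scale a (ut_mul s t)) (ut_mul (ut_scale a s) t)
| ueq_scaleAr a s t : ueq (ut_scale a (ut_mul s t)) (ut_mul s (ut_scale a t))
| ueq_gen a x y :
    ueq (ut_gen (a *: x + y)) (ut_add (ut_scale a (ut_gen x)) (ut_gen y))
| ueq_br i j x y : x \in lpart G i -> y \in lpart G j ->
    ueq (ut_gen (br x y))
        (ut_add (ut_mul (ut_gen x) (ut_gen y))
           (ut_scale (- (-1) ^+ (i && j)) (ut_mul (ut_gen y) (ut_gen x)))).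

HB.instance Definition _ := gen_eqMixin uterm.
HB.instance Definition _ := gen_choiceMixin uterm.

Definition ueqb : rel uterm := fun s t => `[< ueq s t >].

Lemma ueqb_equiv : equiv_class_of ueqb.
Proof.
split.
- by move=> s; apply/asboolP/ueq_refl.
- move=> s t; apply/asboolP/asboolP; exact: ueq_sym.
- move=> t s u /asboolP st /asboolP tu; apply/asboolP; exact: ueq_trans st tu.
Qed.

Canonical ueqb_equivRel := EquivRelPack ueqb_equiv.

Definition Uenv : Type := {eq_quot ueqb}.
HB.instance Definition _ := EqQuotient.on Uenv.
HB.instance Definition _ := Choice.on Uenv.

Definition upi (s : uterm) : Uenv := \pi_({eq_quot ueqb}) s.
Definition urepr (u : Uenv) : uterm := repr (u : {eq_quot ueqb}).

Lemma ureprK : cancel urepr upi.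
Proof. by move=> u; rewrite /upi /urepr reprK. Qed.

Lemma upiP s t : upi s = upi t <-> ueq s t.
Proof.
split=> [/eqmodP|st]; first by move=> /= /asboolP.
by apply/eqmodP => /=; apply/asboolP.
Qed.

Lemma urepr_pi s : ueq (urepr (upi s)) s.
Proof. by apply/upiP; rewrite ureprK. Qed.

Definition U_add (u v : Uenv) := upi (ut_add (urepr u) (urepr v)).
Definition U_mul (u v : Uenv) := upi (ut_mul (urepr u) (urepr v)).
Definition U_scale (a : K) (u : Uenv) := upi (ut_scale a (urepr u)).

Lemma upiD s t : U_add (upi s) (upi t) = upi (ut_add s t).
Proof. by apply/upiP/ueq_add; apply: urepr_pi. Qed.
Lemma upiM s t : U_mul (upi s) (upi t) = upi (ut_mul s t).
Proof. by apply/upiP/ueq_mul; apply: urepr_pi. Qed.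
Lemma upiZ a s : U_scale a (upi s) = upi (ut_scale a s).
Proof. by apply/upiP/ueq_scale; apply: urepr_pi. Qed.

Lemma upi_surj (u : Uenv) : exists s, u = upi s.
Proof. by exists (urepr u); rewrite ureprK. Qed.

Fact U_addA : associative U_add.
Proof.
move=> u v w; have [[r ->] [[s ->] [t ->]]] :=
  (upi_surj u, (upi_surj v, upi_surj w)).
by rewrite !upiD; apply/upiP/ueq_addA.
Qed.
Fact U_addC : commutative U_add.
Proof.
move=> u v; have [[r ->] [s ->]] := (upi_surj u, upi_surj v).
by rewrite !upiD; apply/upiP/ueq_addC.
Qed.
Fact U_add0 : left_id (upi ut_zero) U_add.
Proof. by move=> u; have [r ->] := upi_surj u; rewrite !upiD; apply/upiP/ueq_add0. Qed.
Fact U_addN : left_inverse (upi ut_zero) (U_scale (-1)) U_add.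
Proof.
by move=> u; have [r ->] := upi_surj u; rewrite upiZ upiD; apply/upiP/ueq_addN.
Qed.

HB.instance Definition _ :=
  GRing.isZmodule.Build Uenv U_addA U_addC U_add0 U_addN.

Fact U_mulA : associative U_mul.
Proof.
move=> u v w; have [[r ->] [[s ->] [t ->]]] :=
  (upi_surj u, (upi_surj v, upi_surj w)).
by rewrite !upiM; apply/upiP/ueq_mulA.
Qed.
Fact U_mul1l : left_id (upi ut_one) U_mul.
Proof. by move=> u; have [r ->] := upi_surj u; rewrite !upiM; apply/upiP/ueq_mul1l. Qed.
Fact U_mul1r : right_id (upi ut_one) U_mul.
Proof. by move=> u; have [r ->] := upi_surj u; rewrite !upiM; apply/upiP/ueq_mul1r. Qed.
Fact U_mulDl : left_distributive U_mul +%R.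
Proof.
move=> u v w; have [[r ->] [[s ->] [t ->]]] :=
  (upi_surj u, (upi_surj v, upi_surj w)).
change (U_mul (U_add (upi r) (upi s)) (upi t)
        = U_add (U_mul (upi r) (upi t)) (U_mul (upi s) (upi t))).
by rewrite !(upiD, upiM); apply/upiP/ueq_mulDl.
Qed.
Fact U_mulDr : right_distributive U_mul +%R.
Proof.
move=> u v w; have [[r ->] [[s ->] [t ->]]] :=
  (upi_surj u, (upi_surj v, upi_surj w)).
change (U_mul (upi r) (U_add (upi s) (upi t))
        = U_add (U_mul (upi r) (upi s)) (U_mul (upi r) (upi t))).
by rewrite !(upiD, upiM); apply/upiP/ueq_mulDr.
Qed.

(* The augmentation, which shows that U(G) is not the zero ring. *)
Fixpoint ut_counit (s : uterm) : K :=
  match s with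
  | ut_gen _ => 0
  | ut_zero => 0
  | ut_one => 1
  | ut_add s t => ut_counit s + ut_counit t
  | ut_mul s t => ut_counit s * ut_counit t
  | ut_scale a s => a * ut_counit s
  end.

Lemma ut_counit_eq s t : ueq s t -> ut_counit s = ut_counit t.
Proof.
elim=> //=; first by move=> ? ? ? _ -> _ ->.
- by move=> ? ? ? ? _ -> _ ->.
- by move=> ? ? ? ? _ -> _ ->.
- by move=> ? ? ? _ ->.
- by move=> *; rewrite addrA.
- by move=> *; rewrite addrC.
- by move=> *; rewrite add0r.
- by move=> *; rewrite mulN1r addNr.
- by move=> *; rewrite mulrA.
- by move=> *; rewrite mul1r.
- by move=> *; rewrite mulr1.
- by move=> *; rewrite mulrDl.
- by move=> *; rewrite mulrDr.
- by move=> *; rewrite mulrA.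
- by move=> *; rewrite mul1r.
- by move=> *; rewrite mulrDr.
- by move=> *; rewrite mulrDl.
- by move=> *; rewrite mulrA.
- by move=> *; rewrite mulrCA.
- by move=> *; rewrite mulr0 addr0.
- by move=> *; rewrite !mulr0 addr0.
Qed.

Fact U_1neq0 : upi ut_one != 0.
Proof.
apply/eqP => /upiP /ut_counit_eq /= /eqP; exact/negP/oner_neq0.
Qed.

HB.instance Definition _ := GRing.Zmodule_isNzRing.Build Uenv
  U_mulA U_mul1l U_mul1r U_mulDl U_mulDr U_1neq0.

Fact U_scaleA a b u : U_scale a (U_scale b u) = U_scale (a * b) u.
Proof.
by have [r ->] := upi_surj u; rewrite !upiZ; apply/upiP/ueq_scaleA.
Qed.
Fact U_scale1 : left_id 1 U_scale.
Proof.
by move=> u; have [r ->] := upi_surj u; rewrite !upiZ; apply/upiP/ueq_scale1.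
Qed.
Fact U_scaleDr : right_distributive U_scale +%R.
Proof.
move=> a u v; have [[r ->] [s ->]] := (upi_surj u, upi_surj v).
change (U_scale a (U_add (upi r) (upi s))
        = U_add (U_scale a (upi r)) (U_scale a (upi s))).
by rewrite !(upiD, upiZ); apply/upiP/ueq_scaleDr.
Qed.
Fact U_scaleDl u : {morph U_scale^~ u : a b / a + b}.
Proof.
move=> a b; have [r ->] := upi_surj u.
change (U_scale (a + b) (upi r)
        = U_add (U_scale a (upi r)) (U_scale b (upi r))).
by rewrite !(upiD, upiZ); apply/upiP/ueq_scaleDl.
Qed.

HB.instance Definition _ := GRing.Zmodule_isLmodule.Build K Uenv
  U_scaleA U_scale1 U_scaleDr U_scaleDl.

Fact U_scaleAl (a : K) (u v : Uenv) : a *: (u * v) = (a *: u) * v.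
Proof.
have [[r ->] [s ->]] := (upi_surj u, upi_surj v).
change (U_scale a (U_mul (upi r) (upi s))
        = U_mul (U_scale a (upi r)) (upi s)).
by rewrite !(upiM, upiZ); apply/upiP/ueq_scaleAl.
Qed.

HB.instance Definition _ := GRing.Lmodule_isLalgebra.Build K Uenv U_scaleAl.

Fact U_scaleAr (a : K) (u v : Uenv) : a *: (u * v) = u * (a *: v).
Proof.
have [[r ->] [s ->]] := (upi_surj u, upi_surj v).
change (U_scale a (U_mul (upi r) (upi s))
        = U_mul (upi r) (U_scale a (upi s))).
by rewrite !(upiM, upiZ); apply/upiP/ueq_scaleAr.
Qed.

HB.instance Definition _ := GRing.Lalgebra_isAlgebra.Build K Uenv U_scaleAr.

Definition Uin (x : G) : Uenv := upi (ut_gen x).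

Lemma Uin_linear : linear Uin.
Proof.
move=> a x y.
change (Uin (a *: x + y) = U_add (U_scale a (Uin x)) (Uin y)).
by rewrite upiZ upiD; apply/upiP/ueq_gen.
Qed.

Lemma Uin_br i j x y : x \in lpart G i -> y \in lpart G j ->
  Uin (br x y) = Uin x * Uin y - (-1) ^+ (i && j) *: (Uin y * Uin x).
Proof.
move=> xi yj; rewrite -scaleNr.
change (Uin (br x y) = U_add (U_mul (Uin x) (Uin y))
  (U_scale (- (-1) ^+ (i && j)) (U_mul (Uin y) (Uin x)))).
by rewrite !upiM upiZ upiD; apply/upiP/ueq_br.
Qed.

Variable V : superModule G.

Fixpoint ut_act (s : uterm) (v : V) : V :=
  match s with
  | ut_gen x => act x v
  | ut_zero => 0
  | ut_one => v
  | ut_add s t => ut_act s v + ut_act t v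
  | ut_mul s t => ut_act s (ut_act t v)
  | ut_scale a s => a *: ut_act s v
  end.

Definition Uact (u : Uenv) (v : V) : V := ut_act (urepr u) v.

Lemma ut_act_linear s : linear (ut_act s).
Proof.
elim: s => [x||| s IHs t IHt | s IHs t IHt | b s IHs] a v w //=.
- exact: act_linearr.
- by rewrite scaler0 addr0.
- by rewrite IHs IHt scalerDr addrACA.
- by rewrite IHt IHs.
- by rewrite IHs scalerDr !scalerA mulrC.
Qed.

Lemma ut_actD s v w : ut_act s (v + w) = ut_act s v + ut_act s w.
Proof. by have := ut_act_linear s 1 v w; rewrite !scale1r. Qed.

Lemma ut_act0 s : ut_act s 0 = 0.
Proof. by apply: (addIr (ut_act s 0)); rewrite -ut_actD !add0r. Qed.

Lemma ut_actZ s a v : ut_act s (a *: v) = a *: ut_act s v.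
Proof. by have := ut_act_linear s a v 0; rewrite ut_act0 !addr0. Qed.

Lemma ut_act_eq s t : ueq s t -> ut_act s =1 ut_act t.
Proof.
elim=> //=.
- by move=> ? ? _ st v; rewrite st.
- by move=> ? ? ? _ st _ tu v; rewrite st tu.
- by move=> ? ? ? ? _ st _ tu v; rewrite st tu.
- by move=> ? ? ? ? _ st _ tu v; rewrite st tu.
- by move=> ? ? ? _ st v; rewrite st.
- by move=> *; move=> v; rewrite addrA.
- by move=> *; move=> v; rewrite addrC.
- by move=> *; move=> v; rewrite add0r.
- by move=> *; move=> v; rewrite scaleN1r addNr.
- by move=> *; move=> v; rewrite ut_actD.
- by move=> *; move=> v; rewrite scalerA.
- by move=> *; move=> v; rewrite scale1r.
- by move=> *; move=> v; rewrite scalerDr.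
- by move=> *; move=> v; rewrite scalerDl.
- by move=> *; move=> v; rewrite ut_actZ.
- by move=> a x y v; apply: act_linearl.
- by move=> i j x y xi yj v; rewrite (act_br _ xi yj) scaleNr.
Qed.

Lemma Uact_pi s v : Uact (upi s) v = ut_act s v.
Proof. exact/ut_act_eq/urepr_pi. Qed.

Lemma Uact_in x v : Uact (Uin x) v = act x v.
Proof. exact: Uact_pi. Qed.

Lemma Uact1 v : Uact 1 v = v.
Proof. exact: Uact_pi. Qed.

Lemma UactD u w v : Uact (u + w) v = Uact u v + Uact w v.
Proof. exact: Uact_pi. Qed.

Lemma UactM u w v : Uact (u * w) v = Uact u (Uact w v).
Proof. exact: Uact_pi. Qed.

Lemma UactZ a u v : Uact (a *: u) v = a *: Uact u v.
Proof. exact: Uact_pi. Qed.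

Lemma Uact_linear u : linear (Uact u).
Proof. exact: ut_act_linear. Qed.

End Enveloping.

Definition divided_power (K : fieldType) (U : algType K) (x : U) (n : nat) : U :=
  (n`!%:R)^-1 *: x ^+ n.

Definition binomial_elt (K : fieldType) (U : algType K) (x : U) (n : nat) : U :=
  (n`!%:R)^-1 *: \prod_(k < n) (x - k%:R).

Section Kostant.
Variables (K : fieldType) (G : lieSuperalg K) (h : {vspace G}).
Variables (D : rootData h) (pos : pred (rlat D)) (B : chevalley_basis pos).

Inductive kostant : Uenv G -> Prop :=
| kostant_even alpha n : proot false alpha ->
    kostant (divided_power (Uin (ch_X B alpha)) n)
| kostant_odd gamma : proot true gamma -> kostant (Uin (ch_X B gamma))
| kostant_cartan i n : kostant (binomial_elt (Uin (vsval (ch_H B i))) n)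
| kostant_one : kostant 1
| kostant_sub u v : kostant u -> kostant v -> kostant (u - v)
| kostant_mul u v : kostant u -> kostant v -> kostant (u * v).

Variable V : superModule G.

Definition rational : Prop :=
  internal_dsum (fun _ : V => True) (@weight_vector K G h V) /\
  forall mu : hdual h, (exists2 v : V, v != 0 & weight_vector mu v) ->
    forall i, exists m : int, mu (ch_H B i) = m%:~R.

Definition lattice (M : V -> Prop) : Prop :=
  exists2 b : seq V, basis_of fullv b
    & forall v, M v <-> zspan (fun w => w \in b) v.

Definition admissible (M : V -> Prop) : Prop :=
  lattice M /\ forall u m, kostant u -> M m -> M (Uact u m).

End Kostant.

(* Main.v *)
(* The proof does not go through the Kostant-PBW theorem for the superalgebra.
   If V is not faithful then G acts by 0, since G is simple.  Otherwise the roots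
   take integral values on the H_i, being differences of weights of V, and one
   fixes rho in the Z-span of the H_i with alpha(rho) != 0 for every root; the
   sign of alpha(rho) replaces the given positivity (in type A(n,n) a sum of
   positive roots may vanish, but a sum of positive values alpha(rho) does not).

   Finiteness: K_Z w is finitely generated for every weight vector w.  For the
   even part, let E_i, F_i be the root vectors of the indecomposable positive
   even roots.  Since E_i and F_j commute for i != j, Kostant's commutation rule
   shows that the finitely many nonzero vectors (F-word)(E-word)w span a group
   stable under all E_i^(n), F_i^(n).  It is stable under every X_alpha^(n), because
   exp(X_b) exp(-X_{-b}) exp(X_b) conjugates X_alpha to an integral multiple of
   the root vector of s_b(alpha), whose value at rho is smaller in absolute value for
   a suitable b.  For the odd part, apply words in odd root vectors: a repetition
   can be removed because X_g^2 is an integral combination of even elements.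

   Lattice: in a simple W let v be a homogeneous weight vector with maximal value
   at rho, and f the coordinate along v.  Then f is rational on K_Z v, hence has
   bounded denominators by finiteness, and the functionals f(u .), u in K_Z,
   separate the points of W because their common kernel is a submodule.  A group of
   vectors that spans W and on which enough functionals are integral is a lattice.

   For (b), integral polynomials in the H_i separate the finitely many weights. *)

Require Import Defs.
From HB Require Import structures.
From mathcomp Require Import all_boot all_order all_algebra.
From mathcomp Require Import boolp.
From mathcomp Require Import zify ring.

Set Implicit Arguments.
Unset Strict Implicit.
Unset Printing Implicit Defensive.

Import Order.TTheory GRing.Theory Num.Theory.
Local Open Scope ring_scope.


(** * Subgroups and lattices *)

(** Facts that are usually read off tables (even roots are not isotropic, Cartan integers are
    bounded, a decomposable even root can be lowered by a reflection) come here from the trace form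
    of a faithful V. On h_Z it is a sum of squares of integral weights, hence positive, and its
    radical there acts by 0.

    Both kinds of root data are brought to one interface, [good_chevalley]; the construction of the
    lattices argues from that record alone.

    A finitely generated subgroup that spans V over K need not be a lattice, because its Z-rank may
    exceed dim V, as for Z + Z sqrt 2 in a line. So finiteness of K_Z v serves only to find one
    common denominator. That f takes values in Q comes from [rational_form], a Q-space built from v
    by lowering operators and stable under all root vectors; the correct rank comes from
    [lattice_of_functionals]. *)

Definition zclosed (V : zmodType) (P : V -> Prop) : Prop :=
  P 0 /\ forall x y, P x -> P y -> P (x - y).

Section Zclosed.
Variables (V : zmodType) (P : V -> Prop) (P_closed : zclosed P).

Lemma zclosed0 : P 0. Proof. by case: P_closed. Qed.
Lemma zclosedB x y : P x -> P y -> P (x - y).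
Proof. by case: P_closed => _; apply. Qed.
Lemma zclosedN x : P x -> P (- x).
Proof. by move=> Px; rewrite -sub0r; apply: zclosedB => //; apply: zclosed0. Qed.
Lemma zclosedD x y : P x -> P y -> P (x + y).
Proof. by move=> Px Py; rewrite -[y]opprK; apply: zclosedB => //; apply: zclosedN. Qed.
Lemma zclosedMn x n : P x -> P (x *+ n).
Proof.
by move=> Px; elim: n => [|n IHn]; rewrite ?mulr0n ?mulrSr; [apply: zclosed0 | apply: zclosedD].
Qed.
Lemma zclosedMz x (m : int) : P x -> P (x *~ m).
Proof.
move=> Px; case: m => n; first exact: zclosedMn.
by rewrite NegzE mulrNz; apply: zclosedN; apply: (@zclosedMn _ n.+1).
Qed.
Lemma zclosed_sum (I : Type) (r : seq I) (Q : pred I) (F : I -> V) :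
  (forall i, Q i -> P (F i)) -> P (\sum_(i <- r | Q i) F i).
Proof.
by move=> PF; elim/big_rec: _ => [|i x Qi Px]; [apply: zclosed0 | apply: zclosedD => //; apply: PF].
Qed.
Lemma zclosed_sum_seq (I : eqType) (r : seq I) (F : I -> V) :
  (forall i, i \in r -> P (F i)) -> P (\sum_(i <- r) F i).
Proof. by move=> PF; rewrite big_seq; apply: zclosed_sum. Qed.
End Zclosed.

Section Zspan.
Variables (V : zmodType).
Implicit Types (S P : V -> Prop).

Lemma zspan_sub S P : zclosed P -> (forall x, S x -> P x) -> forall x, zspan S x -> P x.
Proof.
move=> Pc SP x [n [c [v [Sv ->]]]]; apply: zclosed_sum => // i _.
by apply: zclosedMz => //; apply: SP.
Qed.

Lemma zspan_in S x : S x -> zspan S x.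
Proof.
move=> Sx; exists 1%N, (fun=> 1), (fun=> x); split=> //.
by rewrite big_ord1 mulr1z.
Qed.

Lemma zspan_closed S : zclosed (zspan S).
Proof.
split; first by exists 0%N, (fun=> 1), (fun=> 0); split; [case | rewrite big_ord0].
move=> x y [n [c [v [Sv ->]]]] [m [d [w [Sw ->]]]].
exists (n + m)%N, (fun i => match split i with inl j => c j | inr j => - d j end),
  (fun i => match split i with inl j => v j | inr j => w j end).
split; first by move=> i; case: (split i).
rewrite big_split_ord /= -sumrN; congr (_ + _); apply: eq_bigr => i _.
  by rewrite -[lshift _ _]/(unsplit (inl i)) unsplitK.
by rewrite -[rshift _ _]/(unsplit (inr i)) unsplitK mulrNz.
Qed.

Lemma zspan_mono S P : (forall x, S x -> P x) -> forall x, zspan S x -> zspan P x.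
Proof. by move=> SP; apply: zspan_sub (zspan_closed P) _ => x /SP /zspan_in. Qed.

Lemma zspan_additive (W : zmodType) (f : V -> W) S (P : W -> Prop) :
  (forall x y, f (x - y) = f x - f y) -> zclosed P ->
  (forall x, S x -> P (f x)) -> forall x, zspan S x -> P (f x).
Proof.
move=> fB Pc SP; apply: (@zspan_sub S (fun x => P (f x))) => //; split.
  by have:= fB 0 0; rewrite !subrr => ->; apply: zclosed0.
by move=> x y Px Py; rewrite fB; apply: zclosedB.
Qed.
End Zspan.

Definition zint (R : nzRingType) (c : R) : Prop := exists m : int, c = m%:~R.

Lemma zint_closed (R : nzRingType) : zclosed (@zint R).
Proof.
split; first by exists 0.
by move=> _ _ [m ->] [n ->]; exists (m - n); rewrite intrB.
Qed.
Lemma zintM (R : nzRingType) (a b : R) : zint a -> zint b -> zint (a * b).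
Proof. by move=> [m ->] [n ->]; exists (m * n); rewrite intrM. Qed.
Lemma zint_int (R : nzRingType) (m : int) : zint (m%:~R : R).
Proof. by exists m. Qed.
Lemma zint_nat (R : nzRingType) (m : nat) : zint (m%:R : R).
Proof. by exists m. Qed.

Lemma zclosedZ (K : nzRingType) (V : lmodType K) (P : V -> Prop) (c : K) x :
  zclosed P -> zint c -> P x -> P (c *: x).
Proof. by move=> Pc [m ->] Px; rewrite scaler_int; apply: zclosedMz. Qed.

Section CharZero.
Variables (K : fieldType) (charK : [pchar K] =i pred0).

Lemma natK_neq0 n : (0 < n)%N -> n%:R != 0 :> K.
Proof. by move=> n0; rewrite ((pcharf0P K).1 charK) -lt0n. Qed.
Lemma factK_neq0 n : n`!%:R != 0 :> K.
Proof. exact/natK_neq0/fact_gt0. Qed.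
Lemma intK_eq0 (m : int) : (m%:~R == 0 :> K) = (m == 0).
Proof.
case: m => n; first by rewrite -pmulrn ((pcharf0P K).1 charK).
by rewrite NegzE mulrNz oppr_eq0 -pmulrn ((pcharf0P K).1 charK) oppr_eq0.
Qed.
Lemma intK_inj : injective (fun m : int => m%:~R : K).
Proof. by move=> m n /eqP; rewrite -subr_eq0 -intrB intK_eq0 subr_eq0 => /eqP. Qed.
Lemma natK_inj : injective (fun m : nat => m%:R : K).
Proof. by move=> m n e; have := intK_inj (e : m%:Z%:~R = n%:Z%:~R) => -[]. Qed.
End CharZero.

Section VectorSpaces.
Variables (K : fieldType) (V : vectType K).
Implicit Types (U : {vspace V}).

Lemma extend_free (X Y : seq V) : free X ->
  exists2 Z : seq V, {subset Z <= Y} & free (Z ++ X) /\ (<<Y>> <= <<Z ++ X>>)%VS.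
Proof.
elim: Y X => [|y Y IHY] X fX; first by exists [::]; rewrite ?span_nil ?sub0v.
have [yX|yX] := boolP (y \in <<X>>%VS).
  have [Z sZ [fZ YZ]] := IHY X fX; exists Z; first by move=> z /sZ zY; rewrite inE zY orbT.
  split=> //; apply/span_subvP => z; rewrite inE => /predU1P [->|zY].
    by apply: (subvP (sub_span _)) yX => x xX; rewrite mem_cat xX orbT.
  by apply: (subvP YZ); apply: memv_span.
have fyX : free (y :: X) by rewrite free_cons yX.
have [Z sZ [fZ YZ]] := IHY _ fyX; exists (rcons Z y).
  move=> z; rewrite mem_rcons !inE => /predU1P [->|/sZ ->]; first by rewrite eqxx.
  by rewrite orbT.
rewrite cat_rcons; split=> //; apply/span_subvP => z; rewrite inE => /predU1P [->|zY].
  by apply: memv_span; rewrite mem_cat inE eqxx orbT.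
by apply: (subvP YZ); apply: memv_span.
Qed.

(** Turns a linear predicate, such as a kernel described by quantifiers, into a [{vspace V}]. A
    subspace inside [P] that misses a vector satisfying [P] can be enlarged, and this stops after at
    most dim V steps. *)
Lemma vspace_comprehension (P : V -> Prop) :
  P 0 -> (forall a x y, P x -> P y -> P (a *: x + y)) ->
  exists U, forall x, x \in U <-> P x.
Proof.
move=> P0 PD.
(* [n] bounds how many more times [U] can grow. *)
suff H n : forall U, (\dim {:V} <= \dim U + n)%N -> (forall x, x \in U -> P x) ->
    exists U', forall x, x \in U' <-> P x.
  apply: (H (\dim {:V}) 0%VS); first by rewrite leq_addl.
  by move=> x; rewrite memv0 => /eqP ->.
elim: n => [|n IHn] U dU PU.
  exists U => x; split; first exact: PU.
  move=> _; suff -> : U = fullv by exact: memvf.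
  by apply/eqP; rewrite eqEdim subvf -(addn0 (\dim U)).
have [[x [Px xU]]|] := pselect (exists x, P x /\ x \notin U); last first.
  move=> nU; exists U => x; split; first exact: PU.
  by move=> Px; apply: contrapT => /negP xU; apply: nU; exists x.
apply: (IHn (<[x]> + U)%VS).
  have xn0 : x != 0 by apply: contraNneq xU => ->; exact: mem0v.
  have: (\dim U < \dim (<[x]> + U))%N.
    rewrite ltn_neqAle dimvS ?addvSr // andbT eq_sym; apply: contraNneq xU => /eqP.
    rewrite eq_sym dimv_leqif_eq ?addvSr // => /eqP ->.
    exact: subvP (addvSl _ _) _ (memv_line _).
  lia.
move=> y /memv_addP [_ /vlineP [k ->] [z zU ->]]; apply: PD => //; exact: PU.
Qed.

Lemma subv_has_lt U U' : (U' <= U)%VS -> (exists2 x, x \in U & x \notin U') ->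
  (\dim U' < \dim U)%N.
Proof.
move=> sU [x xU xU']; rewrite ltn_neqAle dimvS // andbT.
by rewrite dimv_leqif_eq //; apply: contraNneq xU' => ->.
Qed.

Lemma int_subgroup_gen (P : int -> Prop) : zclosed P ->
  exists2 a, P a & forall b, P b -> exists q, b = a * q.
Proof.
move=> Pc.
have [[n n0 Pn]|Pn] := pselect (exists2 n : nat, (0 < n)%N & P n%:Z); last first.
  exists 0; first exact: zclosed0.
  move=> b Pb; exists 0; rewrite mulr0.
  case: (eqVneq b 0) => // b0; case: Pn; exists `|b|%N; first by rewrite absz_gt0.
  case: b Pb {b0} => k Pb //=; rewrite -[_%:Z]opprK -NegzE; exact: zclosedN.
have ex : exists n : nat, `[< (0 < n)%N /\ P n%:Z >] by exists n; apply/asboolP.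
have [m /asboolP [m0 Pm] minm] := ex_minnP ex.
exists m%:Z => // b Pb; exists (b %/ m%:Z)%Z.
have Pr : P (b %% m%:Z)%Z.
  rewrite /modz; apply: zclosedB => //; by rewrite mulrC -mulrzz; apply: zclosedMz.
have r0 : (0 <= (b %% m%:Z)%Z)%R by apply: modz_ge0; lia.
have rm : ((b %% m%:Z)%Z < m%:Z)%R by apply: ltz_pmod; lia.
have E := divz_eq b m%:Z.
suff: (b %% m%:Z)%Z = 0 by move=> z; rewrite {1}E z addr0 mulrC.
case: (eqVneq (b %% m%:Z)%Z 0) => // rn0.
have: (m <= `|(b %% m%:Z)%Z|)%N.
  apply: minm; apply/asboolP; split; first by rewrite absz_gt0.
  by rewrite gez0_abs.
lia.
Qed.

(** Induction on dim U. A functional [f] that does not vanish on [N] has an image aZ; a vector [g]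
    of [N] over the generator splits [N] into Zg and the kernel of [f], which lies in a smaller
    space. Independence over K, and not only over Z, holds because [f] is nonzero at [g] and
    vanishes on the rest. *)
Lemma lattice_of_functionals (charK : [pchar K] =i pred0)
    (F : (V -> K) -> Prop) (N : V -> Prop) U :
  (forall f, F f -> linear (f : V -> K^o)) ->
  zclosed N -> (forall x, N x -> x \in U) ->
  (forall f x, F f -> N x -> zint (f x)) ->
  (forall x, x \in U -> (forall f, F f -> f x = 0) -> x = 0) ->
  exists2 b : seq V, free b & forall x, N x <-> zspan (fun y => y \in b) x.
Proof.
move=> Flin; have [n] := ubnP (\dim U).
elim: n => // n IHn in U N *; rewrite ltnS => dU Nc NU FN FU.
have [[x Nx xn0]|N0] := pselect (exists2 x, N x & x != 0); last first.
  exists [::]; first exact: nil_free.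
  move=> x; split=> [Nx|].
    have -> : x = 0 by apply: contrapT => /eqP x0; apply: N0; exists x.
    exact: zclosed0 (zspan_closed _).
  by apply: zspan_sub.
have [f Ff fx0] : exists2 f, F f & f x != 0.
  apply: contrapT => nf; move/eqP: xn0; apply; apply: FU (NU _ Nx) _ => f Ff.
  by apply: contrapT => /eqP fx; apply: nf; exists f.
have fl := Flin f Ff.
have fB y z : f (y - z) = f y - f z.
  by rewrite addrC -scaleN1r fl scaleN1r addrC.
have fZ a y : f (a *: y) = a * f y.
  have f0 : f 0 = 0 by rewrite -(subrr 0) fB subrr.
  by have := fl a y 0; rewrite addr0 f0 addr0.
have fD y z : f (y + z) = f y + f z.
  by have := fl 1 y z; rewrite !scale1r.
have f0 : f 0 = 0 by rewrite -(subrr 0) fB subrr.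
have [U' U'P] : exists U', forall y, y \in U' <-> (y \in U /\ f y = 0).
  apply: vspace_comprehension; first by split; first exact: mem0v.
  move=> a y z [yU fy] [zU fz]; split; first by rewrite memvD ?memvZ.
  by rewrite fD fZ fy fz mulr0 addr0.
have dU' : (\dim U' < n)%N.
  apply: leq_trans dU; apply: subv_has_lt; first by apply/subvP => y /U'P [].
  exists x; first exact: NU.
  by apply: contraNN fx0 => /U'P [_ ->].
pose N' y := N y /\ f y = 0.
have N'c : zclosed N'.
  split; first by split; first exact: zclosed0.
  by move=> y z [Ny fy] [Nz fz]; split; [exact: zclosedB | rewrite fB fy fz subrr].
have [b' fb' b'P] : exists2 b : seq V, free b & forall x, N' x <-> zspan (fun y => y \in b) x.
  apply: (IHn U' N') => //.
  - by move=> y [Ny fy]; apply/U'P; split=> //; apply: NU.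
  - by move=> g y Fg [Ny _]; apply: FN.
  - by move=> y /U'P [yU _]; apply: FU.
have [a [g Ng ga] aP] : exists2 a : int, (exists2 g, N g & f g = a%:~R) &
   forall b : int, (exists2 y, N y & f y = b%:~R) -> exists q, b = a * q.
  apply: int_subgroup_gen; split; first by exists 0; first exact: zclosed0.
  move=> c d [y Ny fy] [z Nz fz]; exists (y - z); first exact: zclosedB.
  by rewrite fB fy fz intrB.
have fg0 : f g != 0.
  apply: contraNN fx0 => /eqP fg0; have [m fxm] := FN f x Ff Nx.
  have [q mq] := aP m (ex_intro2 _ _ x Nx fxm).
  by rewrite fxm mq intrM -ga fg0 mul0r.
exists (g :: b').
  rewrite free_cons fb' andbT; apply: contraNN fg0.
  have: (<<b'>> <= U')%VS.
    apply/span_subvP => y yb'; apply/U'P.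
    have [Ny fy] : N' y by apply/b'P; apply: zspan_in.
    by split=> //; apply: NU.
  by move/subvP=> sb /sb /U'P [_ ->].
move=> y; split=> [Ny|]; last first.
  apply: zspan_sub => // z; rewrite inE => /predU1P [->//|zb'].
  by have [] : N' z by apply/b'P; apply: zspan_in.
have [m fym] := FN f y Ff Ny; have [q mq] := aP m (ex_intro2 _ _ y Ny fym).
have -> : y = g *~ q + (y - g *~ q) by rewrite addrC subrK.
apply: (zclosedD (zspan_closed _)).
  by apply: (zclosedMz (zspan_closed _)); apply: zspan_in; rewrite inE eqxx.
have: N' (y - g *~ q).
  split; first by apply: zclosedB => //; apply: zclosedMz.
  by rewrite fB fym mq -scaler_int fZ ga -intrM mulrC subrr.
by move/b'P; apply: zspan_mono => z zb; rewrite inE zb orbT.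
Qed.

End VectorSpaces.


(** Applying op t - ev i0 t to the sum removes the first summand and multiplies the j-th by a scalar
    that is nonzero for a suitable t, so induction on the sequence applies. With [P] a subspace this
    extracts weight components; with [P] the predicate of being 0 it gives their independence. *)
Lemma eigen_components (K : fieldType) (V : lmodType K) (I : eqType) (T : Type)
    (op : T -> {linear V -> V}) (ev : I -> T -> K) (P : V -> Prop) :
  P 0 -> (forall x y, P x -> P y -> P (x - y)) ->
  (forall (a : K) x, P x -> P (a *: x)) -> (forall t x, P x -> P (op t x)) ->
  forall (s : seq I) (w : I -> V), uniq s ->
    {in s &, forall i j, i != j -> exists t, ev i t != ev j t} ->
    (forall i t, i \in s -> op t (w i) = ev i t *: w i) ->
    P (\sum_(i <- s) w i) -> forall i, i \in s -> P (w i).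
Proof.
move=> P0 PB PZ Pop; elim=> [//|i0 s IHs] w /= /andP [i0s us] sep wt Ps.
have Pw j : j \in s -> P (w j).
  move=> js; have ji0 : j != i0 by apply: contraNneq i0s => <-.
  have [t tne] : exists t, ev j t != ev i0 t.
    by apply: sep; rewrite ?inE ?eqxx ?js ?orbT.
  have: P ((ev j t - ev i0 t) *: w j).
    apply: (IHs (fun i => (ev i t - ev i0 t) *: w i)) js => //.
    - by move=> i k si sk; apply: sep; rewrite inE ?si ?sk orbT.
    - by move=> i u si; rewrite linearZ /= wt ?inE ?si ?orbT // !scalerA mulrC.
    have -> : \sum_(i <- s) (ev i t - ev i0 t) *: w i =
        op t (\sum_(i <- i0 :: s) w i) - ev i0 t *: \sum_(i <- i0 :: s) w i.
      rewrite !big_cons linearD /= wt ?inE ?eqxx // scalerDr opprD addrACA subrr add0r.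
      rewrite linear_sum scaler_sumr -sumrB; apply: eq_big_seq => i si.
      by rewrite scalerBl wt // inE si orbT.
    by apply: PB; [apply: Pop | apply: PZ].
  move=> /(PZ (ev j t - ev i0 t)^-1); rewrite scalerA mulVf ?scale1r //.
  by rewrite subr_eq0.
move=> i; rewrite inE => /predU1P [->|]; last exact: Pw.
have -> : w i0 = \sum_(i <- i0 :: s) w i - \sum_(i <- s) w i by rewrite big_cons addrK.
apply: (PB _ _) => //; rewrite big_seq; apply: big_ind => //.
move=> x y Px Py; rewrite -[y]opprK; apply: PB => //; rewrite -scaleN1r; exact: PZ.
Qed.

(** * Binomials and divided powers *)

Section FallingFactorial.
Variable A : nzRingType.
Implicit Types x : A.

Definition ffall x n := \prod_(k < n) (x - k%:R).

Lemma ffall0 x : ffall x 0 = 1. Proof. by rewrite /ffall big_ord0. Qed.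
Lemma ffallS x n : ffall x n.+1 = ffall x n * (x - n%:R).
Proof. by rewrite /ffall big_ord_recr. Qed.

(** Here [x] is a scalar or an element of the noncommutative ring [Uenv G]. All factors are x plus
    an integer, so they commute, and both sides equal (x + 1) times [ffall x n]. *)
Lemma ffall_pascal x n :
  ffall (x + 1) n.+1 = ffall x n.+1 + n.+1%:R * ffall x n.
Proof.
have -> : ffall (x + 1) n.+1 = (x + 1) * ffall x n.
  rewrite /ffall big_ord_recl subr0; congr (_ * _); apply: eq_bigr => i _.
  by rewrite lift0 -natr1 opprD addrACA subrr addr0.
rewrite ffallS; have -> : ffall x n * (x - n%:R) = (x - n%:R) * ffall x n.
  apply/commr_sym; apply: commr_prod => k _.
  have cx : GRing.comm (x - n%:R) x.
    by apply/commr_sym/commrB; [exact: commr_refl | exact: commr_nat].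
  by apply: commrB => //; apply: commr_nat.
by rewrite -mulrDl -natr1 addrA subrK.
Qed.
End FallingFactorial.

Section BinK.
Variables (K : fieldType) (charK : [pchar K] =i pred0).

Definition binK (c : K) n := (n`!%:R)^-1 * ffall c n.

Lemma binK0 c : binK c 0 = 1.
Proof. by rewrite /binK ffall0 fact0 invr1 mulr1. Qed.

Lemma binKS c n : n.+1%:R * binK c n.+1 = (c - n%:R) * binK c n.
Proof.
have a0 := natK_neq0 charK (ltn0Sn n); have f0 := factK_neq0 charK n.
rewrite /binK factS natrM ffallS; move: a0 f0.
move: (n.+1%:R) (n`!%:R) (ffall c n) (n%:R : K) => a f g k a0 f0.
by field; rewrite a0 f0. 
Qed.

Lemma binK_pascal c n : binK (c + 1) n.+1 = binK c n.+1 + binK c n.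
Proof.
rewrite /binK ffall_pascal mulrDr; congr (_ + _).
by rewrite factS natrM invfM mulrA [_^-1 * _^-1]mulrC mulfVK ?natK_neq0.
Qed.

(** By the Pascal rule and induction on [n], integrality at k and at k + 1 are equivalent, so it
    spreads from 0 to all integers, the negative ones included. *)
Lemma binK_int c n : zint c -> zint (binK c n).
Proof.
move=> [m ->]; elim: n m => [|n IHn] m; first by rewrite binK0; exact: (zint_nat _ 1).
have up k : zint (binK k%:~R n.+1) -> zint (binK (k + 1)%:~R n.+1).
  by move=> h; rewrite intrD binK_pascal; apply: (zclosedD (zint_closed K)).
have down k : zint (binK (k + 1)%:~R n.+1) -> zint (binK k%:~R n.+1).
  move=> h; suff -> : binK k%:~R n.+1 = binK (k + 1)%:~R n.+1 - binK k%:~R n.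
    exact: (zclosedB (zint_closed K)).
  by rewrite intrD binK_pascal addrK.
elim/int_rect: m => [|k h|k h].
- by rewrite /binK /ffall big_ord_recl subrr mul0r mulr0; exact: (zint_nat _ 0).
- by rewrite -addn1 PoszD; apply: up.
- by apply: down; rewrite -addn1 PoszD opprD subrK.
Qed.

Lemma binK_nat (m n : nat) : binK m%:R n = 'C(m, n)%:R.
Proof.
elim: m n => [|m IHm] [|n]; rewrite ?binK0 ?bin0 //.
  by rewrite /binK /ffall big_ord_recl subrr mul0r mulr0.
by rewrite -natr1 binK_pascal !IHm binS natrD.
Qed.
End BinK.

Section DividedPowers.
Variables (K : fieldType) (charK : [pchar K] =i pred0) (V : lmodType K).
Implicit Types x : {linear V -> V}.

Definition dpow (x : V -> V) n v : V := (n`!%:R)^-1 *: iter n x v.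

Lemma iter_is_linear x n : linear (iter n x).
Proof. by elim: n => [//|n IHn] a u v /=; rewrite IHn linearP. Qed.

Lemma dpow_is_linear x n : linear (dpow x n).
Proof.
by move=> a u v; rewrite /dpow iter_is_linear scalerDr !scalerA [a * _]mulrC.
Qed.
HB.instance Definition _ x n := GRing.isLinear.Build K V V _ (dpow x n) (@dpow_is_linear x n).

Lemma dpow0 x v : dpow x 0 v = v.
Proof. by rewrite /dpow /= invr1 scale1r. Qed.
Lemma dpow1 x v : dpow x 1 v = x v.
Proof. by rewrite /dpow /= invr1 scale1r. Qed.

Lemma dpowS x n v : x (dpow x n v) = n.+1%:R *: dpow x n.+1 v.
Proof.
by rewrite /dpow linearZ /= scalerA factS natrM invfM mulrA mulfV ?natK_neq0 // mul1r.
Qed.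

Lemma dpow_eq0 x n v : iter n x v = 0 -> dpow x n v = 0.
Proof. by rewrite /dpow => ->; rewrite scaler0. Qed.

(** Identities between divided powers are proved after multiplication by n + 1, where the recursion
    [dpowS] replaces the factorials. *)
Lemma scale_natI (n : nat) (u v : V) : n.+1%:R *: u = n.+1%:R *: v :> V -> u = v.
Proof. by apply: scalerI; apply: natK_neq0. Qed.

Lemma dpow_commute (x y : {linear V -> V}) : (forall v, x (y v) = y (x v)) ->
  forall m n v, dpow x m (dpow y n v) = dpow y n (dpow x m v).
Proof.
move=> xy m n v; rewrite /dpow.
have xiy k u : x (iter k y u) = iter k y (x u) by elim: k => //= k IHk; rewrite xy IHk.
have H : iter m x (iter n y v) = iter n y (iter m x v).
  by elim: m => //= m ->; rewrite xiy.
have L (z : {linear V -> V}) k a u : iter k z (a *: u) = a *: iter k z u.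
  by elim: k => //= k ->; rewrite linearZ.
by rewrite !L H !scalerA mulrC.
Qed.

Section RankOne.
Variables (E F H : {linear V -> V}).
Hypothesis EF : forall v, E (F v) = F (E v) + H v.
Hypothesis HE : forall v, H (E v) = E (H v) + 2 *: E v.
Hypothesis HF : forall v, H (F v) = F (H v) - 2 *: F v.

Lemma weight_dpowE c m v : H v = c *: v ->
  H (dpow E m v) = (c + 2 * m%:R) *: dpow E m v.
Proof.
move=> Hv; elim: m => [|m IHm]; first by rewrite dpow0 mulr0 addr0.
apply: (@scale_natI m); rewrite -linearZ /= -dpowS HE IHm linearZ /= -scalerDl.
by rewrite dpowS !scalerA -natr1; congr (_ *: _); ring.
Qed.

Lemma weight_dpowF c n v : H v = c *: v ->
  H (dpow F n v) = (c - 2 * n%:R) *: dpow F n v.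
Proof.
move=> Hv; elim: n => [|m IHm]; first by rewrite dpow0 mulr0 subr0.
apply: (@scale_natI m); rewrite -linearZ /= -dpowS HF IHm linearZ /= -scalerBl.
by rewrite dpowS !scalerA -natr1; congr (_ *: _); ring.
Qed.

Lemma EFdpow c n v : H v = c *: v ->
  E (dpow F n.+1 v) = dpow F n.+1 (E v) + (c - n%:R) *: dpow F n v.
Proof.
move=> Hv; elim: n => [|n IHn]; first by rewrite !dpow1 EF Hv dpow0 subr0.
apply: (@scale_natI n.+1); rewrite -linearZ /= -dpowS EF IHn (weight_dpowF _ Hv).
rewrite linearD dpowS [F (_ *: _)]linearZ /= scalerDr -addrA; congr (_ + _).
rewrite dpowS !scalerA -scalerDl; congr (_ *: _).
by rewrite -!natr1; ring.
Qed.

(** F^(n-k), with the convention that negative powers are 0; this lets the sum in Kostant's rule run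
    up to m whatever n is. *)
Definition dpowB n k v : V := if (k <= n)%N then dpow F (n - k) v else 0.

Lemma E_dpowB c n k v : H v = c *: v ->
  E (dpowB n k v) = dpowB n k (E v) + (c - n%:R + k%:R + 1) *: dpowB n k.+1 v.
Proof.
move=> Hv; rewrite /dpowB; case: (ltngtP k n) => [kn|kn|->]; last first.
- by rewrite subnn !dpow0 scaler0 addr0.
- by rewrite linear0 scaler0 addr0.
rewrite -(subnSK kn) (EFdpow _ Hv); congr (_ + _ *: _).
by rewrite natrB // -natr1; ring.
Qed.

(* Kostant's commutation rule E^(m) F^(n) = sum_k F^(n-k) bin(H-m-n+2k, k) E^(m-k);
   on a vector of weight c the binomials in H become the scalars below. *)
Lemma EF_commutation c m n v : H v = c *: v ->
  dpow E m (dpow F n v) =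
    \sum_(k < m.+1) binK (c + m%:R - n%:R) k *: dpowB n k (dpow E (m - k) v).
Proof.
move=> Hv; elim: m => [|m IHm].
  by rewrite big_ord1 binK0 scale1r !dpow0 /dpowB leq0n subn0.
apply: (@scale_natI m); rewrite -dpowS IHm linear_sum.
set d := c + m%:R - n%:R.
have -> : c + m.+1%:R - n%:R = d + 1 by rewrite /d -natr1; ring.
pose Z k := dpowB n k (dpow E (m.+1 - k) v).
have dpowBZ k j (a : K) u : dpowB j k (a *: u) = a *: dpowB j k u.
  by rewrite /dpowB; case: ifP => _; rewrite ?scaler0 // linearZ.
(* Moving E past F^(n-k) gives a term of index k and a term of index k + 1. Once the second sum is
   shifted, the two coefficients of Z (k+1) combine by [binKS] and the Pascal rule to (m + 1) bin(d
   + 1, k + 1). *)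
transitivity (\sum_(k < m.+1) ((m.+1%:R - k%:R) * binK d k) *: Z k +
   \sum_(k < m.+1) ((d + m%:R - k%:R + 1) * binK d k) *: Z k.+1).
  rewrite -big_split /=; apply: eq_bigr => k _.
  have km : (k <= m)%N by rewrite -ltnS.
  rewrite linearZ /= (E_dpowB _ _ (weight_dpowE (m - k) Hv)) dpowS dpowBZ.
  rewrite scalerDr !scalerA /Z subSS; congr (_ + _).
    rewrite -subSn //; congr (_ *: _); rewrite natrB 1?ltnW // mulrC //.
  congr (_ *: _); rewrite natrB // /d; ring.
rewrite scaler_sumr big_ord_recl [in RHS]big_ord_recl -addrA; congr (_ + _).
  by rewrite !binK0 subr0 mulr1 scale1r.
under [in X in X + _ = _]eq_bigr do rewrite lift0.
have -> : \sum_(i < m) ((m.+1%:R - i.+1%:R) * binK d i.+1) *: Z i.+1 =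
   \sum_(i < m.+1) ((m.+1%:R - i.+1%:R) * binK d i.+1) *: Z i.+1.
  by rewrite big_ord_recr /= subrr mul0r scale0r addr0.
rewrite -big_split /=; apply: eq_bigr => k _; rewrite /bump leq0n add1n -scalerDl scalerA.
congr (_ *: _); rewrite binK_pascal //.
have := binKS charK d k; rewrite -!natr1 => e.
have -> : (m%:R + 1 - (k%:R + 1)) * binK d k.+1 = m%:R * binK d k.+1 - (k%:R + 1) * binK d k.+1 + binK d k.+1 by ring.
rewrite e; ring.
Qed.
End RankOne.
End DividedPowers.

(** Sorts a product of two truncated exponentials by total degree; inside the square of side M the
    total degree stays below M + M. *)
Lemma sum_triangle (W : nmodType) (t : nat -> nat -> W) M :
  (forall k j, (M <= k)%N -> t k j = 0) -> (forall k j, (M <= j)%N -> t k j = 0) ->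
  \sum_(k < M) \sum_(j < M) t k j = \sum_(n < M + M) \sum_(k < n.+1) t k (n - k)%N.
Proof.
move=> tl tr.
have ext (f : nat -> W) : (forall k, (M <= k)%N -> f k = 0) ->
    \sum_(k < M) f k = \sum_(k < M + M) f k.
  move=> f0; rewrite big_split_ord /= [X in _ + X]big1 ?addr0 // => k _.
  by rewrite f0 // leq_addr.
transitivity (\sum_(k < M + M) \sum_(j < M + M) t k j).
  rewrite -(ext (fun k => \sum_(j < M + M) t k j)).
    by apply: eq_bigr => k _; rewrite (ext (t k)) // => j; apply: tr.
  by move=> k Mk; rewrite big1 // => j _; apply: tl.
transitivity (\sum_(n < M + M) \sum_(k < M + M) \sum_(j < M + M | (k + j == n)%N) t k j).
  rewrite [RHS]exchange_big /=; apply: eq_bigr => k _.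
  rewrite [RHS](exchange_big_dep xpredT) //=; apply: eq_bigr => j _.
  have [kj|kj] := ltnP (k + j) (M + M).
    by rewrite (big_pred1 (Ordinal kj)) // => n; rewrite eq_sym.
  rewrite big_pred0; last by move=> n; apply/eqP => e; move: (ltn_ord n); rewrite -e ltnNge kj.
  have [Mk|kM] := leqP M k; first exact: tl.
  by apply: tr; lia.
apply: eq_bigr => n _.
rewrite [RHS](big_ord_widen (M + M) (fun k => t k (n - k)%N)) //.
rewrite [RHS]big_mkcond; apply: eq_bigr => k _; rewrite ltnS.
case: leqP => [kn|nk]; last first.
  by rewrite big1 // => j /eqP e; move: nk; rewrite -e ltnNge leq_addr.
have jl : (n - k < M + M)%N by apply: leq_ltn_trans (leq_subr _ _) _.
rewrite (big_pred1 (Ordinal jl)) // => j; apply/eqP/eqP => [e|->] /=.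
  by apply: val_inj; rewrite /= -e addKn.
by rewrite subnKC.
Qed.

Section Leibniz.
Variables (K : fieldType) (charK : [pchar K] =i pred0) (U V W : lmodType K).
Variables (b : U -> V -> W).
Hypothesis b_linl : forall v, linear (b^~ v).
Hypothesis b_linr : forall u, linear (b u).
Variables (DU : {linear U -> U}) (DV : {linear V -> V}) (DW : {linear W -> W}).
Hypothesis Db : forall u v, DW (b u v) = b (DU u) v + b u (DV v).

Let bZl a u v : b (a *: u) v = a *: b u v.
Proof.
have b0 : b 0 v = 0 by have := b_linl v 1 0 0; rewrite scaler0 addr0 scale1r => /(congr1 (fun x => x - b 0 v)); rewrite subrr addrK.
by have := b_linl v a u 0; rewrite !addr0 b0 addr0.
Qed.
Let bZr a u v : b u (a *: v) = a *: b u v.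
Proof.
have b0 : b u 0 = 0 by have := b_linr u 1 0 0; rewrite scaler0 addr0 scale1r => /(congr1 (fun x => x - b u 0)); rewrite subrr addrK.
by have := b_linr u a v 0; rewrite !addr0 b0 addr0.
Qed.

(** Dividing by n! absorbs the binomial coefficients of the Leibniz rule, so integrality of the
    divided powers on both arguments passes to the value of [b]. *)
Lemma dpow_leibniz n u v :
  dpow DW n (b u v) = \sum_(k < n.+1) b (dpow DU k u) (dpow DV (n - k) v).
Proof.
elim: n => [|n IHn]; first by rewrite big_ord1 !dpow0.
apply: (@scale_natI _ charK _ n); rewrite -dpowS // IHn linear_sum /=.
pose Y k := b (dpow DU k u) (dpow DV (n.+1 - k) v).
transitivity (\sum_(k < n.+1) (n.+1%:R - k%:R) *: Y k + \sum_(k < n.+1) k.+1%:R *: Y k.+1).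
  rewrite -big_split /=; apply: eq_bigr => k _.
  have km : (k <= n)%N by rewrite -ltnS.
  rewrite Db !dpowS // bZl bZr addrC /Y subSS -subSn //.
  by congr (_ *: _ + _); rewrite natrB // ltnW.
have -> : \sum_(k < n.+1) (n.+1%:R - k%:R) *: Y k = \sum_(k < n.+2) (n.+1%:R - k%:R) *: Y k.
  by rewrite [RHS]big_ord_recr /= subrr scale0r addr0.
have -> : \sum_(k < n.+1) k.+1%:R *: Y k.+1 = \sum_(k < n.+2) k%:R *: Y k.
  by rewrite [RHS]big_ord_recl scale0r add0r.
rewrite -big_split /= scaler_sumr; apply: eq_bigr => k _.
by rewrite -scalerDl subrK.
Qed.

Definition expo (T : lmodType K) (x : T -> T) N (v : T) : T := \sum_(n < N) dpow x n v.

(** The exponential of a derivation is multiplicative. If both arguments die in degree M, their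
    product dies in degree M + M, hence the two truncations. *)
Lemma expo_leibniz M u v :
  (forall k, (M <= k)%N -> dpow DU k u = 0) -> (forall k, (M <= k)%N -> dpow DV k v = 0) ->
  expo DW (M + M) (b u v) = b (expo DU M u) (expo DV M v).
Proof.
move=> u0 v0; rewrite /expo.
have b0l y : b 0 y = 0 by rewrite -(scale0r (0 : U)) bZl scale0r.
have b0r y : b y 0 = 0 by rewrite -(scale0r (0 : V)) bZr scale0r.
have bDl x y z : b (x + y) z = b x z + b y z.
  by have := b_linl z 1 x y; rewrite !scale1r.
have bDr x y z : b x (y + z) = b x y + b x z.
  by have := b_linr x 1 y z; rewrite !scale1r.
transitivity (\sum_(k < M) \sum_(j < M) b (dpow DU k u) (dpow DV j v)); last first.
  rewrite (big_morph (b^~ _) (fun x y => bDl x y _) (b0l _)).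
  by apply: eq_bigr => k _; rewrite (big_morph (b _) (bDr _) (b0r _)).
rewrite (sum_triangle (t := fun k j => b (dpow DU k u) (dpow DV j v))).
- by apply: eq_bigr => n _; rewrite dpow_leibniz.
- by move=> k j Mk; rewrite u0 // b0l.
- by move=> k j Mj; rewrite v0 // b0r.
Qed.
End Leibniz.

Lemma expo_widen (K : fieldType) (T : lmodType K) (x : T -> T) M N v : (M <= N)%N ->
  (forall k, (M <= k)%N -> dpow x k v = 0) -> expo x N v = expo x M v.
Proof.
move=> MN x0; rewrite /expo -(subnKC MN) big_split_ord /= [X in _ + X]big1 ?addr0 // => k _.
by rewrite x0 // leq_addr.
Qed.

(** [Deg n x] is a potential that drops with every operator, so only words of length at most n in
    the finitely many operators can be nonzero. The last clause is an induction principle: all of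
    [l'] is reached from [l] by these operators. *)
Lemma finite_closure (V : zmodType) (I : eqType) (ops : seq I) (op : I -> V -> V)
    (Deg : nat -> V -> Prop) :
  (forall n x i, i \in ops -> Deg n.+1 x -> op i x = 0 \/ Deg n (op i x)) ->
  (forall x i, i \in ops -> Deg 0 x -> op i x = 0) ->
  forall n (l : seq V), (forall x, x \in l -> Deg n x) ->
  exists l' : seq V, [/\ {subset l <= l'},
    forall x i, x \in l' -> i \in ops -> op i x = 0 \/ op i x \in l' &
    forall P : V -> Prop, (forall x, x \in l -> P x) ->
      (forall x i, x \in l' -> P x -> i \in ops -> P (op i x)) ->
      forall x, x \in l' -> P x].
Proof.
move=> DegS Deg0; elim=> [|n IHn] l lD.
  by exists l; split=> // x i /lD xD iops; left; apply: Deg0.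
pose l1 := [seq y <- [seq op i x | x <- l, i <- ops] | y != 0].
have [|l' [sl' cl' Pl']] := IHn l1.
  move=> y; rewrite mem_filter => /andP [yn0 /allpairsP [[x i] /= [xl iops yE]]].
  have [y0|] := DegS n x i iops (lD _ xl); last by rewrite yE.
  by move: yn0; rewrite yE y0 eqxx.
exists (l ++ l'); split.
- by move=> x xl; rewrite mem_cat xl.
- move=> x i; rewrite !mem_cat => /orP [xl|xl'] iops.
    case: (eqVneq (op i x) 0) => [->|yn0]; [by left | right; apply/orP; right].
    by apply: sl'; rewrite mem_filter yn0; apply/allpairsP; exists (x, i).
  by have [->|h] := cl' _ _ xl' iops; [left | right; rewrite h orbT].
move=> P Pl PS x; rewrite mem_cat => /orP [/Pl //|].
apply: Pl'; last by move=> z i zl'; apply: PS; rewrite mem_cat zl' orbT.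
move=> y; rewrite mem_filter => /andP [_ /allpairsP [[z i] /= [zl iops ->]]].
by apply: PS => //; [rewrite mem_cat zl | apply: Pl].
Qed.


HB.instance Definition _ (K : fieldType) (G : lieSuperalg K) (V : superModule G) (x : G) :=
  GRing.isLinear.Build K V V *:%R (@act K G V x) (@act_linearr K G V x).
HB.instance Definition _ (K : fieldType) (G : lieSuperalg K) (x : G) :=
  GRing.isLinear.Build K G G *:%R (@br K G x) (@br_linearr K G x).

(** * Chevalley bases *)

Section LieBasics.
Variables (K : fieldType) (G : lieSuperalg K).
Implicit Types (x y z : G).

Lemma brDl x y z : br (x + y) z = br x z + br y z.
Proof. by have := @br_linearl K G z 1 x y; rewrite !scale1r. Qed.
Lemma br0l z : br (0 : G) z = 0.
Proof. by apply: (addIr (br 0 z)); rewrite -brDl !add0r. Qed.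
Lemma brZl a y z : br (a *: y) z = a *: br y z.
Proof. by have := @br_linearl K G z a y 0; rewrite !addr0 br0l addr0. Qed.
Lemma brNl y z : br (- y) z = - br y z.
Proof. by rewrite -scaleN1r brZl scaleN1r. Qed.
Lemma lpart_decomp x : exists2 u, u \in lpart G false & exists2 v, v \in lpart G true & x = u + v.
Proof.
have: x \in (lpart G false + lpart G true)%VS by rewrite lpart_full memvf.
by case/memv_addP => u uP [v vP ->]; exists u => //; exists v.
Qed.

Lemma lpart_both b b' x : x \in lpart G b -> x \in lpart G b' -> x != 0 -> b = b'.
Proof.
move=> xb xb' x0; case: (eqVneq b b') => // bb'.
have: x \in (lpart G false :&: lpart G true)%VS.
  by rewrite memv_cap; move: b b' bb' xb xb' => [] [] // _ -> ->.
by rewrite lpart_cap memv0 (negPf x0).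
Qed.

Lemma br_skew_even x y : x \in lpart G false -> br x y = - br y x.
Proof.
move=> x0; have [u u0 [v v1 ->]] := lpart_decomp y.
rewrite linearD /= brDl opprD (br_skew x0 u0) (br_skew x0 v1) /= expr0 !scale1r //.
Qed.

Lemma br_jacobi_even x y z : x \in lpart G false ->
  br x (br y z) = br (br x y) z + br y (br x z).
Proof.
move=> x0.
have H i j u w : u \in lpart G i -> w \in lpart G j ->
    br x (br u w) = br (br x u) w + br u (br x w).
  by move=> ui wj; rewrite (br_jacobi _ x0 ui) /= expr0 scale1r.
have brDr (a b c : G) : br a (b + c) = br a b + br a c by rewrite linearD.
have H2 i u w : u \in lpart G i -> br x (br u w) = br (br x u) w + br u (br x w).
  move=> ui; have [w0 w00 [w1 w11 ->]] := lpart_decomp w.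
  by rewrite !brDr (H _ _ _ _ ui w00) (H _ _ _ _ ui w11) addrACA.
have [u u0 [v v1 ->]] := lpart_decomp y.
by rewrite !(brDr, brDl) (H2 _ _ _ u0) (H2 _ _ _ v1) addrACA.
Qed.

End LieBasics.

Section ActBasics.
Variables (K : fieldType) (G : lieSuperalg K) (V : superModule G).
Implicit Types (x y : G) (v : V).

Lemma actDl x y v : act (x + y) v = act x v + act y v.
Proof. by have := @act_linearl K G V v 1 x y; rewrite !scale1r. Qed.
Lemma act0l v : act (0 : G) v = 0.
Proof. by apply: (addIr (act 0 v)); rewrite -actDl !add0r. Qed.
Lemma actZl a y v : act (a *: y) v = a *: act y v.
Proof. by have := @act_linearl K G V v a y 0; rewrite !addr0 act0l addr0. Qed.
Lemma actNl y v : act (- y) v = - act y v.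
Proof. by rewrite -scaleN1r actZl scaleN1r. Qed.
Lemma actBl x y v : act (x - y) v = act x v - act y v.
Proof. by rewrite actDl actNl. Qed.

Lemma act_br_even x y v : x \in lpart G false ->
  act x (act y v) = act (br x y) v + act y (act x v).
Proof.
move=> x0; have [u u0 [w w1 ->]] := lpart_decomp y.
rewrite !actDl !linearD /= !actDl (act_br v x0 u0) (act_br v x0 w1) /= expr0 !scale1r.
by rewrite addrACA !subrK.
Qed.

Lemma act_br_odd x y v : x \in lpart G true -> y \in lpart G true ->
  act x (act y v) = act (br x y) v - act y (act x v).
Proof. by move=> x1 y1; rewrite (act_br v x1 y1) /= expr1 scaleN1r opprK addrK. Qed.

Lemma mpart_decomp v : exists2 u, u \in mpart V false & exists2 w, w \in mpart V true & v = u + w.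
Proof.
have: v \in (mpart V false + mpart V true)%VS by rewrite mpart_full memvf.
by case/memv_addP => u uP [w wP ->]; exists u => //; exists w.
Qed.

Lemma mpart_inj u u' w w' : u \in mpart V false -> u' \in mpart V false ->
  w \in mpart V true -> w' \in mpart V true -> u + w = u' + w' -> u = u' /\ w = w'.
Proof.
move=> u0 u'0 w1 w'1 e.
have d : u - u' = w' - w by apply/eqP; rewrite subr_eq addrAC -subr_eq opprK e addrC.
have: u - u' \in (mpart V false :&: mpart V true)%VS by rewrite memv_cap {2}d !memvB.
rewrite mpart_cap memv0 => /eqP d0; split; first exact: subr0_eq.
by apply/esym/subr0_eq; rewrite -d.
Qed.
End ActBasics.

(** The interface between the root data and the lattice construction. In [gc_odd] the coefficient is
    even because the square of an odd X_a in U(g) is half of [X_a, X_a] and has to be integral;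
    [gc_exc] ensures that brackets with an even X_a follow the r + 1 rule. *)
Record good_chevalley (K : fieldType) (G : lieSuperalg K) (h : {vspace G})
    (D : rootData h) (pos : pred (rlat D)) (B : chevalley_basis pos) : Prop := {
  gc_even : (h <= lpart G false)%VS;
  gc_rwtD : forall a b : rlat D, rwt (a + b) = rwt a + rwt b;
  gc_inj : forall a b : rlat D, isroot a -> isroot b -> rwt a = rwt b -> a = b;
  gc_neq0 : forall a : rlat D, isroot a -> rwt a != 0;
  gc_par : forall b (a : rlat D), proot b a -> ch_X B a \in lpart G b;
  gc_par' : forall b (a : rlat D), isroot a -> ch_X B a \in lpart G b -> proot b a;
  gc_opp : forall a : rlat D, proot false a -> proot false (- a);
  gc_coroot : forall a : rlat D, proot false a -> rwt a (coroot a) = 2;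
  gc_sq : forall a : rlat D, proot false a -> sqnorm a != 0;
  gc_exc : forall a b : rlat D, proot false a -> ~ exceptional a b;
  gc_int : forall (a b : rlat D) c, isroot a -> isroot b -> a <> - b -> isroot (a + b) ->
    structure_constant a b c -> zint c;
  gc_odd : forall a : rlat D, proot true a ->
    exists2 m : int, br (ch_X B a) (ch_X B a) = (2 * m)%:~R *: ch_X B (a + a) &
      m = 0 \/ proot false (a + a);
  gc_intw : forall (a : rlat D) i, isroot a -> zint (rwt a (ch_H B i) : K)
}.

Section BasisFacts.
Variables (K : fieldType) (charK : [pchar K] =i pred0) (G : lieSuperalg K) (h : {vspace G}).
Variables (D : rootData h) (pos : pred (rlat D)) (B : chevalley_basis pos).
Local Notation X := (ch_X B).
Local Notation HH i := (vsval (ch_H B i)).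
Implicit Types (a b : rlat D) (y : subvs_of h).

Lemma hspan_ind (P : subvs_of h -> Prop) : P 0 ->
  (forall (c : K) y y', P y -> P y' -> P (c *: y + y')) -> (forall i, P (ch_H B i)) ->
  forall y, P y.
Proof.
move=> P0 PD PH y.
have [U UP] := vspace_comprehension P0 PD.
apply/UP; suff /subvP : (fullv <= U)%VS by apply; exact: memvf.
rewrite -(span_basis (ch_H_basis B)); apply/span_subvP => z /imageP [i _ ->]; exact/UP.
Qed.

Lemma ch_weight a y : isroot a -> br (vsval y) (X a) = rwt a y *: X a.
Proof.
move=> ra; elim/hspan_ind: y => [|c y y' Hy Hy'|i].
- by rewrite !linear0 br0l scale0r.
- by rewrite !linearP brDl brZl Hy Hy' scalerDl scalerA.
- exact: ch_HX.
Qed.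

Lemma ch_comm y y' : br (vsval y) (vsval y') = 0.
Proof.
elim/hspan_ind: y => [|c y z Hy Hz|i].
- by rewrite linear0 br0l.
- by rewrite linearP brDl brZl Hy Hz scaler0 addr0.
elim/hspan_ind: y' => [|c y z Hy Hz|j].
- by rewrite !linear0.
- by rewrite !linearP /= Hy Hz scaler0 addr0.
- exact: ch_HH.
Qed.

Lemma ch_X_neq0 a : isroot a -> X a != 0.
Proof.
move=> ra; apply: (basis_not0 (ch_basis B)); rewrite mem_cat; apply/orP; right.
by apply: map_f; apply/mem_ch_roots.
Qed.

Lemma span_map_sum (I : eqType) (s : seq I) (f : I -> G) x : uniq s ->
  x \in <<[seq f i | i <- s]>>%VS -> exists c : I -> K, x = \sum_(i <- s) c i *: f i.
Proof.
elim: s x => [|i s IHs] x /=.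
  by rewrite span_nil memv0 => _ /eqP ->; exists (fun=> 0); rewrite big_nil.
move=> /andP [si us]; rewrite span_cons => /memv_addP [_ /vlineP [k ->] [z zs ->]].
have [c ->] := IHs z us zs; exists (fun j => if j == i then k else c j).
rewrite big_cons eqxx; congr (_ + _); apply: eq_big_seq => j js.
by case: eqP si => // <-; rewrite js.
Qed.

Lemma ch_expand x : exists y (c : rlat D -> K), x = vsval y + \sum_(a <- ch_roots B) c a *: X a.
Proof.
have: x \in fullv by exact: memvf.
rewrite -(span_basis (ch_basis B)) span_cat => /memv_addP [u uH [w wX ->]].
have [c ->] := span_map_sum (ch_roots_uniq B) wX.
suff [y ->] : exists y, u = vsval y by exists y, c.
have: u \in h.
  apply: subvP uH; apply/span_subvP => z /imageP [i _ ->]; exact: subvsP.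
by move=> uh; exists (vsproj h u); rewrite vsprojK.
Qed.

Lemma ch_ind (P : G -> Prop) : (forall (c : K) x x', P x -> P x' -> P (c *: x + x')) -> P 0 ->
  (forall i, P (HH i)) -> (forall a, isroot a -> P (X a)) -> forall x, P x.
Proof.
move=> PD P0 PH PX x.
have [U UP] := vspace_comprehension P0 PD.
apply/UP; suff /subvP : (fullv <= U)%VS by apply; exact: memvf.
rewrite -(span_basis (ch_basis B)); apply/span_subvP => z; rewrite mem_cat => /orP [].
  by move=> /imageP [i _ ->]; apply/UP.
by move=> /mapP [a /mem_ch_roots ra ->]; apply/UP/PX.
Qed.

Hypothesis rwt_inj : forall a b, isroot a -> isroot b -> rwt a = rwt b -> a = b.
Hypothesis rwt_neq0 : forall a, isroot a -> rwt a != 0.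

(** Vectors of distinct weights are independent, so the terms of the expansion of [x] whose weight
    differs from [mu] vanish. The Cartan part has weight 0, which [mu] and all roots avoid. *)
Lemma ch_root_space_coord (mu : 'Hom(subvs_of h, K^o)) x : mu != 0 -> root_vector mu x ->
  forall y c, x = vsval y + \sum_(a <- ch_roots B) c a *: X a ->
  vsval y = 0 /\ forall a, isroot a -> rwt a != mu -> c a = 0.
Proof.
move=> mu0 mux y c xE.

have E (f : 'Hom(subvs_of h, K^o)) (g : 'Hom(subvs_of h, K^o)) : f != g -> exists z, f z != g z.
  move=> fg; apply: contrapT => nz; case/eqP: fg; apply/lfunP => z.
  by apply: contrapT => /eqP h1; apply: nz; exists z.
pose s := filter (fun a => rwt a != mu) (ch_roots B).
pose t := filter (fun a => rwt a == mu) (ch_roots B).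
(* [None] is the part of weight [mu] minus [x], [Some None] the Cartan part, [Some (Some a)] the
   term of a root of another weight; together they sum to 0. *)
pose ev (i : option (option (rlat D))) z : K := match i with
  | None => mu z | Some None => 0 | Some (Some a) => rwt a z end.
pose w' (i : option (option (rlat D))) : G := match i with
  | None => \sum_(a <- t) c a *: X a - x | Some None => vsval y | Some (Some a) => c a *: X a end.
pose ss := None :: Some None :: [seq Some (Some a) | a <- s].
have ss_roots a : a \in s -> isroot a by rewrite mem_filter => /andP [_ /mem_ch_roots].
have H : forall i, i \in ss -> w' i = 0.
  apply: (@eigen_components K G _ (subvs_of h) (fun z => br (vsval z)) ev (fun x => x = 0)) => //.
  - by move=> ? ? -> ->; rewrite subr0.
  - by move=> ? ? ->; rewrite scaler0.
  - by move=> ? ? ->; rewrite linear0.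
  - rewrite /ss /= !inE /= map_inj_uniq ?filter_uniq ?ch_roots_uniq //; last by move=> ? ? [].
    by rewrite andbT; apply/andP; split; apply/negP => /mapP [].
  - have ne a : a \in s -> rwt a != mu by rewrite mem_filter => /andP [].
    move=> i j; rewrite /ss !inE => /or3P [/eqP->|/eqP->|/mapP [a as_ ->]]
        /or3P [/eqP->|/eqP->|/mapP [b bs ->]] //= ij.
    + by have [z] := E _ _ mu0; rewrite zero_lfunE => zP; exists z.
    + by have [z zP] := E _ _ (ne _ bs); exists z; rewrite eq_sym.
    + by have [z] := E _ _ mu0; rewrite zero_lfunE => zP; exists z; rewrite eq_sym.
    + by have [z] := E _ _ (rwt_neq0 (ss_roots _ bs)); rewrite zero_lfunE => zP; exists z; rewrite eq_sym.
    + by have [z zP] := E _ _ (ne _ as_); exists z.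
    + by have [z] := E _ _ (rwt_neq0 (ss_roots _ as_)); rewrite zero_lfunE => zP; exists z.
    + apply: E; apply: contra_neq ij => ab; congr (Some (Some _)).
      by apply: rwt_inj ab; apply: ss_roots.
  - move=> i z; rewrite /ss !inE => /or3P [/eqP->|/eqP->|/mapP [a as_ ->]] /=.
    + rewrite linearB linear_sum /= mux scalerBr scaler_sumr; congr (_ - _).
      apply: eq_big_seq => a; rewrite mem_filter => /andP [/eqP amu /mem_ch_roots ra].
      by rewrite linearZ /= ch_weight // amu !scalerA mulrC.
    + by rewrite ch_comm scale0r.
    + by rewrite linearZ /= (ch_weight z (ss_roots _ as_)) !scalerA mulrC.
  - rewrite /ss !big_cons big_map /= xE /t /s !big_filter.
    rewrite [X in _ - (_ + X)](bigID (fun a => rwt a == mu)) /=.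
    by rewrite addrAC addrCA subrr.
split; first by apply: (H (Some None)); rewrite !inE.
move=> a ra amu; have := H (Some (Some a)); rewrite /ss !inE mem_map; last by move=> ? ? [].
rewrite mem_filter amu (introT idP ((mem_ch_roots B a).2 ra)) => /(_ isT) /eqP.
by rewrite scaler_eq0 (negPf (ch_X_neq0 ra)) orbF => /eqP.
Qed.

Lemma ch_root_space a x : isroot a -> root_vector (rwt a) x -> exists c, x = c *: X a.
Proof.
move=> ra rx; have [y [c xE]] := ch_expand x.
have [y0 c0] := ch_root_space_coord (rwt_neq0 ra) rx xE.
exists (c a); rewrite xE y0 add0r (bigD1_seq a) ?ch_roots_uniq //=; last exact/mem_ch_roots.
rewrite big1_seq ?addr0 // => b /andP [ba /mem_ch_roots rb].
by rewrite c0 ?scale0r //; apply: contra_neq ba; apply: rwt_inj.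
Qed.
End BasisFacts.


Section ChevalleyFacts.
Variables (K : fieldType) (charK : [pchar K] =i pred0) (G : lieSuperalg K) (h : {vspace G}).
Variables (D : rootData h) (pos : pred (rlat D)) (B : chevalley_basis pos).
Hypothesis gc : good_chevalley B.
Local Notation X := (ch_X B).
Local Notation HH i := (vsval (ch_H B i)).
Implicit Types (a b : rlat D) (y : subvs_of h).

Lemma root_even a : proot false a -> isroot a. Proof. by left. Qed.

Lemma h_is_even y : vsval y \in lpart G false.
Proof. exact: (subvP (gc_even gc) _ (subvsP y)). Qed.

Lemma rwt0 : rwt (0 : rlat D) = 0.
Proof. by apply: (addIr (rwt (0 : rlat D))); rewrite -(gc_rwtD gc) !add0r. Qed.
Lemma rwtN a : rwt (- a) = - rwt a.
Proof. by apply: (addIr (rwt a)); rewrite -(gc_rwtD gc) !addNr rwt0. Qed.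
Lemma rwt_mulrn_neq0 a n : isroot a -> (0 < n)%N -> rwt a *+ n != 0.
Proof.
move=> ra n0; rewrite -scaler_nat scaler_eq0 negb_or (gc_neq0 gc ra) andbT.
exact: natK_neq0.
Qed.

Lemma root_neq_opp a : isroot a -> a <> - a.
Proof.
move=> ra e; have /eqP := rwt_mulrn_neq0 ra (ltn0Sn 1); apply.
by rewrite mulr2n {2}e -(gc_rwtD gc) subrr rwt0.
Qed.

Lemma even_not_odd a : proot false a -> proot true a -> False.
Proof.
move=> ra0 /(gc_par gc) a1.
by have := lpart_both (gc_par gc ra0) a1 (ch_X_neq0 B (root_even ra0)).
Qed.

Definition gZ := zspan (fun x : G => (exists i, x = HH i) \/ (exists2 a, isroot a & x = X a)).
Definition hZ := zspan (fun y : subvs_of h => exists i, y = ch_H B i).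

Lemma gZ_closed : zclosed gZ. Proof. exact: zspan_closed. Qed.
Lemma gZ_X a : isroot a -> gZ (X a).
Proof. by move=> ra; apply: zspan_in; right; exists a. Qed.
Lemma gZ_h y : hZ y -> gZ (vsval y).
Proof.
apply: (@zspan_additive _ _ (fun y : subvs_of h => vsval y)) => [? ?||_ [i ->]].
- by rewrite linearB.
- exact: gZ_closed.
- by apply: zspan_in; left; exists i.
Qed.

Lemma hZ_closed : zclosed hZ. Proof. exact: zspan_closed. Qed.

Lemma hZ_coroot a : isroot a -> isroot (- a) -> hZ (coroot a).
Proof. by move=> ra rNa; apply/ch_H_span; apply: zspan_in; exists a. Qed.

Lemma hZ_int a y : isroot a -> hZ y -> zint (rwt a y : K).
Proof.
move=> ra; apply: (@zspan_additive _ _ (fun y => rwt a y)) => [? ?||_ [i ->]].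
- by rewrite linearB.
- exact: zint_closed.
- exact: (gc_intw gc).
Qed.

Lemma ch_XNX a : proot false a -> br (X a) (X (- a)) = vsval (coroot a).
Proof.
move=> ra; rewrite ch_XXopp; [|exact: root_even|exact/root_even/(gc_opp gc)].
by rewrite asboolF ?scale1r //; apply: even_not_odd.
Qed.

Lemma ch_bracket a b : isroot a -> isroot b -> gZ (br (X a) (X b)).
Proof.
move=> ra rb; have [e|ne] := pselect (a = - b).
  have rNa : isroot (- a) by rewrite e opprK.
  have -> : b = - a by rewrite e opprK.
  rewrite ch_XXopp //; apply: zclosedZ; first exact: gZ_closed.
    by case: ifP => _; [exists (-1); rewrite intrN | exists 1].
  exact/gZ_h/hZ_coroot.
have [rab|nr] := pselect (isroot (a + b)).
  have [c sc ->] := ch_XX B ra rb ne rab.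
  by apply: zclosedZ; [exact: gZ_closed | apply: (gc_int gc) sc | apply: gZ_X].
by rewrite ch_XX0 //; apply: zclosed0 gZ_closed.
Qed.

(** If 2a were a root, [X_a, X_a] would be a nonzero multiple, by r + 1 up to sign, of X_2a; but the
    bracket is skew on even elements. *)
Lemma even_double_not_root a : proot false a -> ~ isroot (a + a).
Proof.
move=> ra r2; have r := root_even ra.
have [c [sc _ _] e] := ch_XX B r r (root_neq_opp r) r2.
have [|m _ cm] := sc _ (gc_exc gc ra); first by left; apply: (gc_sq gc).
have : br (X a) (X a) = 0.
  have := br_skew_even (X a) (gc_par gc ra) => /eqP.
  rewrite -addr_eq0 -mulr2n -scaler_nat scaler_eq0 (negPf (natK_neq0 charK (ltn0Sn 1))).
  by move/eqP.
rewrite e => /eqP; rewrite scaler_eq0 (negPf (ch_X_neq0 B r2)) orbF => /eqP c0.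
by case: cm; rewrite c0 => /esym/eqP; rewrite ?oppr_eq0 (negPf (natK_neq0 charK (ltn0Sn m))).
Qed.

Lemma even_Ndouble_not_root a : proot false a -> ~ isroot (- a - a).
Proof. by move=> ra; apply: even_double_not_root; apply: (gc_opp gc). Qed.

Lemma string_left_uniq a b r r' : string_left a b r -> string_left a b r' -> r = r'.
Proof.
move=> [s1 s2] [s1' s2']; case: (ltngtP r r') => // lt.
- by case: s2; apply: s1'.
- by case: s2'; apply: s1.
Qed.

Lemma string_left_shift a b r : isroot (a + b) -> string_left a b r ->
  string_left a (a + b) r.+1.
Proof.
move=> rab [s1 s2].
have E j : a + b - a *+ j.+1 = b - a *+ j by rewrite mulrS opprD addrACA subrr add0r.
split; last by rewrite E.
by case=> [|j] jr; [left; rewrite mulr0n subr0 | rewrite E; apply: s1].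
Qed.

(** Every application of X_a raises r by one, so the structure constants multiply to (r+1)...(r+k) =
    k! bin(r+k, k) up to sign. Hence the k-th divided power of ad X_a is integral on X_b. *)
Lemma ad_even_string a b r k : proot false a -> isroot b -> b <> - a -> string_left a b r ->
  exists2 m : int, iter k (br (X a)) (X b) = (m * k`!)%:~R *: X (b + a *+ k) &
     m = 0 \/ (isroot (b + a *+ k) /\ `|m|%N = 'C(r + k, k)).
Proof.
move=> ra; elim: k b r => [|k IHk] b r rb ne sl.
  by exists 1; [rewrite mulr0n addr0 mul1r scale1r | right; rewrite mulr0n addr0 bin0].
have ne' : a <> - b by move=> e; apply: ne; rewrite e opprK.
rewrite iterSr; have [rab|nr] := pselect (isroot (a + b)); last first.
  exists 0; last by left.
  rewrite (ch_XX0 B (root_even ra) rb ne' nr) mul0r scale0r.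
  by elim: k {IHk} => //= k ->; rewrite linear0.
have [c [sc _ _] ->] := ch_XX B (root_even ra) rb ne' rab.
have [|r' slr' cr'] := sc _ (gc_exc gc ra); first by left; apply: (gc_sq gc).
have rr' := string_left_uniq sl slr'; rewrite -rr' {r' slr' rr'} in cr'.
have ne2 : a + b <> - a.
  move=> e; apply: (even_Ndouble_not_root ra); suff -> : - a - a = b by [].
  by rewrite -{1}e addrAC subrr add0r.
have [m em hm] := IHk _ _ rab ne2 (string_left_shift rab sl).
have [s cE s1] : exists2 s : int, c = (s * r.+1%:Z)%:~R & `|s|%N = 1%N.
  by case: cr' => ->; [exists 1 | exists (-1)] => //; rewrite ?mul1r // mulN1r intrN.
have itZ (d : K) z : iter k (br (X a)) (d *: z) = d *: iter k (br (X a)) z.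
  by elim: k {IHk em hm} => //= j ->; rewrite linearZ.
have Eb : a + b + a *+ k = b + a *+ k.+1 by rewrite mulrS addrCA addrA.
rewrite itZ em scalerA Eb; case: hm => [m0|[rk mk]].
  by exists 0; [rewrite m0 !mul0r mulr0 | left].
have binE : (r.+1 * 'C(r.+1 + k, k) = k.+1 * 'C(r + k.+1, k.+1))%N.
  by rewrite addSnnS mul_bin_left addnS subSn ?leq_addl // addnK.
have kk : (k.+1%:Z != 0 :> int) by [].
exists (s * sgz m * 'C(r + k.+1, k.+1)%:Z); last first.
  right; split; first by rewrite -Eb.
  rewrite !abszM s1 mul1n absz_nat.
  have m0 : m != 0 by rewrite -absz_eq0 mk -lt0n bin_gt0 leq_addl.
  by case: sgzP m0 => //; rewrite mul1n.
congr (_ *: _); rewrite cE -intrM; congr (_%:~R).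
have mE : m = sgz m * 'C(r.+1 + k, k)%:Z by rewrite -mk; exact: intEsg.
rewrite {1}mE factS PoszM; have := congr1 Posz binE; rewrite !PoszM => e.
rewrite -!mulrA; congr (s * _); rewrite mulrCA; congr (_ * _).
by rewrite [RHS]mulrA [X in _ = X * _]mulrC -e mulrA. 
Qed.

Lemma ad_even_root a b k : proot false a -> isroot b -> b <> - a ->
  exists2 m : int, iter k (br (X a)) (X b) = (m * k`!)%:~R *: X (b + a *+ k) &
     m = 0 \/ isroot (b + a *+ k).
Proof.
move=> ra rb ne; case: k => [|k].
  by exists 1; [rewrite mulr0n addr0 mul1r scale1r | right; rewrite mulr0n addr0].
have ne' : a <> - b by move=> e; apply: ne; rewrite e opprK.
have [rab|nr] := pselect (isroot (a + b)).
  have [c [sc _ _] _] := ch_XX B (root_even ra) rb ne' rab.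
  have [|r sl _] := sc _ (gc_exc gc ra); first by left; apply: (gc_sq gc).
  have [m -> hm] := ad_even_string k.+1 ra rb ne sl.
  by exists m => //; case: hm => [|[]]; auto.
exists 0; last by left.
rewrite iterSr (ch_XX0 B (root_even ra) rb ne' nr) mul0r scale0r.
by elim: k => //= k ->; rewrite linear0.
Qed.

Lemma br_XH a y : isroot a -> proot false a -> br (X a) (vsval y) = - (rwt a y *: X a).
Proof. by move=> r ra; rewrite (br_skew_even _ (gc_par gc ra)) (ch_weight B y r). Qed.

Lemma br_XX a : proot false a -> br (X a) (X a) = 0.
Proof.
move=> ra; apply: ch_XX0; [exact: root_even|exact: root_even| |exact: even_double_not_root].
exact/root_neq_opp/root_even.
Qed.

Lemma iter_br0 (u z : G) k j : iter j (br u) z = 0 -> iter (j + k) (br u) z = 0.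
Proof. by rewrite addnC iterD => ->; elim: k => //= k ->; rewrite linear0. Qed.

(** Outside the rank one part of [a] the binomials of [ad_even_string] give integrality. Inside it
    the only denominator is the 1/2 in the second divided power on X_{-a}, cancelled by a(H_a) = 2;
    higher powers vanish. *)
Lemma gZ_dpow a n x : proot false a -> gZ x -> gZ (dpow (br (X a)) n x).
Proof.
move=> ra; have r := root_even ra.
apply: (@zspan_additive _ _ (dpow (br (X a)) n)).
- by move=> u v; rewrite linearB.
- exact: gZ_closed.
have zero k (z : G) : br (X a) z = 0 -> dpow (br (X a)) k.+1 z = 0.
  by move=> z0; rewrite dpow_eq0 // (iter_br0 k (j := 1)).
have hcase k y : hZ y -> gZ (dpow (br (X a)) k (vsval y)).
  move=> hy; case: k => [|[|k]]; first by rewrite dpow0; apply: gZ_h.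
    rewrite dpow1 /= (br_XH y r ra) -scaleNr; apply: zclosedZ; first exact: gZ_closed.
      by apply: (zclosedN (zint_closed K)); apply: hZ_int.
    exact: gZ_X.
  rewrite dpow_eq0; first exact: zclosed0 gZ_closed.
  by apply: (iter_br0 k (j := 2)); rewrite /= (br_XH y r ra) linearN linearZ /= (br_XX ra) scaler0 oppr0.
move=> z [[i ->]|[b rb ->]].
  by apply: hcase; apply: zspan_in; exists i.
have [e|ne] := pselect (b = - a); last first.
  have [m e hm] := ad_even_root n ra rb ne.
  rewrite /dpow e scalerA intrM mulrCA mulVf ?factK_neq0 // mulr1.
  case: hm => [->|rk]; first by rewrite scale0r; apply: zclosed0 gZ_closed.
  by apply: zclosedZ; [exact: gZ_closed | exact: zint_int | exact: gZ_X].
rewrite e; case: n => [|[|[|n]]].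
- by rewrite dpow0 -e; apply: gZ_X.
- by rewrite dpow1 /= (ch_XNX ra); apply/gZ_h/hZ_coroot => //; rewrite -e.
- rewrite /dpow /= (ch_XNX ra) (br_XH _ r ra) (gc_coroot gc ra) scalerN scalerA mulVf ?scale1r.
    by apply: zclosedN; [exact: gZ_closed | exact: gZ_X].
  exact: natK_neq0.
rewrite dpow_eq0; first exact: zclosed0 gZ_closed.
apply: (iter_br0 n (j := 3)).
by rewrite /= (ch_XNX ra) (br_XH _ r ra) linearN linearZ /= (br_XX ra) scaler0 oppr0.
Qed.

End ChevalleyFacts.


(** * Weights of a rational module *)

(** The vectors x^k v have the distinct [t]-eigenvalues c + ks; were they nonzero for all k up to
    dim V, they would form a free family of dim V + 1 vectors. *)
Lemma eigen_nilpotent (K : fieldType) (charK : [pchar K] =i pred0) (V : vectType K)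
    (t x : {linear V -> V}) (c s : K) (v : V) :
  s != 0 -> t v = c *: v -> (forall u, t (x u) = x (t u) + s *: x u) ->
  iter (\dim {:V}) x v = 0.
Proof.
move=> s0 tv tx; set d := \dim {:V}.
pose w (k : nat) := iter k x v.
have tw k : t (w k) = (c + k%:R * s) *: w k.
  elim: k => [|k IHk]; first by rewrite mul0r addr0.
  rewrite /w /= tx -/(w k) IHk linearZ /= -scalerDl -natr1 mulrDl mul1r addrA.
  by [].
apply: contrapT => /eqP wd.
have w0 k : (k <= d)%N -> w k != 0.
  move=> kd; apply: contraNneq wd => wk.
  rewrite -(subnK kd) iterD -/(w k) wk.
  by apply/eqP; elim: (d - k)%N => //= j ->; rewrite linear0.
have: free [tuple w i | i < d.+1].
  apply/freeP => k; under eq_bigr do rewrite -tnth_nth tnth_mktuple.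
  move=> k0 i; have: k i *: w i = 0.
    apply: (@eigen_components K V 'I_d.+1 unit (fun _ => t)
      (fun i _ => c + (i : nat)%:R * s) (fun x => x = 0) _ _ _ _ (index_enum 'I_d.+1)
      (fun i => k i *: w i)) => //.
    - by move=> ? ? -> ->; rewrite subr0.
    - by move=> ? ? ->; rewrite scaler0.
    - by move=> _ ? ->; rewrite linear0.
    - exact: index_enum_uniq.
    - move=> i1 i2 _ _ ne; exists tt; apply: contra_neq ne => /addrI /(mulIf s0).
      by move/(natK_inj charK); apply: val_inj.
    - by move=> j _ _; rewrite linearZ /= tw !scalerA mulrC.
    - exact: mem_index_enum.
  by move/eqP; rewrite scaler_eq0 (negPf (w0 i (ltn_ord i))) orbF => /eqP.
rewrite /free => /eqP e; have := dimvS (subvf <<[tuple w i | i < d.+1]>>).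
by rewrite e size_tuple -/d ltnn.
Qed.

Lemma absz_sqr (R : nzRingType) (m : int) : (`|m| ^ 2)%N%:R = (m ^+ 2)%:~R :> R.
Proof.
have -> : m ^+ 2 = (`|m| ^ 2)%N%:Z by rewrite -abszX gez0_abs // sqr_ge0.
by [].
Qed.

Section Weights.
Variables (K : fieldType) (charK : [pchar K] =i pred0) (G : lieSuperalg K) (h : {vspace G}).
Variables (D : rootData h) (pos : pred (rlat D)) (B : chevalley_basis pos).
Hypothesis h_even : (h <= lpart G false)%VS.
Variables (V : superModule G) (V_rat : rational B V).
Local Notation X := (ch_X B).
Implicit Types (a b : rlat D) (y : subvs_of h) (v : V) (mu : 'Hom(subvs_of h, K^o)).

Lemma weight_vectorZ mu (c : K) v : weight_vector mu v -> weight_vector mu (c *: v).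
Proof. by move=> vm y; rewrite linearZ /= vm !scalerA mulrC. Qed.
Lemma weight_vector0 mu : weight_vector mu (0 : V).
Proof. by move=> y; rewrite linear0 scaler0. Qed.

Lemma weight_vector_root mu a v : isroot a -> weight_vector mu v ->
  weight_vector (mu + rwt a) (act (X a) v).
Proof.
move=> ra vm y; rewrite act_br_even ?(ch_weight B y ra); last exact: (subvP h_even _ (subvsP y)).
by rewrite actZl vm linearZ /= -scalerDl add_lfunE addrC.
Qed.

Lemma weight_parts mu v u w : weight_vector mu v -> u \in mpart V false -> w \in mpart V true ->
  v = u + w -> weight_vector mu u /\ weight_vector mu w.
Proof.
move=> vm u0 w1 vE.
have H y : act (vsval y) u = mu y *: u /\ act (vsval y) w = mu y *: w.
  have y0 : vsval y \in lpart G false by exact: (subvP h_even _ (subvsP y)).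
  apply: mpart_inj; rewrite ?memvZ //.
  - exact: (act_graded y0 u0).
  - exact: (act_graded y0 w1).
  - by rewrite -[LHS]linearD /= -vE vm vE scalerDr.
by split=> y; case: (H y).
Qed.

Definition hom_weight v := exists mu (p : bool), weight_vector mu v /\ v \in mpart V p.

Lemma hom_weight_span v : exists s : seq V, (forall x, x \in s -> hom_weight x) /\ v = \sum_(x <- s) x.
Proof.
have [[dec _] _] := V_rat; have [s [w [us wP ->]]] := (dec v).1 I.
elim: s us wP => [|i s IHs] /=; first by exists [::]; rewrite !big_nil.
move=> /andP [_ us] wP; have [|r [rP e]] := IHs us.
  by move=> j js; apply: wP; rewrite inE js orbT.
have [u u0 [x x1 wE]] := mpart_decomp (w i).
have [um xm] := weight_parts (wP i (mem_head _ _)) u0 x1 wE.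
exists [:: u, x & r]; rewrite !big_cons e wE addrA; split=> // z.
rewrite !inE => /or3P [/eqP ->|/eqP ->|/rP //]; [by exists i, false | by exists i, true].
Qed.

Lemma hom_weight_basis (Y : seq V) : free Y ->
  exists2 Z : seq V, (forall z, z \in Z -> hom_weight z) & basis_of fullv (Z ++ Y).
Proof.
move=> fY.
have [s [sP sspan]] : exists s : seq V, (forall x, x \in s -> hom_weight x) /\ (fullv <= <<s>>)%VS.
  rewrite -(span_basis (vbasisP fullv)).
  elim: (vbasis _ : seq V) => [|x l [s [sP sl]]]; first by exists [::]; rewrite span_nil sub0v.
  have [r [rP xE]] := hom_weight_span x; exists (r ++ s); split.
    by move=> z; rewrite mem_cat => /orP [/rP|/sP].
  rewrite span_cons span_cat; apply: addvS => //.
  apply/subvP => _ /vlineP [k ->]; rewrite xE memvZ // big_seq.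
  by apply: memv_suml => z zr; apply: memv_span.
have [Z sZ [fZ sub]] := extend_free s fY; exists Z; first by move=> z /sZ /sP.
rewrite /basis_of fZ andbT eqEsubv subvf /=; exact: subv_trans sspan sub.
Qed.

Lemma weight_int mu v i : v != 0 -> weight_vector mu v -> zint (mu (ch_H B i) : K).
Proof. by move=> v0 vm; case: V_rat => _; apply; exists v. Qed.

Lemma weight_hZ mu v y : v != 0 -> weight_vector mu v -> hZ B y -> zint (mu y : K).
Proof.
move=> v0 vm; apply: (@zspan_additive _ _ (fun y => mu y)) => [? ?||_ [i ->]].
- by rewrite linearB.
- exact: zint_closed.
- exact: weight_int v0 vm.
Qed.

Lemma act_nilpotent a v : isroot a -> rwt a != 0 -> iter (\dim {:V}) (act (X a)) v = 0.
Proof.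
move=> ra a0; have [y ay] : exists y, rwt a y != 0.
  apply: contrapT => ny; case/eqP: a0; apply/lfunP => y; rewrite zero_lfunE.
  by apply: contrapT => /eqP ay; apply: ny; exists y.
have lin : linear (iter (\dim {:V}) (@act K G V (X a))) by apply: iter_is_linear.
have [s [sP ->]] := hom_weight_span v.
elim: s sP => [|x s IHs] sP.
  by rewrite big_nil; elim: (\dim _) => //= n ->; rewrite linear0.
rewrite big_cons -[x]scale1r lin IHs ?addr0 ?scale1r; last first.
  by move=> z zs; apply: sP; rewrite inE zs orbT.
have [mu [b [xm _]]] := sP x (mem_head _ _).
apply: (@eigen_nilpotent K charK V (act (vsval y)) (act (X a)) (mu y) (rwt a y)) => //; first exact: xm.
move=> u; rewrite /= act_br_even ?(ch_weight B y ra); last exact: (subvP h_even _ (subvsP y)).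
by rewrite actZl addrC.
Qed.

Definition faithful := forall x : G, (forall v, act x v = 0) -> x = 0.

Lemma faithful_weight_int a i : faithful -> isroot a -> zint (rwt a (ch_H B i) : K).
Proof.
move=> faith ra.
have [v [hv av]] : exists v, hom_weight v /\ act (X a) v != 0.
  apply: contrapT => nv; have /eqP := ch_X_neq0 B ra; apply; apply: faith => v.
  have [s [sP ->]] := hom_weight_span v.
  rewrite linear_sum big_seq big1 // => x /sP hx.
  by apply: contrapT => /eqP ax; apply: nv; exists x.
have [mu [_ [vm _]]] := hv.
have v0 : v != 0 by apply: contraNneq av => ->; rewrite linear0.
have z1 := weight_int i v0 vm.
have z2 := weight_int i av (weight_vector_root ra vm).
have -> : rwt a (ch_H B i) = (mu + rwt a) (ch_H B i) - mu (ch_H B i) :> K.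
  by rewrite add_lfunE addrAC subrr add0r.
exact: (zclosedB (zint_closed K)).
Qed.

(** The form tr(yz) on V, written in a weight basis. The ordinary trace is taken because the signs
    of the supertrace would spoil positivity; its invariance is then stated for even elements. The
    last clause is tr(y [x, x']) = tr([y, x] x') = s(y) tr(x x'), with t the trace of x x'. *)
Lemma trace_form : exists kap : subvs_of h -> subvs_of h -> K,
  [/\ forall y z, kap y z = kap z y,
      forall (c : K) y y' z, kap (c *: y + y') z = c * kap y z + kap y' z,
      forall y, hZ B y -> exists N : nat, kap y y = N%:R,
      forall y, hZ B y -> kap y y = 0 -> forall v, act (vsval y) v = 0 &
      forall x x' H (s : 'Hom(subvs_of h, K^o)), x \in lpart G false -> x' \in lpart G false ->
        br x x' = vsval H -> root_vector s x ->
        exists t, forall y, kap y H = s y * t].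
Proof.
have [Z ZP] := hom_weight_basis (nil_free V); rewrite cats0 => Zb.
have dimZ := size_basis (X := in_tuple Z) Zb.
set n := size Z in dimZ; pose e := in_tuple Z : n.-tuple V.
have e_basis : basis_of fullv e by [].
have /choice [mu muP] : forall i : 'I_n, exists f : 'Hom(subvs_of h, K^o), weight_vector f e`_i.
  move=> i; have [f [p [fw _]]] := ZP e`_i (mem_nth 0 (ltn_ord i)); by exists f.
have e0 (i : 'I_n) : e`_i != 0.
  by apply: (basis_not0 e_basis); apply: mem_nth; rewrite size_tuple; apply: ltn_ord.
have eC v : v = \sum_(j < n) coord e j v *: e`_j by exact: (coord_basis e_basis (memvf v)).
have act_e x v : (forall i : 'I_n, act x e`_i = 0) -> act x v = 0.
  by move=> xe; rewrite (eC v) linear_sum big1 // => j _; rewrite linearZ /= xe scaler0.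
exists (fun y z => \sum_(j < n) mu j y * mu j z); split.
- by move=> y z; apply: eq_bigr => j _; rewrite mulrC.
- move=> c y y' z; rewrite mulr_sumr -big_split /=; apply: eq_bigr => j _.
  by rewrite linearP /= mulrDl mulrA.
- move=> y hy; have /choice [m mP] : forall j, zint (mu j y : K).
    by move=> j; apply: weight_hZ (e0 j) (muP j) hy.
  exists (\sum_(j < n) `|m j| ^ 2)%N; rewrite natr_sum; apply: eq_bigr => j _.
  by rewrite mP -intrM -expr2 -absz_sqr.
- move=> y hy ky; have /choice [m mP] : forall j, zint (mu j y : K).
    by move=> j; apply: weight_hZ (e0 j) (muP j) hy.
  have: (\sum_(j < n) `|m j| ^ 2)%N = 0%N.
    apply: (natK_inj charK); rewrite mulr0n -ky natr_sum; apply: eq_bigr => j _.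
    by rewrite mP -intrM -expr2 -absz_sqr.
  move/eqP; rewrite sum_nat_eq0 => /forallP m0 v; apply: act_e => j.
  by have := m0 j; rewrite /= expn_eq0 /= andbT absz_eq0 (muP j) mP => /eqP ->; rewrite scale0r.
move=> x x' H s x0 x'0 xx' xs.
pose A (i j : 'I_n) : K := coord e j (act x e`_i); pose A' (i j : 'I_n) : K := coord e j (act x' e`_i).
have coordE (k : 'I_n -> K) j : coord e j (\sum_(i < n) k i *: e`_i) = k j.
  exact: coord_sum_free (basis_free e_basis).
have comp (f g : {linear V -> V}) (i j : 'I_n) : coord e j (f (g e`_i)) =
    \sum_(k < n) coord e k (g e`_i) * coord e j (f e`_k).
  rewrite {1}(eC (g e`_i)) linear_sum linear_sum; apply: eq_bigr => k _.
  by rewrite linearZ linearZ.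
(* [x] shifts weights by [s], so a nonzero entry [A i j] forces mu_j = mu_i + s. In the final double
   sum, exchanging indices produces the factor mu_j - mu_i, which is thereby replaced by s. *)
have shift y (i j : 'I_n) : (mu j y - mu i y - s y) * A i j = 0.
  have y0 : vsval y \in lpart G false by exact: (subvP h_even _ (subvsP y)).
  have := act_br_even x e`_i y0; rewrite xs actZl muP [act x (_ *: _)]linearZ /=.
  move/(congr1 (coord e j)); rewrite linearD !linearZ /= -/(A i j) (comp (act _) (act _)) /=.
  rewrite (bigD1 j) //= big1 ?addr0; last first.
    move=> k kj; rewrite muP linearZ /= (coord_free _ _ (basis_free e_basis)) (negPf kj) /=.
    by rewrite !mulr0.
  rewrite muP linearZ /= (coord_free _ _ (basis_free e_basis)) eqxx mulr1 -/(A i j) => e1.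
  by rewrite !mulrBl mulrC e1; rewrite /GRing.scale /=; ring.
exists (\sum_(i < n) \sum_(j < n) A i j * A' j i) => y.
have muH i : mu i H = \sum_(j < n) (A' i j * A j i - A i j * A' j i) :> K.
  have := act_br_even x' e`_i x0; rewrite xx' muP => /(congr1 (coord e i)).
  rewrite linearD linearZ /= (coord_free _ _ (basis_free e_basis)) eqxx.
  rewrite (comp (act x) (act x')) (comp (act x') (act x)) /= => e1.
  by rewrite sumrB e1 /GRing.scale /= mulr1 addrK.
under eq_bigr do rewrite muH mulr_sumr.
under eq_bigr do under eq_bigr do rewrite mulrBr.
under eq_bigr do rewrite sumrB.
rewrite sumrB [X in X - _]exchange_big /= -sumrB mulr_sumr; apply: eq_bigr => i _.
rewrite -sumrB mulr_sumr; apply: eq_bigr => j _.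
have := shift y i j; rewrite !mulrBl => /eqP; rewrite subr_eq0 => /eqP e1.
by rewrite [A' j i * _]mulrC !mulrA -mulrBl -[in RHS]e1 mulrBl.
Qed.
End Weights.


(** * The even part *)

Section Rho.
Variables (K : fieldType) (charK : [pchar K] =i pred0) (G : lieSuperalg K) (h : {vspace G}).
Variables (D : rootData h) (pos : pred (rlat D)) (B : chevalley_basis pos).
Hypothesis gc : good_chevalley B.

Lemma poly_nonroot (p : {poly K}) : p != 0 -> exists m : nat, p.[m%:R] != 0.
Proof.
move=> p0; apply: contrapT => nm.
have := @max_poly_roots K p [seq k%:R | k <- iota 0 (size p)] p0.
rewrite size_map size_iota ltnn => F; suff: false by [].
apply: F; last by rewrite map_inj_uniq ?iota_uniq //; apply: natK_inj.
apply/allP => _ /mapP [k _ ->]; rewrite /root; apply/eqP.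
by apply: contrapT => /eqP pk; apply: nm; exists k.
Qed.

(** [rho] is the sum of m^i H_i. A root [a] takes at it the value at m of the nonzero polynomial
    with coefficients a(H_i), and some natural number m is a root of none of these finitely many
    polynomials. *)
Lemma regular_element : exists (rho : subvs_of h) (ht : rlat D -> int),
  hZ B rho /\ forall a : rlat D, isroot a -> rwt a rho = (ht a)%:~R :> K /\ ht a != 0.
Proof.
pose p (a : rlat D) := \sum_(i < \dim h) (rwt a (ch_H B i) : K) *: 'X^i : {poly K}.
have p0 a : isroot a -> p a != 0.
  move=> ra; apply: contraNneq (gc_neq0 gc ra) => pa0.
  apply/eqP/lfunP => y; rewrite zero_lfunE.
  apply: (hspan_ind (B := B) (P := fun y => rwt a y = 0 :> K)) => [|c u v hu hv|i].
  - by rewrite linear0.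
  - by rewrite linearP /= hu hv scaler0 addr0.
  have := congr1 (fun q : {poly K} => q`_i) pa0; rewrite coef0 /p coef_sum.
  rewrite (bigD1 i) //= coefZ coefXn eqxx mulr1 big1 ?addr0 // => j ji.
  by rewrite coefZ coefXn eq_sym -[X in X == _]/(j : nat) (inj_eq val_inj) (negPf ji) mulr0.
have [m pm] : exists m : nat, (\prod_(a <- ch_roots B) p a).[m%:R] != 0.
  apply: poly_nonroot; rewrite prodf_seq_neq0; apply/allP => a /mem_ch_roots ra /=.
  exact: p0.
pose rho : subvs_of h := \sum_(i < \dim h) ch_H B i *~ (m ^ i)%N%:Z.
have hrho : hZ B rho.
  apply: zclosed_sum => [|i _]; first exact: hZ_closed.
  by apply: zclosedMz; [exact: hZ_closed | apply: zspan_in; exists i].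
have /choice [ht htP] : forall a : rlat D, exists k : int, isroot a -> rwt a rho = k%:~R :> K.
  move=> a; have [ra|nra] := pselect (isroot a); last by exists 0.
  by have [k kP] := hZ_int gc ra hrho; exists k.
exists rho, ht; split=> // a ra; split; first exact: htP.
rewrite -(intK_eq0 charK) -htP //.
move: pm; rewrite horner_prod prodf_seq_neq0 => /allP /(_ a) /=.
rewrite (introT idP ((mem_ch_roots B a).2 ra)) => /(_ isT).
suff -> : (p a).[m%:R] = rwt a rho by [].
rewrite /p /rho horner_sum linear_sum; apply: eq_bigr => i _.
by rewrite hornerZ hornerXn -natrX raddfMz /= -mulrzr.
Qed.
End Rho.

Section EvenPart.
Variables (K : fieldType) (charK : [pchar K] =i pred0) (G : lieSuperalg K) (h : {vspace G}).
Variables (D : rootData h) (pos : pred (rlat D)) (B : chevalley_basis pos).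
Hypothesis gc : good_chevalley B.
Variables (V : superModule G) (V_rat : rational B V).
Variables (rho : subvs_of h) (ht : rlat D -> int).
Hypothesis rho_hZ : hZ B rho.
Hypothesis htP : forall a : rlat D, isroot a -> rwt a rho = (ht a)%:~R :> K /\ ht a != 0.
Local Notation X := (ch_X B).
Implicit Types (a b : rlat D) (mu : 'Hom(subvs_of h, K^o)).

Lemma htD a b : isroot a -> isroot b -> isroot (a + b) -> ht (a + b) = ht a + ht b.
Proof.
move=> ra rb rab; apply: (intK_inj charK).
by rewrite intrD -(htP ra).1 -(htP rb).1 -(htP rab).1 (gc_rwtD gc) add_lfunE.
Qed.

Lemma htN a : isroot a -> isroot (- a) -> ht (- a) = - ht a.
Proof.
move=> ra rNa; apply: (intK_inj charK).
by rewrite mulrNz -(htP ra).1 -(htP rNa).1 (rwtN gc) opp_lfunE.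
Qed.

Definition int_weight mu := forall i, zint (mu (ch_H B i) : K).
(** Integrality of the weight is recorded separately because the zero vector, which arises when
    operators are applied, is a weight vector of every weight. *)
Definition int_weight_vector (v : V) := exists mu, int_weight mu /\ weight_vector mu v.

Lemma int_weight_hZ mu y : int_weight mu -> hZ B y -> zint (mu y : K).
Proof.
move=> im; apply: (@zspan_additive _ _ (fun y => mu y)) => [? ?||_ [i ->]] //.
- by rewrite linearB.
- exact: zint_closed.
Qed.

Lemma int_weight_root mu a n : isroot a -> int_weight mu -> int_weight (mu + rwt a *+ n).
Proof.
move=> ra im i; rewrite add_lfunE -scaler_nat scale_lfunE.
apply: (zclosedD (zint_closed K)); first exact: im.
by apply: zintM; [exact: zint_nat | exact: (gc_intw gc)].
Qed.

Lemma weight_vector_dpow mu a n v : isroot a -> weight_vector mu v ->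
  weight_vector (mu + rwt a *+ n) (dpow (@act K G V (X a)) n v).
Proof.
move=> ra vm; rewrite /dpow; apply: weight_vectorZ.
elim: n => [|n IHn]; first by rewrite mulr0n addr0.
rewrite mulrSr addrA; exact: (weight_vector_root B (gc_even gc) ra IHn).
Qed.

Lemma int_weight_vector_dpow a n v : isroot a -> int_weight_vector v -> int_weight_vector (dpow (@act K G V (X a)) n v).
Proof.
move=> ra [mu [im vm]]; exists (mu + rwt a *+ n); split; first exact: int_weight_root.
exact: weight_vector_dpow.
Qed.

Lemma int_weight_vector_act a v : isroot a -> int_weight_vector v -> int_weight_vector (act (X a) v).
Proof. by move=> ra vi; rewrite -dpow1; apply: int_weight_vector_dpow. Qed.

Lemma degree_bound : exists N : nat, forall mu (v : V) (d : int), weight_vector mu v -> v != 0 ->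
  mu rho = d%:~R :> K -> (`|d| <= N)%N.
Proof.
have [Z ZP Zb] := hom_weight_basis (gc_even gc) V_rat (nil_free V); rewrite cats0 in Zb.
pose n := size Z; pose e := in_tuple Z : n.-tuple V.
have e0 (i : 'I_n) : e`_i != 0.
  by apply: (basis_not0 (Zb : basis_of fullv e)); apply: mem_nth; apply: ltn_ord.
have /choice [m mP] : forall i : 'I_n, exists k : int, act (vsval rho) e`_i = k%:~R *: e`_i.
  move=> i; have [nu [p [ew _]]] := ZP e`_i (mem_nth 0 (ltn_ord i)).
  by have [k kE] := weight_hZ V_rat (e0 i) ew rho_hZ; exists k; rewrite -kE.
exists (\sum_(i < n) `|m i|)%N => mu v d vm v0 mud.
have vE := coord_basis (Zb : basis_of fullv e) (memvf v).
have [i ci] : exists i, coord e i v != 0.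
  apply: contrapT => nc; case/eqP: v0; rewrite vE big1 // => i _.
  have -> : coord e i v = 0 by apply: contrapT => /eqP ci; apply: nc; exists i.
  by rewrite scale0r.
suff -> : d = m i by rewrite (bigD1 i) //= leq_addr.
have := vm rho; rewrite {1}vE linear_sum /= => /(congr1 (coord e i)).
rewrite (eq_bigr (fun j => ((m j)%:~R * coord e j v) *: e`_j)); last first.
  by move=> j _; rewrite linearZ /= mP scalerA mulrC.
rewrite (coord_sum_free _ _ (basis_free (Zb : basis_of fullv e))) linearZ /= mud.
by move/(mulIf ci)/(intK_inj charK).
Qed.

Variable N : nat.
Hypothesis degN : forall mu (v : V) (d : int), weight_vector mu v -> v != 0 ->
  mu rho = d%:~R :> K -> (`|d| <= N)%N.

Lemma rwt_rho a n mu (d : int) : isroot a -> mu rho = d%:~R :> K ->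
  (mu + rwt a *+ n) rho = (d + ht a *+ n)%:~R :> K.
Proof.
move=> ra mud; rewrite add_lfunE -scaler_nat scale_lfunE mud (htP ra).1 intrD.
by rewrite -[in RHS]mulr_natl intrM natz.
Qed.

Lemma int_weight_vector_degree v : int_weight_vector v -> exists mu (d : int), [/\ int_weight mu, weight_vector mu v & mu rho = d%:~R :> K].
Proof.
by move=> [mu [im vm]]; have [d dE] := int_weight_hZ im rho_hZ; exists mu, d.
Qed.

(** The values at [rho] before and after lie in [-N, N], but differ by n ht(a), of absolute value at
    least n. *)
Lemma dpow_high a n v : isroot a -> int_weight_vector v -> (N.*2 < n)%N -> dpow (@act K G V (X a)) n v = 0.
Proof.
move=> ra vi Nn; apply: contrapT => /eqP x0.
have v0 : v != 0.
  apply: contraNneq x0 => ->; apply/eqP.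
  exact: (linear0 (dpow (@act K G V (X a)) n)).
have [mu [d [im vm mud]]] := int_weight_vector_degree vi.
have := degN vm v0 mud; have := degN (weight_vector_dpow n ra vm) x0 (rwt_rho n ra mud).
have [_] := htP ra; rewrite -mulr_natl natz; move: (ht a) => k k0.
have: (n <= `|(n%:Z * k)%R|)%N by rewrite abszM absz_nat leq_pmulr // absz_gt0.
lia.
Qed.

(** The sign [eps] treats raising and lowering operators at once. All operators push the value at
    [rho] in the same direction inside [-N, N], and exponents above 2N give 0, so only finitely many
    words matter. *)
Lemma dpow_closure (R : seq (rlat D)) (eps : int) : eps = 1 \/ eps = -1 ->
  (forall a, a \in R -> isroot a /\ (0 < eps * ht a)%R) ->
  forall l : seq V, (forall x, x \in l -> int_weight_vector x) ->
  exists l' : seq V, [/\ {subset l <= l'}, forall x, x \in l' -> int_weight_vector x,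
    forall x a n, x \in l' -> a \in R ->
      dpow (act (X a)) n x = 0 \/ dpow (act (X a)) n x \in l' &
    forall P : V -> Prop, (forall x, x \in l -> P x) ->
      (forall x a n, x \in l' -> P x -> a \in R -> P (dpow (act (X a)) n x)) ->
      forall x, x \in l' -> P x].
Proof.
move=> epsP RP l lw.
(* [k] bounds the number of operators that can still act: each raises [eps * d] by at least 1, and
   beyond N only 0 remains. The initial vectors have [eps * d] at least -N, hence degree 2N. *)
pose Deg (k : nat) (x : V) := exists mu (d : int),
  [/\ int_weight mu, weight_vector mu x, mu rho = d%:~R :> K & (N%:Z <= eps * d + k%:Z)%R].
pose op (i : rlat D * nat) := dpow (@act K G V (X i.1)) i.2.
pose ops := [seq (a, n) | a <- R, n <- iota 1 N.*2].
have opsP i : i \in ops -> i.1 \in R /\ (0 < i.2 <= N.*2)%N.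
  by move=> /allpairsP [[a n] /= [aR nN ->]]; split=> //=; rewrite mem_iota in nN; lia.
have opDeg k x i : i \in ops -> Deg k x -> exists mu (d : int),
   [/\ int_weight mu, weight_vector mu (op i x), mu rho = d%:~R :> K & (N%:Z + 1 <= eps * d + k%:Z)%R].
  move=> /opsP [/RP [ra ha] n1] [mu [d [im xm mud dk]]].
  exists (mu + rwt i.1 *+ i.2), (d + ht i.1 *+ i.2); split.
  - exact: int_weight_root.
  - exact: weight_vector_dpow.
  - exact: rwt_rho.
  rewrite -mulr_natl natz; move: ha n1 dk; move: (ht i.1) (i.2) => c n hc /andP [n0 _] dk.
  have : (1 <= n%:Z * (eps * c))%R by move: (eps * c) hc n0 => z; nia.
  by move: dk; lia.
have [|||l' [sl' cl' Pl']] := @finite_closure V _ ops op Deg _ _ (N.*2) l.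
- move=> k x i iops /(opDeg _ _ _ iops) [mu [d [im xm mud dk]]]; right.
  by exists mu, d; split=> //; lia.
- move=> x i iops /(opDeg _ _ _ iops) [mu [d [im xm mud dk]]].
  apply: contrapT => /eqP x0; have := degN xm x0 mud.
  by case: epsP dk => ->; lia.
- move=> x xl; have [mu [d [im xm mud]]] := int_weight_vector_degree (lw x xl).
  have [x0|x0] := eqVneq x 0; last first.
    by exists mu, d; split=> //; have := degN xm x0 mud; case: epsP => ->; lia.
  exists 0, 0; split; rewrite ?x0 ?zero_lfunE //.
  - by move=> i; rewrite zero_lfunE; exists 0.
  - exact: weight_vector0.
  - lia.
have PI (P : V -> Prop) : (forall x, x \in l -> P x) ->
   (forall x a n, x \in l' -> P x -> a \in R -> P (dpow (act (X a)) n x)) -> forall x, x \in l' -> P x.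
  by move=> Pl PS; apply: Pl' => // x i xl' Px /opsP [iR _]; apply: PS.
have wl' : forall x, x \in l' -> int_weight_vector x.
  by apply: PI => // x a n _ xi /RP [ra _]; apply: int_weight_vector_dpow.
exists l'; split=> // x a [|n] xl' aR; first by rewrite dpow0; right.
have [nN|Nn] := leqP n.+1 N.*2; last first.
  by left; apply: dpow_high => //; [case: (RP a aR) | exact: wl'].
apply: (cl' x (a, n.+1)) => //; apply/allpairsP; exists (a, n.+1); split=> //=.
by rewrite mem_iota; lia.
Qed.

(** Positivity is that of [ht], so these are the indecomposable even roots for [rho] and not the
    members of the given [Pi]. *)
Definition simple_root a := [/\ proot false a, (0 < ht a)%R &
  ~ exists b c, [/\ proot false b, proot false c, (0 < ht b)%R, (0 < ht c)%R & a = b + c]].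

(** A nonzero bracket would make a - b an even root; according to the sign of its height, a = (a -
    b) + b or b = a + (b - a) would be a decomposition. *)
Lemma simple_root_commute a b : simple_root a -> simple_root b -> a <> b -> br (X a) (X (- b)) = 0.
Proof.
move=> [ra ha sa] [rb hb sb] ab; have rNb := gc_opp gc rb.
have ne : a <> - - b by rewrite opprK.
have [rab|nr] := pselect (isroot (a - b)); last by rewrite ch_XX0 //; apply: root_even.
have [c _ e] := ch_XX B (root_even ra) (root_even rNb) ne rab.
have [c0|c0] := eqVneq c 0; first by rewrite e c0 scale0r.
have X0 : X (a - b) \in lpart G false.
  suff -> : X (a - b) = c^-1 *: br (X a) (X (- b)).
    by apply: memvZ; apply: (br_graded (gc_par gc ra) (gc_par gc rNb)).
  by rewrite e scalerA mulVf // scale1r.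
have r0 := gc_par' gc rab X0; have [_ hab] := htP rab.
have hE := htD (root_even ra) (root_even rNb) rab.
have hNb := htN (root_even rb) (root_even rNb).
case: (ltrgt0P (ht (a - b))) hab => // hab _.
  by case: sa; exists (a - b), b; rewrite subrK.
case: sb; exists a, (- (a - b)); split=> //; first exact: (gc_opp gc).
  by rewrite (htN rab (root_even (gc_opp gc r0))) oppr_gt0.
by rewrite opprB addrC subrK.
Qed.

Lemma sl2_relations a : proot false a -> [/\
  forall v : V, act (X a) (act (X (- a)) v) = act (X (- a)) (act (X a) v) + act (vsval (coroot a)) v,
  forall v : V, act (vsval (coroot a)) (act (X a) v) =
    act (X a) (act (vsval (coroot a)) v) + 2 *: act (X a) v &
  forall v : V, act (vsval (coroot a)) (act (X (- a)) v) =
    act (X (- a)) (act (vsval (coroot a)) v) - 2 *: act (X (- a)) v].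
Proof.
move=> ra; have rNa := gc_opp gc ra; split=> v.
- by rewrite (act_br_even _ _ (gc_par gc ra)) (ch_XNX gc ra) addrC.
- rewrite (act_br_even _ _ (h_is_even gc _)) (ch_weight B _ (root_even ra)) actZl (gc_coroot gc ra).
  by rewrite addrC.
rewrite (act_br_even _ _ (h_is_even gc _)) (ch_weight B _ (root_even rNa)) actZl (rwtN gc).
by rewrite opp_lfunE (gc_coroot gc ra) scaleNr addrC.
Qed.

Lemma EF_closed (P : V -> Prop) a u m n : zclosed P -> proot false a -> int_weight_vector u ->
  (forall k j, P (dpow (act (X (- a))) k (dpow (act (X a)) j u))) ->
  P (dpow (act (X a)) m (dpow (act (X (- a))) n u)).
Proof.
move=> Pc ra [mu [im um]] Pu; have [EF HE HF] := sl2_relations ra.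
have Hu := um (coroot a).
rewrite (EF_commutation charK (E := act (X a)) (F := act (X (- a))) EF HE HF m n Hu).
apply: zclosed_sum => // k _; apply: zclosedZ => //.
  apply: binK_int => //; apply: (zclosedB (zint_closed K)); last exact: zint_nat.
  apply: (zclosedD (zint_closed K)); last exact: zint_nat.
  by apply: int_weight_hZ => //; apply: hZ_coroot; [exact: root_even | exact/root_even/(gc_opp gc)].
by rewrite /dpowB; case: ifP => _; [exact: Pu | exact: zclosed0].
Qed.

Lemma zspan_dpow (l : seq V) a n : 
  (forall x, x \in l -> zspan (fun y => y \in l) (dpow (act (X a)) n x)) ->
  forall x, zspan (fun y => y \in l) x -> zspan (fun y => y \in l) (dpow (act (X a)) n x).
Proof.
move=> H; apply: (@zspan_additive _ _ (dpow (@act K G V (X a)) n)) => //.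
  by move=> u v; exact: (linearB (dpow (@act K G V (X a)) n)).
exact: zspan_closed.
Qed.

Lemma simple_root_lattice (w : V) : int_weight_vector w -> exists l : seq V, [/\ w \in l, forall x, x \in l -> int_weight_vector x,
  forall P : V -> Prop, P w ->
    (forall x a n, P x -> proot false a -> P (dpow (act (X a)) n x)) -> forall x, x \in l -> P x &
  forall a n x, simple_root a -> zspan (fun y => y \in l) x ->
    zspan (fun y => y \in l) (dpow (act (X a)) n x) /\
    zspan (fun y => y \in l) (dpow (act (X (- a))) n x)].
Proof.
move=> wi; pose S := [seq a <- ch_roots B | `[< simple_root a >]].
have SP a : a \in S <-> simple_root a.
  rewrite mem_filter; split=> [/andP [/asboolP //]|sa].
  rewrite (introT (asboolP _) sa) /=; apply/mem_ch_roots; case: sa => ra _ _; exact: root_even.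
have S1 a : a \in S -> isroot a /\ (0 < 1 * ht a)%R.
  by move/SP => [ra ha _]; rewrite mul1r; split=> //; apply: root_even.
pose S' := [seq - a | a <- S].
have S'1 a : a \in S' -> isroot a /\ (0 < -1 * ht a)%R.
  move=> /mapP [b /SP [rb hb _] ->]; have rNb := root_even (gc_opp gc rb).
  by rewrite (htN (root_even rb) rNb) mulN1r opprK.
(* [lE] holds the E-words applied to [w], and [lF] below the F-words applied to these. *)
have [|lE [wE iE cE PE]] := dpow_closure (or_introl erefl) S1 (l := [:: w]).
  by move=> x; rewrite inE => /eqP ->.
have [lF [sF iF cF PF]] := dpow_closure (or_intror erefl) S'1 iE.
pose L := zspan (fun y => y \in lF).
have Lc : zclosed L by exact: zspan_closed.
have inL x : x \in lF -> L x by exact: (@zspan_in _ (fun y => y \in lF) x).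
have LF a n x : a \in S -> L x -> L (dpow (act (X (- a))) n x).
  move=> aS; apply: zspan_dpow => y yl.
  have [->|] := cF y (- a) n yl (map_f _ aS); [exact: zclosed0 | exact: inL].
have LE a n x : a \in S -> L x -> L (dpow (act (X a)) n x).
  move=> aS; apply: zspan_dpow => y.
  (* Induction along the F-word, for all [a] and [n] at once: for a = b, Kostant's rule calls on all
     exponents of E_a; for a distinct from b, E_a simply passes F_b. *)
  move: y a n aS; have H : forall y, y \in lF -> forall a n, a \in S -> L (dpow (act (X a)) n y).
    apply: PF => [z zE a n aS|z b' n zF IH b'S' a m aS].
      have [->|h1] := cE z a n zE aS; [exact: zclosed0 | exact/inL/sF].
    have [b bS bE] := mapP b'S'; rewrite bE.
    have [sa sb] := ((SP a).1 aS, (SP b).1 bS).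
    have [eab|ab] := pselect (a = b).
      rewrite eab in aS sa *; case: (sa) => ra _ _.
      apply: EF_closed => //; first exact: iF.
      by move=> k j; apply: LF => //; apply: IH.
    rewrite (dpow_commute (x := act (X a)) (y := act (X (- b)))).
      by apply: LF => //; apply: IH.
    case: sa => ra _ _ v.
    by rewrite /= (act_br_even _ _ (gc_par gc ra)) simple_root_commute ?act0l ?add0r //; apply/SP.
  by move=> y a n aS yl; apply: H.
exists lF; split=> //.
- by apply/sF/wE; rewrite inE.
- move=> P Pw PS; have PlE : forall x, x \in lE -> P x.
    apply: PE => [x|x a n _ Px /SP [ra _ _]]; last exact: PS.
    by rewrite inE => /eqP ->.
  apply: PF => // x a n _ Px /mapP [b /SP [rb _ _] ->].
  by apply: PS => //; apply: (gc_opp gc).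
by move=> a n x /SP aS Lx; split; [apply: LE | apply: LF].
Qed.

End EvenPart.


(** * Exponentials, reflections and stability under all even root vectors *)

Section Expo.
Variables (K : fieldType) (charK : [pchar K] =i pred0) (T : lmodType K).
Implicit Types x : {linear T -> T}.

Lemma expo_is_linear x M : linear (expo x M).
Proof.
move=> a u v; rewrite /expo scaler_sumr -big_split /=; apply: eq_bigr => k _.
exact: dpow_is_linear.
Qed.
HB.instance Definition _ x M := GRing.isLinear.Build K T T _ (expo x M) (@expo_is_linear x M).

Lemma dpow_scale (c : K) x (y : T -> T) k v : (forall u, y u = c *: x u) ->
  dpow y k v = c ^+ k *: dpow x k v.
Proof.
move=> yx; rewrite /dpow scalerA mulrC -scalerA; congr (_ *: _).
elim: k => [|k IHk]; first by rewrite scale1r.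
by rewrite /= IHk yx linearZ /= scalerA -exprS.
Qed.

Lemma dpow_comp x i j v : dpow x i (dpow x j v) = 'C(i + j, i)%:R *: dpow x (i + j) v.
Proof.
have itZ (c : K) k u : iter k x (c *: u) = c *: iter k x u.
  by elim: k => //= k ->; rewrite linearZ.
rewrite /dpow itZ -iterD !scalerA; congr (_ *: _).
have := congr1 (fun n : nat => n%:R : K) (bin_fact (leq_addr j i)).
rewrite addKn !natrM => <-.
have f1 := factK_neq0 charK i; have f2 := factK_neq0 charK j.
have c0 : 'C(i + j, i)%:R != 0 :> K by apply: natK_neq0 => //; rewrite bin_gt0 leq_addr.
by field; rewrite f1 f2 c0.
Qed.

(** The part of degree n of the product is (1 - 1)^n x^n / n!, which is 0 unless n = 0. *)
Lemma expoNK x (y : T -> T) M v : (forall u, y u = - x u) ->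
  (forall k u, (M <= k)%N -> dpow x k u = 0) -> (0 < M)%N -> expo y M (expo x M v) = v.
Proof.
move=> yx x0 M0.
have dy k u : dpow y k u = (-1) ^+ k *: dpow x k u.
  by apply: dpow_scale => w; rewrite yx scaleN1r.
have y0 k u : (M <= k)%N -> dpow y k u = 0 by move=> Mk; rewrite dy x0 ?scaler0.
transitivity (\sum_(n < M + M) \sum_(k < n.+1) dpow y k (dpow x (n - k) v)); last first.
  rewrite -(prednK M0) addSn big_ord_recl big_ord1 big1 => [|n _].
    by rewrite addr0 dy expr0 scale1r !dpow0.
  rewrite lift0 (eq_bigr (fun k : 'I_n.+2 => ((-1) ^+ k * 'C(n.+1, k)%:R) *: dpow x n.+1 v)).
    rewrite -scaler_suml.
    have -> : \sum_(i < n.+2) (-1) ^+ i * 'C(n.+1, i)%:R = (1 + (-1)) ^+ n.+1 :> K.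
      by rewrite exprDn; apply: eq_bigr => i _; rewrite expr1n mul1r mulr_natr.
    by rewrite subrr expr0n scale0r.
  move=> k _; have kn : (k <= n.+1)%N by rewrite -ltnS.
  by rewrite dy dpow_comp subnKC // scalerA.
rewrite -(sum_triangle (t := fun k j => dpow y k (dpow x j v))); first last.
- by move=> k j Mj; rewrite dy (x0 j) // linear0 scaler0.
- by move=> k j Mk; rewrite y0.
rewrite /expo; apply: eq_bigr => k _; rewrite dy linear_sum scaler_sumr.
by apply: eq_bigr => j _; rewrite dy.
Qed.

Lemma expo_order2 x M v : (2 <= M)%N -> x (x v) = 0 -> expo x M v = v + x v.
Proof.
move=> M2 xx; rewrite (expo_widen M2); first by rewrite /expo !big_ord_recl big_ord0 dpow0 dpow1 addr0.
move=> k k2; apply: dpow_eq0; rewrite -(subnK k2) iterD /= xx.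
by elim: (k - 2)%N => //= j ->; rewrite linear0.
Qed.

Lemma expo_order3 x M v : (3 <= M)%N -> x (x (x v)) = 0 -> expo x M v = v + x v + 2^-1 *: x (x v).
Proof.
move=> M2 xx; rewrite (expo_widen M2).
  by rewrite /expo !big_ord_recl big_ord0 dpow0 dpow1 addr0 addrA.
move=> k k2; apply: dpow_eq0; rewrite -(subnK k2) iterD /= xx.
by elim: (k - 3)%N => //= j ->; rewrite linear0.
Qed.
End Expo.

Section Weyl.
Variables (K : fieldType) (charK : [pchar K] =i pred0) (G : lieSuperalg K) (h : {vspace G}).
Variables (D : rootData h) (pos : pred (rlat D)) (B : chevalley_basis pos).
Hypothesis gc : good_chevalley B.
Variables (V : superModule G) (V_rat : rational B V).
Local Notation X := (ch_X B).
Implicit Types (a b : rlat D).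

Lemma ad_nilpotent a z : isroot a -> iter (\dim {:G}) (br (X a)) z = 0.
Proof.
move=> ra; have [y ay] : exists y, rwt a y != 0.
  apply: contrapT => ny; have /eqP := gc_neq0 gc ra; apply; apply/lfunP => y; rewrite zero_lfunE.
  by apply: contrapT => /eqP ay; apply: ny; exists y.
have lin : linear (iter (\dim {:G}) (br (X a))) by apply: iter_is_linear.
have eig c u : br (vsval y) u = c *: u -> iter (\dim {:G}) (br (X a)) u = 0.
  move=> yu; apply: (@eigen_nilpotent K charK G (br (vsval y)) (br (X a)) c (rwt a y)) => // w.
  by rewrite /= (br_jacobi_even _ _ (h_is_even gc y)) (ch_weight B y ra) brZl addrC.
apply: (ch_ind (B := B) (P := fun z => iter (\dim {:G}) (br (X a)) z = 0)) => [c u w hu hw||i|b rb].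
- by rewrite lin hu hw scaler0 addr0.
- by apply: (eig 0); rewrite linear0 scaler0.
- by apply: (eig 0); rewrite (ch_comm B) scale0r.
- by apply: (eig (rwt b y)); rewrite (ch_weight B).
Qed.

(** One truncation for all exponentials on V and on g; the summand 3 leaves room for the explicit
    expansions of order 2 and 3. *)
Definition nil_bound := (\dim {:V} + \dim {:G} + 3)%N.

Definition nilpotent_even (x : G) := [/\ x \in lpart G false,
  forall k (v : V), (nil_bound <= k)%N -> dpow (act x) k v = 0 &
  forall k z, (nil_bound <= k)%N -> dpow (br x) k z = 0].

Lemma nilpotent_X a : proot false a -> nilpotent_even (X a).
Proof.
move=> ra; have r := root_even ra; split; first exact: (gc_par gc).
- move=> k v n0k; apply: dpow_eq0.
  have kd : (\dim {:V} <= k)%N by apply: leq_trans n0k; rewrite /nil_bound; lia.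
  rewrite -(subnK kd) iterD (act_nilpotent charK (gc_even gc) V_rat _ r (gc_neq0 gc r)).
  by elim: (k - _)%N => //= j ->; rewrite linear0.
move=> k z n0k; apply: dpow_eq0.
have kd : (\dim {:G} <= k)%N by apply: leq_trans n0k; rewrite /nil_bound; lia.
rewrite -(subnK kd) iterD (ad_nilpotent _ r).
by elim: (k - _)%N => //= j ->; rewrite linear0.
Qed.

Lemma dpow_actN x k (v : V) : dpow (act (- x)) k v = (-1) ^+ k *: dpow (act x) k v.
Proof. by apply: (dpow_scale (x := act x)) => u; rewrite actNl scaleN1r. Qed.
Lemma dpow_brN (x : G) k z : dpow (br (- x)) k z = (-1) ^+ k *: dpow (br x) k z.
Proof. by apply: (dpow_scale (x := br x)) => u; rewrite brNl scaleN1r. Qed.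

Lemma nilpotentN x : nilpotent_even x -> nilpotent_even (- x).
Proof.
move=> [x0 xV xG]; split; first by rewrite memvN.
  by move=> k v kn; rewrite dpow_actN xV // scaler0.
by move=> k v kn; rewrite dpow_brN xG // scaler0.
Qed.

Definition exp_act (x : G) (v : V) : V := expo (act x) nil_bound v.
Definition exp_ad (x z : G) : G := expo (br x) nil_bound z.

Lemma exp_actZ x (c : K) v : exp_act x (c *: v) = c *: exp_act x v.
Proof. exact: (linearZ_LR (expo (@act K G V x) nil_bound)). Qed.
Lemma exp_adD x u v : exp_ad x (u + v) = exp_ad x u + exp_ad x v.
Proof. exact: (linearD (expo (@br K G x) nil_bound)). Qed.
Lemma exp_adN x u : exp_ad x (- u) = - exp_ad x u.
Proof. exact: (linearN (expo (@br K G x) nil_bound)). Qed.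
Lemma exp_adZ x (c : K) v : exp_ad x (c *: v) = c *: exp_ad x v.
Proof. exact: (linearZ_LR (expo (@br K G x) nil_bound)). Qed.

Lemma exp_act_act x z v : nilpotent_even x -> exp_act x (act z v) = act (exp_ad x z) (exp_act x v).
Proof.
move=> [x0 xV xG]; rewrite /exp_act.
(* The left side is truncated at twice the bound, as [expo_leibniz] requires; the added terms are
   0. *)
rewrite -(expo_widen (leq_addr nil_bound nil_bound)) => [|k]; last exact: xV.
apply: (expo_leibniz charK (b := @act K G V) _ _ (DU := br x) (DV := act x) (DW := act x)).
- exact: act_linearl.
- exact: act_linearr.
- by move=> u w; rewrite /= (act_br_even _ _ x0).
- by move=> k; apply: xG.
- by move=> k; apply: xV.
Qed.

Lemma exp_ad_br x z w : nilpotent_even x -> exp_ad x (br z w) = br (exp_ad x z) (exp_ad x w).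
Proof.
move=> [x0 xV xG]; rewrite /exp_ad.
rewrite -(expo_widen (leq_addr nil_bound nil_bound)) => [|k]; last exact: xG.
apply: (expo_leibniz charK (b := @br K G) _ _ (DU := br x) (DV := br x) (DW := br x)).
- exact: br_linearl.
- exact: br_linearr.
- by move=> u y; rewrite /= (br_jacobi_even _ _ x0).
- by move=> k; apply: xG.
- by move=> k; apply: xG.
Qed.

Lemma exp_actNK x v : nilpotent_even x -> exp_act (- x) (exp_act x v) = v.
Proof.
move=> [x0 xV xG]; apply: (expoNK charK (x := act x)) => //.
- by move=> u; rewrite /= actNl.
- by rewrite /nil_bound; lia.
Qed.

Lemma exp_act_closed (L : V -> Prop) x : zclosed L ->
  (forall n v, L v -> L (dpow (act x) n v)) -> forall v, L v -> L (exp_act x v).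
Proof. by move=> Lc xL v Lv; apply: zclosed_sum => // n _; apply: xL. Qed.

Section Reflection.
Variables (b : rlat D) (rb : proot false b).
Local Notation E := (X b).
Local Notation F := (X (- b)).
Let rNb := gc_opp gc rb.

Definition refl_act v := exp_act E (exp_act (- F) (exp_act E v)).
Definition refl_act_inv v := exp_act (- E) (exp_act F (exp_act (- E) v)).
Definition refl_ad z := exp_ad E (exp_ad (- F) (exp_ad E z)).

Lemma refl_actK v : refl_act_inv (refl_act v) = v.
Proof.
have nE := nilpotent_X rb; have nF := nilpotent_X rNb.
rewrite /refl_act_inv /refl_act (exp_actNK _ nE) -{1}[F]opprK (exp_actNK _ (nilpotentN nF)) (exp_actNK _ nE) //.
Qed.

Lemma refl_act_act z v : refl_act (act z v) = act (refl_ad z) (refl_act v).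
Proof.
have nE := nilpotent_X rb; have nF := nilpotentN (nilpotent_X rNb).
by rewrite /refl_act (exp_act_act _ _ nE) (exp_act_act _ _ nF) (exp_act_act _ _ nE).
Qed.

Lemma refl_ad_br z w : refl_ad (br z w) = br (refl_ad z) (refl_ad w).
Proof.
have nE := nilpotent_X rb; have nF := nilpotentN (nilpotent_X rNb).
by rewrite /refl_ad (exp_ad_br _ _ nE) (exp_ad_br _ _ nF) (exp_ad_br _ _ nE).
Qed.

Lemma refl_adZ (c : K) z : refl_ad (c *: z) = c *: refl_ad z.
Proof. by rewrite /refl_ad !exp_adZ. Qed.

Lemma refl_ad_h (y : subvs_of h) : refl_ad (vsval y) = vsval (y - (rwt b y : K) *: coroot b).
Proof.
have r := root_even rb; have rN := root_even rNb.
have n3 : (3 <= nil_bound)%N by rewrite /nil_bound; lia.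
have n2 : (2 <= nil_bound)%N by apply: ltnW.
have two : (2 : K) != 0 by apply: natK_neq0 charK _ _.
have EH u : br E (vsval u) = - ((rwt b u : K) *: E) by rewrite (br_XH gc).
have FH u : br F (vsval u) = (rwt b u : K) *: F.
  by rewrite (br_XH gc) // (rwtN gc) opp_lfunE scaleNr opprK.
have FE : br F E = - vsval (coroot b).
  by rewrite (br_skew_even _ (gc_par gc rNb)) (ch_XNX gc rb).
have eEh u : exp_ad E (vsval u) = vsval u - (rwt b u : K) *: E.
  rewrite /exp_ad (expo_order2 (x := br E)) //= EH // linearN linearZ /= (br_XX charK gc rb).
  by rewrite scaler0 oppr0.
have eEE : exp_ad E E = E.
  by rewrite /exp_ad (expo_order2 (x := br E)) //= (br_XX charK gc rb) ?addr0 ?linear0.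
have eFh u : exp_ad (- F) (vsval u) = vsval u - (rwt b u : K) *: F.
  have e1 : br (- F) (vsval u) = - ((rwt b u : K) *: F) by rewrite brNl FH.
  rewrite /exp_ad (expo_order2 (x := br (- F))) //= e1 //.
  by rewrite linearN linearZ /= brNl (br_XX charK gc rNb) oppr0 scaler0 oppr0.
have eFE : exp_ad (- F) E = E + vsval (coroot b) - F.
  have e1 : br (- F) E = vsval (coroot b) by rewrite brNl FE opprK.
  have e2 : br (- F) (vsval (coroot b)) = - (2 *: F) by rewrite brNl FH (gc_coroot gc rb).
  rewrite /exp_ad (expo_order3 (x := br (- F))) //= e1 e2.
    by rewrite scalerN scalerA mulVf // scale1r.
  by rewrite linearN linearZ /= brNl (br_XX charK gc rNb) oppr0 scaler0 oppr0.
rewrite /refl_ad eEh exp_adD eFh exp_adN exp_adZ eFE; set s : K := rwt b y.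
(* The terms in F cancel here. The last exponential sends H_b to H_b - 2E and so removes those in E,
   leaving y - b(y) H_b. *)
have -> : vsval y - s *: F - s *: (E + vsval (coroot b) - F) =
    vsval y - s *: vsval (coroot b) - s *: E.
  by rewrite scalerBr scalerDr opprB addrA subrK opprD addrA addrAC.
rewrite !(exp_adD, exp_adN, exp_adZ) !eEh eEE (gc_coroot gc rb) -/s [RHS]linearB [in RHS]linearZ /=.
rewrite scalerBr scalerA mulrC -scalerA scaler_nat mulr2n opprB !addrA subrK.
by rewrite scalerN addrAC addrK.
Qed.

Lemma exp_ad_gZ a z : proot false a -> gZ B z -> gZ B (exp_ad (X a) z) /\ gZ B (exp_ad (- X a) z).
Proof.
move=> ra gz; split; apply: (zclosed_sum (gZ_closed B)) => n _; first exact: gZ_dpow.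
rewrite dpow_brN; apply: zclosedZ; [exact: gZ_closed| |exact: gZ_dpow].
by exists ((-1) ^+ n); rewrite rmorphXn /= intrN.
Qed.

Lemma exp_ad_even x z : x \in lpart G false -> z \in lpart G false -> exp_ad x z \in lpart G false.
Proof.
move=> x0 z0; apply: rpred_sum => n _; apply: memvZ.
by elim: (n : nat) => //= k IHk; apply: (br_graded x0 IHk).
Qed.

Lemma gZ_expand z : gZ B z -> exists (y : subvs_of h) (c : rlat D -> K),
  z = vsval y + \sum_(a <- ch_roots B) c a *: X a /\ forall a, zint (c a).
Proof.
move: z; apply: zspan_sub.
  split.
    exists 0, (fun=> 0); split; last by move=> _; exists 0.
    by rewrite linear0 big1 ?addr0 // => a _; rewrite scale0r.
  move=> _ _ [y [c [-> ci]]] [y' [c' [-> ci']]]; exists (y - y'), (fun a => c a - c' a); split.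
    rewrite linearB opprD addrACA -sumrB; congr (_ + _).
    by apply: eq_bigr => a _; rewrite scalerBl.
  by move=> a; apply: (zclosedB (zint_closed K)).
move=> _ [[i ->]|[a ra ->]].
  exists (ch_H B i), (fun=> 0); split; last by move=> _; exists 0.
  by rewrite big1 ?addr0 // => a _; rewrite scale0r.
exists 0, (fun c => (c == a)%:R); split; last by move=> c; apply: zint_nat.
rewrite linear0 add0r (bigD1_seq a) ?ch_roots_uniq //=; last exact/mem_ch_roots.
rewrite eqxx scale1r big1 ?addr0 // => c ca; by rewrite (negPf ca) scale0r.
Qed.

Lemma gZ_root_vector (mu : 'Hom(subvs_of h, K^o)) z : mu != 0 -> root_vector mu z -> gZ B z ->
  z = 0 \/ exists2 d : rlat D, isroot d /\ rwt d = mu & exists m : int, z = m%:~R *: X d.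
Proof.
move=> mu0 zm /gZ_expand [y [c [zE ci]]].
have [y0 c0] := ch_root_space_coord (gc_inj gc) (gc_neq0 gc) mu0 zm zE.
have [[d [rd dm]]|nd] := pselect (exists d : rlat D, isroot d /\ rwt d = mu); last first.
  left; rewrite zE y0 add0r big1_seq // => a /mem_ch_roots ra; rewrite c0 ?scale0r //.
  by apply/eqP => am; apply: nd; exists a.
right; exists d => //; have [m mE] := ci d; exists m.
rewrite zE y0 add0r -mE (bigD1_seq d) ?ch_roots_uniq //=; last exact/mem_ch_roots.
rewrite big1_seq ?addr0 // => a /andP [ad /mem_ch_roots ra].
rewrite c0 ?scale0r // -dm; apply: contra_neq ad; exact: (gc_inj gc).
Qed.

(** Evaluated at H_b, the reflected weight is -a(H_b); if it were 0, the reflected weight would be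
    [a] itself. *)
Lemma reflect_neq0 a : proot false a ->
  rwt a - (rwt a (coroot b) : K) *: rwt b != 0.
Proof.
move=> ra; apply/eqP => e.
pose s : 'Hom(subvs_of h, K^o) := rwt a - (rwt a (coroot b) : K) *: rwt b.
have := gc_neq0 gc (root_even ra).
have E : s (coroot b) = - rwt a (coroot b).
  by rewrite add_lfunE opp_lfunE scale_lfunE (gc_coroot gc rb) /GRing.scale /=; ring.
have k0 : rwt a (coroot b) = 0 :> K by apply/eqP; rewrite -oppr_eq0 -E /s e zero_lfunE.
by case/eqP; have := e; rewrite k0 scale0r subr0.
Qed.

(** The image has weight s_b(a), and it stays in the Z-form because the exponentials preserve it; so
    it is 0 or an integral multiple of one root vector, even because the exponentials preserve the
    even part. *)
Lemma refl_ad_root a : proot false a ->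
  refl_ad (X a) = 0 \/ exists2 d : rlat D, proot false d /\ rwt d = rwt a - (rwt a (coroot b) : K) *: rwt b &
     exists m : int, refl_ad (X a) = m%:~R *: X d.
Proof.
move=> ra; have r := root_even ra.
have gt : gZ B (refl_ad (X a)).
  by apply: (exp_ad_gZ rb _).1; apply: (exp_ad_gZ rNb _).2; apply: (exp_ad_gZ rb _).1; apply: gZ_X.
have t0 : refl_ad (X a) \in lpart G false.
  have e0 := gc_par gc rb; have f0 := gc_par gc rNb.
  apply: exp_ad_even => //; apply: exp_ad_even; first by rewrite memvN.
  by apply: exp_ad_even => //; apply: (gc_par gc ra).
have rv : root_vector (rwt a - (rwt a (coroot b) : K) *: rwt b) (refl_ad (X a)).
  (* [y'] is the reflection of [y], so [y] is the image of [y'] and the automorphism can be pulled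
     out of the bracket. *)
  move=> y; pose y' := y - (rwt b y : K) *: coroot b.
  have ey : rwt b y' = - rwt b y :> K.
    by rewrite /y' linearB linearZ /= (gc_coroot gc rb) /GRing.scale /=; ring.
  have -> : y = y' - (rwt b y' : K) *: coroot b by rewrite ey scaleNr opprK subrK.
  rewrite -refl_ad_h -refl_ad_br (ch_weight B y' r) refl_adZ; congr (_ *: _).
  rewrite add_lfunE opp_lfunE scale_lfunE !linearB !linearZ /= (gc_coroot gc rb) /GRing.scale /=.
  ring.
have [|[d [rd dm] [m mE]]] := gZ_root_vector (reflect_neq0 ra) rv gt; first by left.
have [->|m0] := eqVneq (refl_ad (X a)) 0; [by left | right; exists d; last by exists m].
split=> //; apply: (gc_par' gc rd).
have mK : m%:~R != 0 :> K by apply: contraNneq m0 => e; rewrite mE e scale0r.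
suff -> : X d = m%:~R^-1 *: refl_ad (X a) by apply: memvZ.
by rewrite mE scalerA mulVf // scale1r.
Qed.

Lemma reflection_stable (L : V -> Prop) a : zclosed L -> proot false a ->
  (forall n v, L v -> L (dpow (act E) n v) /\ L (dpow (act F) n v)) ->
  (forall d : rlat D, proot false d -> rwt d = rwt a - (rwt a (coroot b) : K) *: rwt b ->
     forall n v, L v -> L (dpow (act (X d)) n v)) ->
  forall n v, L v -> L (dpow (act (X a)) n v).
Proof.
move=> Lc ra LEF Ld n v Lv.
have LN x : (forall n v, L v -> L (dpow (act x) n v)) -> forall v, L v -> L (exp_act (- x) v).
  move=> Lx; apply: exp_act_closed => // k u Lu; rewrite dpow_actN; apply: zclosedZ => //; last exact: Lx.
  by exists ((-1) ^+ k); rewrite rmorphXn /= intrN.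
have LE k u : L u -> L (dpow (act E) k u) by case/(LEF k).
have LF k u : L u -> L (dpow (act F) k u) by case/(LEF k).
have tL u : L u -> L (refl_act u).
  move=> Lu; apply: exp_act_closed => //; apply: (LN F _ _) => //; exact: exp_act_closed.
have tVL u : L u -> L (refl_act_inv u).
  move=> Lu; apply: (LN E _ _) => //; apply: exp_act_closed => //; exact: LN.
rewrite -[dpow _ _ _]refl_actK; apply: tVL.
have tVZ (c : K) u : refl_act (c *: u) = c *: refl_act u by rewrite /refl_act !exp_actZ.
have [t0|[d [rd dE] [m mE]]] := refl_ad_root ra.
  case: n => [|n]; first by rewrite dpow0; apply: tL.
  rewrite /dpow tVZ /= refl_act_act t0 act0l scaler0; exact: zclosed0.
have -> : refl_act (dpow (act (X a)) n v) = (m ^+ n)%:~R *: dpow (act (X d)) n (refl_act v).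
  rewrite /dpow tVZ scalerA mulrC -scalerA; congr (_ *: _).
  elim: n => [|n IHn]; first by rewrite scale1r.
  by rewrite [iter n.+1 _ _]/= refl_act_act mE IHn actZl /= linearZ /= scalerA -intrM -exprS.
apply: zclosedZ => //; first exact: zint_int.
by apply: Ld => //; apply: tL.
Qed.

End Reflection.

Hypothesis faith : faithful V.
Variables (rho : subvs_of h) (ht : rlat D -> int).
Hypothesis rho_hZ : hZ B rho.
Hypothesis htP : forall a : rlat D, isroot a -> rwt a rho = (ht a)%:~R :> K /\ ht a != 0.

(** [n a] is the trace norm of H_a, positive by faithfulness, and 2 kap(y, H_a) = n_a a(y). Symmetry
    of the form gives p n_a = q n_b, and Cauchy-Schwarz gives pq <= 4; if pq = 4 the vectors H_a and
    H_b are proportional. *)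
Lemma cartan_integers : exists n : rlat D -> nat, (forall a, proot false a -> (0 < n a)%N) /\
  forall a b, proot false a -> proot false b -> exists p q : int,
  [/\ rwt a (coroot b) = p%:~R :> K, rwt b (coroot a) = q%:~R :> K,
      p * (n a)%:Z = q * (n b)%:Z, (p * q <= 4)%R &
      p * q = 4 -> forall y, 2 * (rwt b y : K) = q%:~R * (rwt a y : K)].
Proof.
have [kap [kC kL kN k0 kT]] := trace_form charK (gc_even gc) V_rat.
have hc a : proot false a -> hZ B (coroot a).
  by move=> ra; apply: hZ_coroot; [exact: root_even | exact/root_even/(gc_opp gc)].
have /choice [n nP] : forall a, exists n : nat, proot false a ->
    (0 < n)%N /\ forall y, 2 * kap y (coroot a) = (rwt a y : K) * n%:R.
  move=> a; have [ra|nra] := pselect (proot false a); last by exists 0%N.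
  have [n nE] := kN _ (hc a ra).
  have [t tP] := kT (X a) (X (- a)) (coroot a) (rwt a) (gc_par gc ra) (gc_par gc (gc_opp gc ra))
    (ch_XNX gc ra) (fun y => ch_weight B y (root_even ra)).
  have tn : 2 * t = n%:R by rewrite -nE tP (gc_coroot gc ra).
  exists n => _; split; last by move=> y; rewrite tP -tn mulrCA.
  rewrite lt0n; apply/eqP => n0; have := k0 _ (hc a ra); rewrite nE n0 => /(_ erefl) act0.
  have H0 : coroot a = 0 by apply: subvs_inj; rewrite linear0; apply: faith.
  have := gc_coroot gc ra; rewrite H0 linear0 => /esym/eqP.
  by rewrite (negPf (natK_neq0 charK (ltn0Sn 1))).
exists n; split=> [a /nP []//|a b ra rb].
have [na aP] := nP a ra; have [nb bP] := nP b rb.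
have [p pE] := hZ_int gc (root_even ra) (hc b rb).
have [q qE] := hZ_int gc (root_even rb) (hc a ra).
have pq : p * (n a)%:Z = q * (n b)%:Z.
  apply: (intK_inj charK); rewrite !intrM -pE -qE.
  by have := aP (coroot b); have := bP (coroot a); rewrite kC => -> ->.
(* Twice the component of H_b orthogonal to H_a; its norm is n_b (4 - pq), a natural number. *)
pose z := coroot b *~ 2 - coroot a *~ p.
have hz : hZ B z.
  by apply: (zclosedB (hZ_closed B)); apply: (zclosedMz (hZ_closed B)); exact: hc.
have kD y c : kap (y - c) =1 (fun w => kap y w - kap c w).
  by move=> w; rewrite -scaleN1r addrC kL mulN1r addrC.
have kZ y (m : int) w : kap (y *~ m) w = m%:~R * kap y w.
  have k00 : kap 0 w = 0.
    by have := kL 1 0 0 w; rewrite scaler0 addr0 mul1r => /(congr1 (fun v => v - kap 0 w)); rewrite subrr addrK.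
  by rewrite -scaler_int -[_ *: y]addr0 kL k00 addr0.
have kzy y : 2 * kap z y = 2 * (2 * kap y (coroot b) - p%:~R * kap y (coroot a)).
  by rewrite kD !kZ [kap _ y]kC [kap (coroot a) y]kC.
have kzyE y : 2 * kap z y = 2 * (rwt b y : K) * (n b)%:R - p%:~R * (rwt a y : K) * (n a)%:R.
  by rewrite kzy bP mulrBr [2 * (p%:~R * _)]mulrCA aP; ring.
have [N NE] := kN z hz.
have zz : 2 * (N%:R : K) = (2 * (4 * (n b)%:Z - p * q * (n b)%:Z))%:~R.
  have ev (f : 'Hom(subvs_of h, K^o)) : f z = f (coroot b) * 2 - f (coroot a) * p%:~R :> K.
    by rewrite linearB !raddfMz /= [f (coroot b) * 2]mulr_natr mulrzr mulNrz.
  have az : rwt a z = 0 :> K by rewrite ev pE (gc_coroot gc ra); ring.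
  have bz : rwt b z = 4 - p%:~R * q%:~R :> K by rewrite ev qE (gc_coroot gc rb); ring.
  rewrite -NE kzyE az bz !intrM !intrB !intrM -!pmulrn.
  ring.
have NZ : (2 * N%:Z = 2 * (4 * (n b)%:Z - p * q * (n b)%:Z))%R.
  by apply: (intK_inj charK); rewrite -zz intrM.
exists p, q; split=> //; first by nia.
move=> pq4 y; have N0 : N = 0%N by move: NZ; rewrite pq4; lia.
have act0 := k0 z hz (eq_trans NE (congr1 _ N0)).
have z0 : z = 0 by apply: subvs_inj; rewrite linear0; apply: faith.
have := kzyE y; rewrite z0 kC.
have -> : kap y 0 = 0.
  by rewrite kC; have := kZ 0 0 y; rewrite mul0r mulr0z.
have e := congr1 (fun i : int => i%:~R : K) pq; rewrite !intrM -!pmulrn in e.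
have -> : p%:~R * rwt a y * (n a)%:R = q%:~R * rwt a y * (n b)%:R :> K.
  by rewrite mulrAC e; ring.
rewrite mulr0 -mulrBl => /esym/eqP; rewrite mulf_eq0 (negPf (natK_neq0 charK nb)) orbF subr_eq0.
by move/eqP.
Qed.

(** The inequalities say that s_b(a) has height ht(a) - p ht(b), strictly between -ht(a) and ht(a).
    For a = b + c the integers q = b(H_a) and q' = c(H_a) add up to 2. If one of them is at least 2,
    its p is at most 2 and that summand works; otherwise both are 1, both p are at most 3, and the
    summand of smaller height, at most ht(a)/2, works. *)
Lemma reflection_descent a : proot false a -> (0 < ht a)%R -> ~ simple_root ht a ->
  exists2 b, proot false b & (0 < ht b < ht a)%R /\
    exists2 p : int, rwt a (coroot b) = p%:~R :> K & (0 < p)%R /\ (p * ht b < 2 * ht a)%R.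
Proof.
move=> ra ha ns.
have [b [c [rb rc hb hc aE]]] : exists b c, [/\ proot false b, proot false c, (0 < ht b)%R, (0 < ht c)%R & a = b + c].
  by apply: contrapT => nbc; apply: ns; split.
have haE : ht a = ht b + ht c.
  by rewrite aE; apply: (htD charK gc htP); rewrite -?aE; apply: root_even.
have [n [n0 nP]] := cartan_integers.
have [p [q [pE qE pq pq4 eq4]]] := nP a b ra rb.
have [p' [q' [pE' qE' pq' pq4' eq4']]] := nP a c ra rc.
have qq : q + q' = 2.
  apply: (intK_inj charK); rewrite /= intrD -qE -qE'; have := gc_coroot gc ra.
  by rewrite {1}aE (gc_rwtD gc) add_lfunE => ->.
have na := n0 a ra; have nb := n0 b rb; have nc := n0 c rc.
(* The equality case would give a = 2b, twice an even root. *)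
have ne4 : ~ (p = 4 /\ q = 1).
  move=> [p4 q1]; have bc : b = c.
    apply: (gc_inj gc); [exact: root_even|exact: root_even|apply/lfunP => y].
    have := eq4 _ y; rewrite p4 q1 => /(_ erefl); rewrite mul1r aE (gc_rwtD gc) add_lfunE.
    by rewrite mulr2n mulrDl mul1r => /addrI.
  by apply: (even_double_not_root charK gc rb); rewrite {2}bc -aE; apply: root_even.
have ne4' : ~ (p' = 4 /\ q' = 1).
  move=> [p4 q1]; have bc : c = b.
    apply: (gc_inj gc); [exact: root_even|exact: root_even|apply/lfunP => y].
    have := eq4' _ y; rewrite p4 q1 => /(_ erefl); rewrite mul1r aE (gc_rwtD gc) add_lfunE.
    by rewrite mulr2n mulrDl mul1r => /addIr.
  by apply: (even_double_not_root charK gc rc); rewrite {1}bc -aE; apply: root_even.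
have pos_pq (u v : int) (i j : nat) : (0 < i)%N -> (0 < j)%N -> u * i%:Z = v * j%:Z -> (0 < v)%R -> (0 < u)%R.
  by move=> i0 j0 e v0; nia.
have useb : (0 < q)%R -> (p * ht b < 2 * ht a)%R -> exists2 b, proot false b & (0 < ht b < ht a)%R /\
    exists2 p : int, rwt a (coroot b) = p%:~R :> K & (0 < p)%R /\ (p * ht b < 2 * ht a)%R.
  move=> q0 lt; exists b => //; split; first by lia.
  by exists p => //; split=> //; apply: pos_pq na nb pq q0.
have usec : (0 < q')%R -> (p' * ht c < 2 * ht a)%R -> exists2 b, proot false b & (0 < ht b < ht a)%R /\
    exists2 p : int, rwt a (coroot b) = p%:~R :> K & (0 < p)%R /\ (p * ht b < 2 * ht a)%R.
  move=> q0 lt; exists c => //; split; first by lia.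
  by exists p' => //; split=> //; apply: pos_pq na nc pq' q0.
have [q2|q2] := lerP 2 q.
  have p0 := pos_pq _ _ _ _ na nb pq ltac:(lia).
  by apply: useb; [lia | have : (p <= 2)%R by nia]; nia.
have [q2'|q2'] := lerP 2 q'.
  have p0 := pos_pq _ _ _ _ na nc pq' ltac:(lia).
  by apply: usec; [lia | have : (p' <= 2)%R by nia]; nia.
have q1 : q = 1 by lia.
have q1' : q' = 1 by lia.
have p3 : (p <= 3)%R by have : p != 4 by [apply/eqP => e; apply: ne4]; move: pq4; rewrite q1 mulr1; lia.
have p3' : (p' <= 3)%R by have : p' != 4 by [apply/eqP => e; apply: ne4']; move: pq4'; rewrite q1' mulr1; lia.
have [bc|cb] := lerP (ht b) (ht c); [apply: useb | apply: usec]; try lia; nia.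
Qed.

Lemma even_stable (L : V -> Prop) : zclosed L ->
  (forall a n v, simple_root ht a -> L v -> L (dpow (act (X a)) n v) /\ L (dpow (act (X (- a))) n v)) ->
  forall a, proot false a -> forall n v, L v -> L (dpow (act (X a)) n v).
Proof.
move=> Lc Ls a; have [m] := ubnP `|ht a|%N; elim: m a => // m IHm a hm ra.
(* The reflecting root is chosen for the positive one of a and -a. Since s_b commutes with the sign,
   s_b(a) is smaller in absolute height in both cases. *)
have main a' : (a' = a \/ a' = - a) -> proot false a' -> (0 < ht a')%R ->
    `|ht a'|%N = `|ht a|%N -> forall n v, L v -> L (dpow (act (X a)) n v).
  move=> aa' ra' ha' haa'.
  have [sa|ns] := pselect (simple_root ht a').
    move=> n v Lv; have [L1 L2] := Ls a' n v sa Lv.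
    by case: aa' L1 L2 => -> //; rewrite opprK.
  have [b rb [hb [p pE [p0 pb]]]] := reflection_descent ra' ha' ns.
  apply: (reflection_stable rb Lc ra) => [n v Lv|d rd dE].
    have rNb := gc_opp gc rb.
    have hNb := htN charK gc htP (root_even rb) (root_even rNb).
    by split; apply: IHm => //; rewrite ?hNb; lia.
  apply: IHm => //.
  have : ht d = ht a' - p * ht b \/ ht d = - (ht a' - p * ht b).
    have hd : (ht d)%:~R = rwt a rho - (rwt a (coroot b) : K) * rwt b rho.
      by rewrite -(htP (root_even rd)).1 dE add_lfunE opp_lfunE scale_lfunE.
    case: aa' => e; [left | right]; apply: (intK_inj charK); rewrite /= hd.
      by rewrite -e pE !intrB !intrM (htP (root_even ra')).1 (htP (root_even rb)).1.
    have -> : rwt a = - rwt a' by rewrite e (rwtN gc) opprK.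
    rewrite !opp_lfunE pE mulrNz !intrB !intrM (htP (root_even ra')).1 (htP (root_even rb)).1.
    by rewrite mulNr opprK opprB addrC.
  lia.
have [_ h0] := htP (root_even ra).
have rNa := gc_opp gc ra.
have hNa := htN charK gc htP (root_even ra) (root_even rNa).
case: (ltrgt0P (ht a)) h0 => // h0 _; first by apply: (main a); auto.
by apply: (main (- a)); auto; rewrite hNa ?abszN ?oppr_gt0.
Qed.

End Weyl.


(** * The odd part *)

Section UactFacts.
Variables (K : fieldType) (charK : [pchar K] =i pred0) (G : lieSuperalg K) (h : {vspace G}).
Variables (V : superModule G).
Implicit Types (x : G) (v : V).

Lemma Uact_exp x n v : Uact (Uin x ^+ n) v = iter n (act x) v.
Proof.
elim: n => [|n IHn]; first by rewrite expr0 Uact1.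
by rewrite exprS UactM Uact_in IHn.
Qed.

Lemma Uact_dpow x n v : Uact (divided_power (Uin x) n) v = dpow (act x) n v.
Proof. by rewrite /divided_power UactZ Uact_exp. Qed.

Lemma Uact_opp (u : Uenv G) v : Uact (- u) v = - Uact u v.
Proof. by rewrite -scaleN1r UactZ scaleN1r. Qed.

Lemma Uact_sub (u w : Uenv G) v : Uact (u - w) v = Uact u v - Uact w v.
Proof. by rewrite UactD Uact_opp. Qed.

Lemma Uact_nat n v : Uact (n%:R : Uenv G) v = n%:R *: v.
Proof. by rewrite -[n%:R]mulr1 mulr_natl -scaler_nat UactZ Uact1. Qed.

Lemma Uact_subB (u : Uenv G) v w : Uact u (v - w) = Uact u v - Uact u w.
Proof.
have lin := @Uact_linear K G V u.
by rewrite addrC -scaleN1r lin scaleN1r addrC.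
Qed.

Lemma Uact_scale (u : Uenv G) (c : K) v : Uact u (c *: v) = c *: Uact u v.
Proof.
have U0 : Uact u (0 : V) = 0 by have := Uact_subB u 0 0; rewrite !subrr.
by have := @Uact_linear K G V u c v 0; rewrite !addr0 U0 addr0.
Qed.

Lemma Uact_binomial_eigen (t : Uenv G) (z : K) n v : Uact t v = z *: v ->
  Uact (binomial_elt t n) v = binK z n *: v.
Proof.
move=> tv; rewrite /binomial_elt UactZ /binK -scalerA; congr (_ *: _).
rewrite -/(ffall t n); elim: n => [|n IHn]; first by rewrite !ffall0 Uact1 scale1r.
by rewrite !ffallS UactM Uact_sub tv Uact_nat -scalerBl Uact_scale IHn scalerA mulrC.
Qed.

Lemma Uact_binomial (mu : 'Hom(subvs_of h, K^o)) (y : subvs_of h) n v : weight_vector mu v ->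
  Uact (binomial_elt (Uin (vsval y)) n) v = binK (mu y) n *: v.
Proof. by move=> vm; apply: Uact_binomial_eigen; rewrite Uact_in vm. Qed.
End UactFacts.

Section OddPart.
Variables (K : fieldType) (charK : [pchar K] =i pred0) (G : lieSuperalg K) (h : {vspace G}).
Variables (D : rootData h) (pos : pred (rlat D)) (B : chevalley_basis pos).
Hypothesis gc : good_chevalley B.
Variables (V : superModule G) (V_rat : rational B V).
Local Notation X := (ch_X B).
Implicit Types (a b c : rlat D).

Variables (l0 : seq V).
Hypothesis l0_weight : forall x, x \in l0 -> int_weight_vector B x.
Hypothesis l0_even : forall a n x, proot false a -> zspan (fun y => y \in l0) x ->
  zspan (fun y => y \in l0) (dpow (act (X a)) n x).

Definition odd_roots := [seq a <- ch_roots B | `[< proot true a >]].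

Lemma mem_odd_roots a : a \in odd_roots <-> proot true a.
Proof.
rewrite mem_filter; split=> [/andP [/asboolP]//|ra].
by rewrite (introT (asboolP _) ra) /=; apply/mem_ch_roots; right.
Qed.

Fixpoint odd_words k : seq V :=
  if k is j.+1 then odd_words j ++ [seq act (X a) x | a <- odd_roots, x <- odd_words j] else l0.

Definition odd_span k := zspan (fun y => y \in odd_words k).

Lemma odd_span_closed k : zclosed (odd_span k). Proof. exact: zspan_closed. Qed.
Lemma odd_span_in k x : x \in odd_words k -> odd_span k x.
Proof. exact: (@zspan_in _ (fun y => y \in odd_words k)). Qed.

Lemma odd_spanS k x : odd_span k x -> odd_span k.+1 x.
Proof. by apply: zspan_mono => y yk; rewrite mem_cat yk. Qed.

Lemma odd_span_mono j k x : (j <= k)%N -> odd_span j x -> odd_span k x.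
Proof. by move=> jk; rewrite -(subnK jk); elim: (k - j)%N => //= m IHm /IHm /odd_spanS. Qed.

Lemma odd_span_act a k x : proot true a -> odd_span k x -> odd_span k.+1 (act (X a) x).
Proof.
move=> ra; apply: (@zspan_additive _ _ (act (X a))) => [u w||y yk].
- by rewrite linearB.
- exact: odd_span_closed.
apply: odd_span_in; rewrite mem_cat; apply/orP; right.
by apply/allpairsP; exists (a, y); split=> //; apply/mem_odd_roots.
Qed.

Lemma odd_words_ind (P : V -> Prop) : (forall x, x \in l0 -> P x) ->
  (forall a x, proot true a -> P x -> P (act (X a) x)) -> forall k x, x \in odd_words k -> P x.
Proof.
move=> P0 PS; elim=> // k IHk x; rewrite mem_cat => /orP [/IHk //|].
by move=> /allpairsP [[a y] /= [/mem_odd_roots ra /IHk yk ->]]; apply: PS.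
Qed.

Lemma odd_words_weight k x : x \in odd_words k -> int_weight_vector B x.
Proof. by apply: odd_words_ind => // a y ra; apply: (int_weight_vector_act gc); right. Qed.

Lemma odd_span_h k y x : hZ B y -> odd_span k x -> odd_span k (act (vsval y) x).
Proof.
move=> hy; apply: (@zspan_additive _ _ (act (vsval y))) => [u w||z zk].
- by rewrite linearB.
- exact: odd_span_closed.
have [mu [im zm]] := odd_words_weight zk; rewrite zm; apply: zclosedZ; first exact: odd_span_closed.
  exact: (int_weight_hZ im hy).
exact: odd_span_in.
Qed.

Lemma odd_string a c j : proot false a -> proot true c ->
  exists2 m : int, dpow (br (X a)) j (X c) = m%:~R *: X (c + a *+ j) & m = 0 \/ proot true (c + a *+ j).
Proof.
move=> ra rc.
have ne : c <> - a by move=> e; apply: (even_not_odd gc (gc_opp gc ra)); rewrite -e.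
have [m e hm] := ad_even_root charK gc j ra (or_intror rc) ne.
have E : dpow (br (X a)) j (X c) = m%:~R *: X (c + a *+ j).
  by rewrite /dpow e scalerA intrM mulrCA mulVf ?factK_neq0 // mulr1.
case: hm => [m0|rk]; first by exists 0; [rewrite E m0 | left].
have [m0|m0] := eqVneq m 0; first by exists 0; [rewrite E m0 | left].
exists m => //; right; apply: (gc_par' gc rk).
have mK : m%:~R != 0 :> K by rewrite intK_eq0.
suff -> : X (c + a *+ j) = m%:~R^-1 *: dpow (br (X a)) j (X c).
  apply/memvZ/memvZ; elim: j {e E rk} => [|j IHj]; first exact: (gc_par gc).
  exact: (br_graded (gc_par gc ra) IHj).
by rewrite E scalerA mulVf // scale1r.
Qed.

(** By the Leibniz rule an even divided power passes an odd letter X_c, turning it into integral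
    multiples of other odd root vectors, and finally acts on [l0]; the number of odd letters does
    not grow. *)
Lemma odd_span_even k a n x : proot false a -> odd_span k x -> odd_span k (dpow (act (X a)) n x).
Proof.
move=> ra; elim: k n x => [|k IHk] n x; first exact: l0_even.
suff key : forall y, y \in odd_words k.+1 -> odd_span k.+1 (dpow (act (X a)) n y) by exact: zspan_dpow key _.
move=> y; rewrite mem_cat => /orP [yk|].
  by apply/odd_spanS/IHk; apply: odd_span_in.
move=> /allpairsP [[c z] /= [/mem_odd_roots rc zk ->]].
rewrite (dpow_leibniz charK (b := @act K G V) _ _ (DU := br (X a)) (DV := act (X a)) (DW := act (X a))).
- apply: (zclosed_sum (odd_span_closed k.+1)) => j _.
  have [m -> hm] := odd_string j ra rc.
  rewrite actZl; case: hm => [->|rk]; first by rewrite scale0r; apply: zclosed0 (odd_span_closed _).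
  apply: zclosedZ; [exact: odd_span_closed|exact: zint_int|apply: odd_span_act => //].
  by apply: IHk; apply: odd_span_in.
- exact: act_linearl.
- exact: act_linearr.
- by move=> u w; rewrite /= (act_br_even _ _ (gc_par gc ra)).
Qed.

Lemma odd_span_bracket k a c x : proot true a -> proot true c -> odd_span k x -> odd_span k (act (br (X a) (X c)) x).
Proof.
move=> ra rc Lx; have [r r'] : isroot a /\ isroot c by split; right.
have [e|ne] := pselect (a = - c).
  have rNa : isroot (- a) by rewrite e opprK.
  have -> : c = - a by rewrite e opprK.
  rewrite ch_XXopp // actZl; apply: zclosedZ; first exact: odd_span_closed.
    by case: ifP => _; [exists (-1); rewrite intrN | exists 1].
  by apply: odd_span_h => //; apply: hZ_coroot.
have [rac|nr] := pselect (isroot (a + c)); last first.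
  by rewrite ch_XX0 // act0l; apply: zclosed0 (odd_span_closed _).
have [d sd e] := ch_XX B r r' ne rac.
have [d0|d0] := eqVneq d 0; first by rewrite e d0 scale0r act0l; apply: zclosed0 (odd_span_closed _).
have X0 : X (a + c) \in lpart G false.
  suff -> : X (a + c) = d^-1 *: br (X a) (X c).
    by apply: memvZ; apply: (br_graded (gc_par gc ra) (gc_par gc rc)).
  by rewrite e scalerA mulVf // scale1r.
rewrite e actZl; apply: zclosedZ; [exact: odd_span_closed|exact: (gc_int gc) sd|].
by rewrite -dpow1; apply: odd_span_even => //; apply: (gc_par' gc rac X0).
Qed.

(** Acting twice by X_a is half the action of [X_a, X_a]; the factor 2 in [gc_odd] makes this an
    integral multiple of an even root vector. *)
Lemma odd_span_square k a x : proot true a -> odd_span k x -> odd_span k (act (X a) (act (X a) x)).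
Proof.
move=> ra Lx; have X1 := gc_par gc ra.
have [m e hm] := gc_odd gc ra.
have -> : act (X a) (act (X a) x) = m%:~R *: act (X (a + a)) x.
  have two : (2 : K) != 0 by apply: natK_neq0.
  apply: (scalerI two); rewrite scalerA.
  have := act_br_odd x X1 X1; rewrite e actZl intrM => e2.
  by rewrite scaler_nat mulr2n {1}e2 subrK.
case: hm => [->|r2]; first by rewrite scale0r; apply: zclosed0 (odd_span_closed _).
by apply: zclosedZ; [exact: odd_span_closed|exact: zint_int|rewrite -dpow1; apply: odd_span_even].
Qed.

Definition word_act (w : seq (rlat D)) (x : V) := foldr (fun a v => act (X a) v) x w.

Lemma word_act_in w x : {in w, forall a, proot true a} -> x \in l0 -> odd_span (size w) (word_act w x).
Proof.
elim: w => [|a w IHw] wo xl; first exact: (odd_span_in (k := 0)).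
by apply: odd_span_act; [apply: wo; rewrite inE eqxx | apply: IHw => // b bw; apply: wo; rewrite inE bw orbT].
Qed.

(** X_a is moved to the right, up to sign, until it meets its copy and becomes a square. Every
    exchange leaves a bracket term, which is even and therefore acts without lengthening the
    word. *)
Lemma word_act_repeat a w x : {in w, forall b, proot true b} -> x \in l0 -> a \in w ->
  odd_span (size w) (act (X a) (word_act w x)).
Proof.
elim: w => // b w IHw wo xl aw.
have rb : proot true b by apply: wo; rewrite inE eqxx.
have wo' : {in w, forall b, proot true b} by move=> c cw; apply: wo; rewrite inE cw orbT.
have ra : proot true a by apply: wo.
have Lw := word_act_in wo' xl.
have [eab|ab] := eqVneq a b; first by rewrite eab; apply/odd_spanS/odd_span_square.
move: aw; rewrite inE (negPf ab) /= => aw.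
rewrite /= (act_br_odd _ (gc_par gc ra) (gc_par gc rb)).
apply: zclosedB; first exact: odd_span_closed.
  by apply/odd_spanS/odd_span_bracket.
by apply: odd_span_act => //; apply: IHw.
Qed.

Lemma word_act_not_uniq w x : {in w, forall b, proot true b} -> x \in l0 -> ~~ uniq w ->
  odd_span (size w).-1 (word_act w x).
Proof.
elim: w => // a w IHw wo xl.
have ra : proot true a by apply: wo; rewrite inE eqxx.
have wo' : {in w, forall b, proot true b} by move=> c cw; apply: wo; rewrite inE cw orbT.
rewrite /= negb_and negbK => /orP [aw|nu]; first exact: word_act_repeat.
have := odd_span_act ra (IHw wo' xl nu).
by case: w nu {IHw wo wo'}.
Qed.

Lemma odd_words_word_act k x : x \in odd_words k -> exists w y,
  [/\ (size w <= k)%N, {in w, forall b, proot true b}, y \in l0 & x = word_act w y].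
Proof.
elim: k x => [|k IHk] x; first by move=> xl; exists [::], x.
rewrite mem_cat => /orP [/IHk [w [y [sw wo yl ->]]]|].
  by exists w, y; split=> //; apply: leqW.
move=> /allpairsP [[a z] /= [/mem_odd_roots ra /IHk [w [y [sw wo yl ->]]] ->]].
exists (a :: w), y; split=> // b; rewrite inE => /predU1P [->//|]; exact: wo.
Qed.

Let M := size odd_roots.

Lemma odd_span_stable a x : proot true a -> odd_span M x -> odd_span M (act (X a) x).
Proof.
move=> ra /(odd_span_act ra); apply: zspan_sub; first exact: odd_span_closed.
move=> y /odd_words_word_act [w [z [sw wo zl ->]]].
have [swM|swM] := leqP (size w) M; first by apply: odd_span_mono swM _; apply: word_act_in.
have sw1 : (size w).-1 = M by apply/eqP; rewrite eqn_leq; lia.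
rewrite -sw1; apply: word_act_not_uniq => //; apply/negP => uw.
have : (size w <= M)%N by apply: uniq_leq_size => // b /wo rb; apply/mem_odd_roots.
by rewrite leqNgt swM.
Qed.

Lemma odd_span_kostant u x : kostant B u -> odd_span M x -> odd_span M (Uact u x).
Proof.
move=> ku; elim: ku x => [a n ra|a ra|i n||u1 u2 _ IH1 _ IH2|u1 u2 _ IH1 _ IH2] x Lx.
- by rewrite Uact_dpow; apply: odd_span_even.
- by rewrite Uact_in; apply: odd_span_stable.
- move: x Lx; apply: (@zspan_additive _ _ (Uact _)) => [v w||y yl].
  + exact: Uact_subB.
  + exact: odd_span_closed.
  have [mu [im ym]] := odd_words_weight yl; rewrite (Uact_binomial _ _ ym).
  by apply: zclosedZ; [exact: odd_span_closed|exact: binK_int|exact: odd_span_in].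
- by rewrite Uact1.
- by rewrite Uact_sub; apply: zclosedB; [exact: odd_span_closed|exact: IH1|exact: IH2].
- by rewrite UactM; apply: IH1; apply: IH2.
Qed.
End OddPart.

(** The middle clause, an induction principle for [l], is what later places the generators inside
    [rational_form]. *)
Lemma kostant_finite (K : fieldType) (charK : [pchar K] =i pred0) (G : lieSuperalg K) (h : {vspace G})
    (D : rootData h) (pos : pred (rlat D)) (B : chevalley_basis pos) (gc : good_chevalley B)
    (V : superModule G) (V_rat : rational B V) (faith : faithful V) (w : V) : int_weight_vector B w ->
  exists l : seq V, [/\ w \in l,
    forall P : V -> Prop, P w ->
      (forall x a n, P x -> proot false a -> P (dpow (act (ch_X B a)) n x)) ->
      (forall x a, P x -> proot true a -> P (act (ch_X B a) x)) -> forall x, x \in l -> P x &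
    forall u x, kostant B u -> zspan (fun y => y \in l) x -> zspan (fun y => y \in l) (Uact u x)].
Proof.
move=> wi; have [rho [ht [hrho htP]]] := regular_element charK gc.
have [N degN] := degree_bound charK gc V_rat hrho.
have [l [wl li lP ls]] := simple_root_lattice charK gc hrho htP degN wi.
pose L := zspan (fun y : V => y \in l).
have Lc : zclosed L by exact: zspan_closed.
have Le : forall a n x, proot false a -> L x -> L (dpow (act (ch_X B a)) n x).
  move=> a n x ra; apply: (even_stable charK gc V_rat faith htP Lc) => //.
exists (odd_words B l (size (odd_roots B))); split.
- by elim: (size _) => //= k IHk; rewrite mem_cat IHk.
- move=> P Pw Pe Po x; apply: odd_words_ind => [y yl|a y ra Py]; [exact: lP yl | exact: Po].
- by move=> u x; apply: (odd_span_kostant charK gc).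
Qed.


(** * Simple modules *)

Lemma span_stable (K : fieldType) (V W : vectType K) (f : {linear V -> W}) (b : seq V) (U : {vspace W}) :
  (forall x, x \in b -> f x \in U) -> forall x, x \in <<b>>%VS -> f x \in U.
Proof.
move=> bU x xb; rewrite -lfunE.
have: (linfun f @: <<b>> <= U)%VS.
  by rewrite limg_span; apply/span_subvP => _ /mapP [y yb ->]; rewrite lfunE; apply: bU.
by move/subvP; apply; apply: memv_img.
Qed.

Section Parity.
Variables (K : fieldType) (charK : [pchar K] =i pred0) (G : lieSuperalg K) (V : superModule G).
Implicit Types (v : V) (W : {vspace V}).

(** The operator 1 on the even part and -1 on the odd part. In characteristic 0 homogeneity of a
    subspace is stability under it. *)
Definition parity_inv v : V :=
  daddv_pi (mpart V false) (mpart V true) v - daddv_pi (mpart V true) (mpart V false) v.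

Lemma parity_inv_is_linear : linear parity_inv.
Proof.
move=> a u v; rewrite /parity_inv !(linearP (daddv_pi _ _)) scalerBr opprD addrACA //.
Qed.
HB.instance Definition _ := GRing.isLinear.Build K V V _ parity_inv parity_inv_is_linear.

Lemma parity_invD u v : parity_inv (u + v) = parity_inv u + parity_inv v.
Proof. exact: linearD. Qed.
Lemma parity_invB u v : parity_inv (u - v) = parity_inv u - parity_inv v.
Proof. exact: linearB. Qed.
Lemma parity_invZ a v : parity_inv (a *: v) = a *: parity_inv v.
Proof. exact: linearZ_LR. Qed.

Lemma parity_invE (p : bool) v : v \in mpart V p -> parity_inv v = (-1) ^+ p *: v.
Proof.
have d0 : (mpart V true :&: mpart V false = 0)%VS by rewrite capvC mpart_cap.
have z (A C : {vspace V}) u : (A :&: C = 0)%VS -> u \in C -> daddv_pi A C u = 0.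
  move=> AC uC; have uAC : u \in (A + C)%VS by apply: subvP (addvSr _ _) _ uC.
  have := daddv_pi_add AC uAC; rewrite (daddv_pi_id (U := C) (V := A)) // 1?capvC //.
  by move=> e; apply: (addIr u); rewrite e add0r.
case: p => vp; rewrite /parity_inv.
  by rewrite (z _ _ _ (mpart_cap V) vp) (daddv_pi_id d0 vp) sub0r expr1 scaleN1r.
by rewrite (z _ _ _ d0 vp) (daddv_pi_id (mpart_cap V) vp) subr0 expr0 scale1r.
Qed.

Lemma parity_act (p : bool) (x : G) v : x \in lpart G p ->
  parity_inv (act x v) = (-1) ^+ p *: act x (parity_inv v).
Proof.
move=> xp; have [u u0 [w w1 ->]] := mpart_decomp v.
rewrite parity_invD (linearD (act x)) /= parity_invD (parity_invE u0) (parity_invE w1).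
rewrite (parity_invE (act_graded xp u0)) (parity_invE (act_graded xp w1)) (linearD (act x)) /=.
rewrite !(linearZ_LR (act x)) /= scalerDr !scalerA addbF expr0 mulr1; congr (_ + _ *: _).
by case: p {xp}; rewrite /= !(expr0, expr1) ?mulrNN ?mulr1 ?mul1r.
Qed.

Lemma parity_homogeneous W : (forall v, v \in W -> parity_inv v \in W) -> homogeneous_sub (mpart V) W.
Proof.
move=> Wp; apply/eqP; rewrite eqEsubv subv_add !capvSl /=; apply/subvP => v vW.
have [u u0 [w w1 vE]] := mpart_decomp v.
have := Wp v vW; rewrite {1}vE parity_invD (parity_invE u0) (parity_invE w1) expr0 expr1 scale1r scaleN1r => dW.
have two : (2 : K) != 0 by apply: natK_neq0.
have half (z : V) : 2 *: z \in W -> z \in W.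
  by move=> /(memvZ 2^-1); rewrite scalerA mulVf // scale1r.
have uW : u \in W.
  by apply: half; have := memvD vW dW; rewrite vE addrACA subrr addr0 scaler_nat mulr2n.
have wW : w \in W by have := memvB vW uW; rewrite vE addrC addKr.
by rewrite vE memv_add // memv_cap ?uW ?wW.
Qed.

Lemma homogeneous_parts W v : homogeneous_sub (mpart V) W -> v \in W ->
  exists2 u, u \in W /\ u \in mpart V false & exists2 w, w \in W /\ w \in mpart V true & v = u + w.
Proof.
move=> Wh; rewrite -{1}Wh => /memv_addP [u]; rewrite memv_cap => /andP [uW u0] [w].
by rewrite memv_cap => /andP [wW w1] ->; exists u => //; exists w.
Qed.

Lemma homogeneous_parity W v : homogeneous_sub (mpart V) W -> v \in W -> parity_inv v \in W.
Proof.
move=> Wh /(homogeneous_parts Wh) [u [uW u0] [w [wW w1] ->]].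
by rewrite parity_invD (parity_invE u0) (parity_invE w1) memvD // memvZ.
Qed.

Lemma parity_invK v : parity_inv (parity_inv v) = v.
Proof.
have [u u0 [w w1 ->]] := mpart_decomp v.
rewrite parity_invD (parity_invE u0) (parity_invE w1) expr0 scale1r expr1 scaleN1r.
by rewrite parity_invB (parity_invE u0) (parity_invE w1) expr0 scale1r expr1 scaleN1r opprK.
Qed.
End Parity.

Lemma Uact_submodule (K : fieldType) (G : lieSuperalg K) (V : superModule G) (W : {vspace V})
  (u : Uenv G) (v : V) : submodule W -> v \in W -> Uact u v \in W.
Proof.
move=> [_ Ws]; rewrite /Uact; elim: (urepr u) v => [x||| s IHs t IHt | s IHs t IHt | a s IHs] v vW //=.
- exact: Ws.
- exact: mem0v.
- by rewrite memvD ?IHs ?IHt.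
- by rewrite IHs ?IHt.
- by rewrite memvZ ?IHs.
Qed.

Section KostantElements.
Variables (K : fieldType) (charK : [pchar K] =i pred0) (G : lieSuperalg K) (h : {vspace G}).
Variables (D : rootData h) (pos : pred (rlat D)) (B : chevalley_basis pos).
Local Notation X := (ch_X B).

Lemma kostant_X a : isroot a -> kostant B (Uin (X a)).
Proof.
case=> ra; last exact: kostant_odd.
have := kostant_even B 1 ra; rewrite /divided_power expr1 invr1 scale1r //.
Qed.

Lemma kostant_H i : kostant B (Uin (vsval (ch_H B i))).
Proof.
by have := kostant_cartan B i 1; rewrite /binomial_elt big_ord1 subr0 invr1 scale1r.
Qed.

Lemma kostantN u : kostant B u -> kostant B (- u).
Proof.
move=> ku; rewrite -sub0r; apply: kostant_sub => //.
by rewrite -(subrr (1 : Uenv G)); apply: kostant_sub; apply: kostant_one.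
Qed.

(** Conjugation by the parity operator fixes the even generators and negates the odd ones. The
    statement concerns operators on V, so that it follows by induction on [kostant]. *)
Lemma kostant_parity (gc : good_chevalley B) (V : superModule G) (V_rat : rational B V) u : kostant B u ->
  exists2 u', kostant B u' & forall v : V, parity_inv (Uact u v) = Uact u' (parity_inv v).
Proof.
elim=> [a n ra|a ra|i n||u1 u2 _ [w1 k1 e1] _ [w2 k2 e2]|u1 u2 _ [w1 k1 e1] _ [w2 k2 e2]].
- exists (divided_power (Uin (X a)) n); first exact: kostant_even.
  move=> v; rewrite !Uact_dpow /dpow parity_invZ; congr (_ *: _).
  by elim: n => //= n <-; rewrite (parity_act _ (gc_par gc ra)) expr0 scale1r.
- exists (- Uin (X a)); first exact/kostantN/kostant_odd.
  by move=> v; rewrite Uact_opp !Uact_in (parity_act _ (gc_par gc ra)) expr1 scaleN1r.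
- exists (binomial_elt (Uin (vsval (ch_H B i))) n); first exact: kostant_cartan.
  move=> v; have [s [sP ->]] := hom_weight_span (gc_even gc) V_rat v.
  have UD (t : Uenv G) (x y : V) : Uact t (x + y) = Uact t x + Uact t y.
    by have := @Uact_linear K G V t 1 x y; rewrite !scale1r.
  have U0 (t : Uenv G) : Uact t (0 : V) = 0.
    by apply: (addIr (Uact t 0)); rewrite -UD !add0r.
  elim: s sP => [|x s IHs] sP; first by rewrite big_nil U0 (linear0 (@parity_inv K G V)) U0.
  rewrite big_cons UD !parity_invD UD IHs; last by move=> y ys; apply: sP; rewrite inE ys orbT.
  congr (_ + _); have [mu [p [xm xp]]] := sP x (mem_head _ _).
  rewrite (Uact_binomial _ _ xm) (parity_invE xp) parity_invZ (parity_invE xp).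
  by rewrite (Uact_binomial _ _ (weight_vectorZ _ xm)).
- by exists 1; [exact: kostant_one | move=> v; rewrite !Uact1].
- exists (w1 - w2); first exact: kostant_sub.
  by move=> v; rewrite !Uact_sub parity_invB e1 e2.
- exists (w1 * w2); first exact: kostant_mul.
  by move=> v; rewrite !UactM e1 e2.
Qed.
End KostantElements.


(** * Highest weight vectors and lattices in simple modules *)

Section SimpleModule.
Variables (K : fieldType) (charK : [pchar K] =i pred0) (G : lieSuperalg K) (h : {vspace G}).
Variables (D : rootData h) (pos : pred (rlat D)) (B : chevalley_basis pos).
Hypothesis gc : good_chevalley B.
Variables (V : superModule G) (V_rat : rational B V) (faith : faithful V).
Variables (W : {vspace V}) (W_sub : submodule W) (W_neq0 : W != 0%VS).
Hypothesis W_simple : forall W' : {vspace V}, submodule W' -> (W' <= W)%VS -> W' = 0%VS \/ W' = W.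
Local Notation X := (ch_X B).
Implicit Types (a b : rlat D).

Lemma hom_weight_submodule v : v \in W ->
  exists s : seq V, (forall x, x \in s -> hom_weight h x /\ x \in W) /\ v = \sum_(x <- s) x.
Proof.
move=> vW; have [[dec _] _] := V_rat; have [s [w [us wP vE]]] := (dec v).1 I.
have wW i : i \in s -> w i \in W.
  apply: (@eigen_components K V _ (subvs_of h) (fun y => act (vsval y))
    (fun (mu : 'Hom(subvs_of h, K^o)) y => mu y) (fun x => x \in W)) => //.
  - exact: mem0v.
  - by move=> x y; apply: memvB.
  - by move=> c x; apply: memvZ.
  - by move=> y x; case: W_sub => _; apply.
  - move=> mu nu _ _ mn; apply: contrapT => nz; case/eqP: mn; apply/lfunP => y.
    by apply: contrapT => /eqP ne; apply: nz; exists y.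
  - by move=> mu y /wP; apply.
  - by rewrite -vE.
rewrite vE {vE vW v}; elim: s us wP wW => [|i s IHs] /=; first by exists [::]; rewrite !big_nil.
move=> /andP [_ us] wP wW; have [||r [rP e]] := IHs us.
- by move=> j js; apply: wP; rewrite inE js orbT.
- by move=> j js; apply: wW; rewrite inE js orbT.
have [u [uW u0] [x [xW x1] wE]] := homogeneous_parts W_sub.1 (wW i (mem_head _ _)).
have [um xm] := weight_parts (gc_even gc) (wP i (mem_head _ _)) u0 x1 wE.
exists [:: u, x & r]; rewrite !big_cons e wE addrA; split=> // z.
by rewrite !inE => /or3P [/eqP ->|/eqP ->|/rP //]; split=> //; [exists i, false | exists i, true].
Qed.

Variables (rho : subvs_of h) (ht : rlat D -> int).
Hypothesis rho_hZ : hZ B rho.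
Hypothesis htP : forall a : rlat D, isroot a -> rwt a rho = (ht a)%:~R :> K /\ ht a != 0.

Lemma highest_weight : exists (v : V) (mu : 'Hom(subvs_of h, K^o)) (p : bool) (d : int),
  [/\ v \in W, v != 0, weight_vector mu v, v \in mpart V p /\ mu rho = d%:~R :> K &
   forall (x : V) nu (e : int), x \in W -> x != 0 -> weight_vector nu x -> nu rho = e%:~R :> K ->
     (e <= d)%R].
Proof.
have [N degN] := degree_bound charK gc V_rat rho_hZ.
(* Values at [rho] lie in [-N, N]; the shift by N makes them natural numbers below 2N + 1, so that a
   maximum exists. *)
pose P (n : nat) := `[< exists (v : V) (mu : 'Hom(subvs_of h, K^o)) (p : bool),
  [/\ v \in W, v != 0, weight_vector mu v & v \in mpart V p /\
     mu rho = (n%:Z - N%:Z)%:~R :> K] >].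
have shift (v : V) (mu : 'Hom(subvs_of h, K^o)) : v != 0 -> weight_vector mu v ->
    exists n : nat, mu rho = (n%:Z - N%:Z)%:~R :> K.
  move=> v0 vm; have [d dE] := weight_hZ V_rat v0 vm rho_hZ.
  have dN := degN _ _ _ vm v0 dE; exists (absz (d + N%:Z)); rewrite dE; congr (_%:~R); lia.
have exP : exists n, P n.
  have [v vW v0] : exists2 v, v \in W & v != 0.
    by exists (vpick W); [exact: memv_pick | rewrite vpick0].
  have [s [sP vE]] := hom_weight_submodule vW.
  have [x xs x0] : exists2 x, x \in s & x != 0.
    apply: contrapT => nx; case/eqP: v0; rewrite vE big_seq big1 // => x xs.
    by apply: contrapT => /eqP x0; apply: nx; exists x.
  have [[mu [p [xm xp]]] xW] := sP x xs; have [n nE] := shift x mu x0 xm.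
  by exists n; apply/asboolP; exists x, mu, p.
have ubP n : P n -> (n <= N.*2)%N.
  by move=> /asboolP [v [mu [p [vW v0 vm [vp mE]]]]]; have := degN _ _ _ vm v0 mE; lia.
have [n /asboolP [v [mu [p [vW v0 vm [vp mE]]]]] maxn] := ex_maxnP exP ubP.
exists v, mu, p, (n%:Z - N%:Z); split=> // x nu e xW x0 xn ne.
have [u [uW u0] [w [wW w1] xE]] := homogeneous_parts W_sub.1 xW.
have [um wm] := weight_parts (gc_even gc) xn u0 w1 xE.
have [m mE'] := shift x nu x0 xn.
have Pm : P m.
  have [u00|un0] := eqVneq u 0; last by apply/asboolP; exists u, nu, false.
  have [w00|wn0] := eqVneq w 0; last by apply/asboolP; exists w, nu, true.
  by move: x0; rewrite xE u00 w00 addr0 eqxx.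
have := maxn m Pm; move: ne; rewrite mE' => /(intK_inj charK) <-; lia.
Qed.

Variables (v0 : V) (mu0 : 'Hom(subvs_of h, K^o)) (p0 : bool) (d0 : int).
Hypothesis v0W : v0 \in W.
Hypothesis v0_neq0 : v0 != 0.
Hypothesis v0_weight : weight_vector mu0 v0.
Hypothesis v0_par : v0 \in mpart V p0.
Hypothesis mu0_rho : mu0 rho = d0%:~R :> K.
Hypothesis d0_max : forall (x : V) nu (e : int), x \in W -> x != 0 -> weight_vector nu x ->
  nu rho = e%:~R :> K -> (e <= d0)%R.

Lemma actW x v : v \in W -> act x v \in W. Proof. by case: W_sub => _; apply. Qed.

Lemma v0_int_weight : int_weight_vector B v0.
Proof. by exists mu0; split=> // i; apply: weight_int V_rat _ _ _ v0_neq0 v0_weight. Qed.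

Lemma raise_v0 a : isroot a -> (0 < ht a)%R -> act (X a) v0 = 0.
Proof.
move=> ra ha; apply: contrapT => /eqP x0.
have xm := weight_vector_root B (gc_even gc) ra v0_weight.
have := d0_max (e := d0 + ht a) (actW _ v0W) x0 xm.
by rewrite add_lfunE mu0_rho (htP ra).1 intrD => /(_ erefl); lia.
Qed.

(** [f] is the coordinate along [v0] in a basis of homogeneous weight vectors containing [v0]. Both
    [rho] and the parity operator are diagonal there, so [f] is an eigenfunctional of each. *)
Lemma functional_exists : exists f : {linear V -> K^o}, [/\ f v0 = 1,
  forall x, f (act (vsval rho) x) = d0%:~R * f x &
  forall x, f (parity_inv x) = (-1) ^+ p0 * f x].
Proof.
have fv0 : free [:: v0] by rewrite seq1_free.
have [Z ZP Zb] := hom_weight_basis (gc_even gc) V_rat fv0.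
pose e := in_tuple (Z ++ [:: v0]); pose n := size (Z ++ [:: v0]).
have eb : basis_of fullv e by [].
have i0P : (size Z < n)%N by rewrite /n size_cat addn1.
pose i0 : 'I_n := Ordinal i0P.
have ei0 : e`_i0 = v0 by rewrite /= nth_cat ltnn subnn.
have eP (i : 'I_n) : hom_weight h e`_i.
  have : e`_i \in Z ++ [:: v0] by apply: mem_nth.
  rewrite mem_cat inE => /orP [/ZP //|/eqP ->]; by exists mu0, p0.
pose f : {linear V -> K^o} := coord e i0.
have key (g : {linear V -> V}) (c : K) : (forall i : 'I_n, exists k : K, g e`_i = k *: e`_i) ->
    g v0 = c *: v0 -> forall x, f (g x) = c * f x.
  move=> ge gv0 x; have /choice [k kP] := ge.
  have kc : k i0 = c.
    have := kP i0; rewrite ei0 gv0 => /eqP; rewrite -subr_eq0 -scalerBl scaler_eq0.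
    by rewrite (negPf v0_neq0) orbF subr_eq0 => /eqP ->.
  rewrite {1}(coord_basis eb (memvf x)) linear_sum /=.
  rewrite (eq_bigr (fun i => (k i * coord e i x) *: e`_i)); last first.
    by move=> i _; rewrite linearZ /= kP scalerA mulrC.
  by rewrite /f /= (coord_sum_free _ _ (basis_free eb)) kc.
exists f; split.
- by have := coord_free i0 i0 (basis_free eb); rewrite ei0 eqxx.
- apply: (key (act (vsval rho))); last by rewrite /= v0_weight mu0_rho.
  by move=> i; have [nu [p [en _]]] := eP i; exists (nu rho); rewrite /= en.
- apply: (key (@parity_inv K G V)); last exact: parity_invE.
  by move=> i; have [nu [p [_ ep]]] := eP i; exists ((-1) ^+ p); apply: parity_invE.
Qed.

(** A Q-subspace of W, being closed under differences and division by positive integers. Only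
    lowering root vectors occur among its rules, because [f] vanishes on everything they produce,
    which makes the values of [f] rational. *)
Inductive rational_form : V -> Prop :=
| rform_v0 : rational_form v0
| rform_sub x y : rational_form x -> rational_form y -> rational_form (x - y)
| rform_div n x : rational_form x -> rational_form (n.+1%:R^-1 *: x)
| rform_act a x : isroot a -> (ht a < 0)%R -> rational_form x -> rational_form (act (X a) x).

Lemma rform_closed : zclosed rational_form.
Proof.
by split; [rewrite -(subrr v0); apply: rform_sub; apply: rform_v0 | exact: rform_sub].
Qed.

(** A raising operator is moved to the right past the lowering ones until it kills [v0]. The
    brackets that arise lie in the Z-form of g, which acts on the shorter expression by the
    induction hypothesis. *)
Lemma rform_stable x : rational_form x -> (forall y, hZ B y -> rational_form (act (vsval y) x)) /\
  forall a, isroot a -> rational_form (act (X a) x).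
Proof.
elim=> {x} [|x y _ [xh xa] _ [yh ya]|n x _ [xh xa]|b x rb hb Rx [xh xa]].
- split=> [y hy|a ra].
    rewrite v0_weight; apply: zclosedZ; [exact: rform_closed| |exact: rform_v0].
    exact: (weight_hZ V_rat v0_neq0 v0_weight hy).
  have [_ h0] := htP ra; case: (ltrgt0P (ht a)) h0 => // ha _.
    by rewrite raise_v0 //; apply: zclosed0 rform_closed.
  by apply: rform_act => //; apply: rform_v0.
- split=> [z hz|a ra]; rewrite linearB /=.
    by apply: rform_sub; [exact: xh | exact: yh].
  by apply: rform_sub; [exact: xa | exact: ya].
- split=> [z hz|a ra]; rewrite linearZ /=; apply: rform_div; [exact: xh | exact: xa].
have Rg z : gZ B z -> rational_form (act z x).
  apply: (@zspan_additive _ _ (fun z => act z x)) => [u w||_ [[i ->]|[a ra ->]]].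
  - by rewrite actBl.
  - exact: rform_closed.
  - by apply: xh; apply: zspan_in; exists i.
  - exact: xa.
have par a : isroot a -> exists p : bool, X a \in lpart G p.
  by case=> /(gc_par gc); [exists false | exists true].
split=> [y hy|a ra].
  rewrite (act_br_even _ _ (h_is_even gc y)) (ch_weight B y rb) actZl.
  apply: (zclosedD rform_closed).
    by apply: zclosedZ; [exact: rform_closed|exact: (hZ_int gc)|exact: xa].
  by apply: rform_act => //; apply: xh.
have [_ h0] := htP ra; case: (ltrgt0P (ht a)) h0 => // ha _; last first.
  by apply: rform_act => //; apply: rform_act.
have [pa Xa] := par a ra; have [pb Xb] := par b rb.
have -> : act (X a) (act (X b) x) = act (br (X a) (X b)) x + (-1) ^+ (pa && pb) *: act (X b) (act (X a) x).
  by rewrite (act_br x Xa Xb) subrK.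
apply: (zclosedD rform_closed); first exact/Rg/ch_bracket.
apply: zclosedZ; first exact: rform_closed.
  by exists ((-1) ^+ (pa && pb)); rewrite rmorphXn /= intrN.
by apply: rform_act => //; apply: xa.
Qed.

Lemma rform_dpow a n x : isroot a -> rational_form x -> rational_form (dpow (act (X a)) n x).
Proof.
move=> ra Rx; rewrite /dpow -(prednK (fact_gt0 n)); apply: rform_div.
by elim: n => //= n /rform_stable [_]; apply.
Qed.

Lemma rform_W x : rational_form x -> x \in W.
Proof.
elim=> // [x' y _ xW _ yW|n x' _ xW|a x' _ _ _ xW]; [exact: memvB|exact: memvZ|exact: actW].
Qed.

Section Functional.
Variable f : {linear V -> K^o}.
Hypothesis f1 : f v0 = 1.
Hypothesis f_rho : forall x, f (act (vsval rho) x) = d0%:~R * f x.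

(** [f] sees only the value [d0] at [rho], the maximum on W; a lowered weight vector has a strictly
    smaller value. *)
Lemma f_lower a x : isroot a -> (ht a < 0)%R -> x \in W -> f (act (X a) x) = 0.
Proof.
move=> ra ha xW; have [s [sP ->]] := hom_weight_submodule xW.
rewrite !linear_sum big_seq big1 // => y /sP [[mu [p [ym _]]] yW].
have [y0|y0] := eqVneq y 0; first by rewrite y0 !linear0.
have [e eE] := weight_hZ V_rat y0 ym rho_hZ.
have ed := d0_max yW y0 ym eE.
have := f_rho (act (X a) y); rewrite (weight_vector_root B (gc_even gc) ra ym rho).
rewrite add_lfunE eE (htP ra).1 -intrD linearZ /= => /eqP.
rewrite -subr_eq0 -mulrBl -intrB mulf_eq0 (intK_eq0 charK) => /orP [|/eqP //].
by move=> /eqP; lia.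
Qed.

Lemma f_rational x : rational_form x -> exists (n : nat) (m : int), n.+1%:R * f x = m%:~R.
Proof.
elim=> {x} [|x y _ [n [m e]] _ [n' [m' e']]|k x _ [n [m e]]|a x ra ha Rx _].
- by exists 0%N, 1; rewrite f1 mulr1.
- exists (n.+1 * n'.+1).-1, (m * n'.+1%:Z - m' * n.+1%:Z).
  rewrite prednK ?muln_gt0 // linearB natrM intrB !intrM -e -e' -!pmulrn mulrBr /=; ring.
- exists (n.+1 * k.+1).-1, m; rewrite prednK ?muln_gt0 // linearZ /= natrM -e.
  rewrite /GRing.scale /= -mulrA; congr (_ * _); rewrite mulrA mulfV ?mul1r //.
  exact: natK_neq0.
- by exists 0%N, 0; rewrite f_lower ?mulr0 //; apply: rform_W.
Qed.

Lemma common_denominator (l : seq V) : (forall x, x \in l -> rational_form x) ->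
  exists2 n : nat, (0 < n)%N & forall x, x \in l -> zint (n%:R * f x).
Proof.
elim: l => [|y l IHl] lP; first by exists 1%N.
have [|n n0 nP] := IHl; first by move=> x xl; apply: lP; rewrite inE xl orbT.
have [k [m e]] := f_rational (lP y (mem_head _ _)).
exists (n * k.+1)%N; first by rewrite muln_gt0 n0.
move=> x; rewrite inE natrM => /predU1P [->|/nP xz].
  by rewrite -mulrA e; apply: zintM; [exact: zint_nat | exact: zint_int].
by rewrite mulrAC; apply: zintM => //; apply: zint_nat.
Qed.
End Functional.

Lemma simple_module_lattice_aux : exists2 b : seq V, basis_of W b &
  forall u x, kostant B u -> zspan (fun y => y \in b) x -> zspan (fun y => y \in b) (Uact u x).
Proof.
have [f [f1 f_rho f_par]] := functional_exists.
have [l [v0l lP lK]] := kostant_finite charK gc V_rat faith v0_int_weight.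
have lR x : x \in l -> rational_form x.
  apply: lP => [|z a n Rz ra|z a Rz ra]; first exact: rform_v0.
    by apply: rform_dpow => //; left.
  by case: (rform_stable Rz) => _; apply; right.
have [n n0 nP] := common_denominator f1 f_rho lR.
pose N (x : V) := exists2 u, kostant B u & x = Uact u v0.
have Nc : zclosed N.
  split.
    exists (1 - 1); first by apply: kostant_sub; exact: kostant_one.
    by rewrite Uact_sub subrr.
  by move=> _ _ [u ku ->] [w kw ->]; exists (u - w); [exact: kostant_sub | rewrite Uact_sub].
(* K_Z v0 lies in a finitely generated group on whose generators [f] has the common denominator
   [n]. *)
have Nl x : N x -> zspan (fun y => y \in l) x.
  by move=> [u ku ->]; apply: lK => //; exact: (@zspan_in _ (fun y => y \in l)).
have NK u x : kostant B u -> N x -> N (Uact u x).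
  by move=> ku [w kw ->]; exists (u * w); [exact: kostant_mul | rewrite UactM].
have NW x : N x -> x \in W by move=> [u ku ->]; apply: Uact_submodule.
have nf x : N x -> zint (n%:R * f x).
  move/Nl; apply: (@zspan_additive _ _ (fun x => n%:R * f x : K)) => //; last exact: zint_closed.
  by move=> y z; rewrite linearB mulrBr.
have act_closed (P : V -> Prop) (U : {vspace V}) : (forall x, x \in U <-> P x) ->
    (forall u x, kostant B u -> P x -> x \in W -> P (Uact u x)) -> (forall x, P x -> x \in W) ->
    forall z x, x \in U -> act z x \in U.
  move=> UP PK PW z x xU; apply: (ch_ind (B := B) (P := fun z => act z x \in U)) => [c y w hy hw||i|a ra].
  - by rewrite actDl actZl memvD ?memvZ.
  - by rewrite act0l mem0v.
  - rewrite -Uact_in; apply/UP; apply: PK; [exact: kostant_H|exact/UP|exact/PW/UP].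
  - rewrite -Uact_in; apply/UP; apply: PK; [exact: kostant_X|exact/UP|exact/PW/UP].
have UactD' u (a : K) (x y : V) : Uact u (a *: x + y) = a *: Uact u x + Uact u y.
  exact: Uact_linear.
have Uact0 u : Uact u (0 : V) = 0.
  by have := Uact_subB u (0 : V) 0; rewrite !subrr.
(* The common kernel is homogeneous, by [kostant_parity] and the parity of [f], and stable under the
   Chevalley basis; it is thus a submodule, and f v0 = 1 keeps it from being W. *)
have sep x : x \in W -> (forall u, kostant B u -> f (Uact u x) = 0) -> x = 0.
  pose P (x : V) := x \in W /\ forall u, kostant B u -> f (Uact u x) = 0.
  have [J JP] : exists J : {vspace V}, forall x, x \in J <-> P x.
    apply: vspace_comprehension; first by split=> [|u _]; rewrite ?mem0v // Uact0 linear0.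
    move=> a y z [yW yu] [zW zu]; split; first by rewrite memvD ?memvZ.
    by move=> u ku; rewrite UactD' linearP /= yu // zu // scaler0 addr0.
  have Jsub : submodule J.
    split.
      apply: (parity_homogeneous charK) => y /JP [yW yu]; apply/JP; split.
        exact: (homogeneous_parity W_sub.1).
      move=> u ku; have [u' ku' e] := kostant_parity gc V_rat ku.
      have := f_par (Uact u (parity_inv y)); rewrite e parity_invK yu // => /esym/eqP.
      by rewrite mulf_eq0 signr_eq0 /= => /eqP.
    apply: (act_closed P) => //; last by move=> y [].
    by move=> u y ku [yW yu] _; split; [exact: Uact_submodule | move=> w kw; rewrite -UactM; apply: yu; apply: kostant_mul].
  have JW : (J <= W)%VS by apply/subvP => y /JP [].
  have [J0|JE] := W_simple Jsub JW.
    by move=> xW xu; apply/eqP; rewrite -memv0 -J0; apply/JP.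
  have /JP [_ /(_ 1 (kostant_one B))] : v0 \in J by rewrite JE.
  by rewrite Uact1 f1 => /eqP; rewrite oner_eq0.
have [b fb bN] : exists2 b : seq V, free b & forall x, N x <-> zspan (fun y => y \in b) x.
  apply: (lattice_of_functionals charK
    (F := fun g => exists2 u, kostant B u & g = fun x => n%:R * f (Uact u x)) (U := W)) => //.
  - move=> _ [u ku ->] a x y; rewrite UactD' linearP /= mulrDr; congr (_ + _).
    by rewrite /GRing.scale /= mulrCA.
  - by move=> _ x [u ku ->] Nx; apply: nf; apply: NK.
  - move=> x xW xF; apply: sep => // u ku.
    have /eqP := xF _ (ex_intro2 _ _ u ku erefl).
    by rewrite mulf_eq0 (negPf (natK_neq0 charK n0)) => /eqP.
have bin x : x \in b -> N x by move=> xb; apply/bN; exact: (@zspan_in _ (fun y => y \in b)).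
have bspan x : zspan (fun y => y \in b) x -> x \in <<b>>%VS.
  move: x; apply: zspan_sub; first by split=> [|y z]; [exact: mem0v | exact: memvB].
  by move=> y; apply: memv_span.
have Nb x : N x -> x \in <<b>>%VS by move/bN/bspan.
(* The span of [b] is a submodule containing [v0], hence all of W by simplicity. *)
have bsub : submodule <<b>>%VS.
  split.
    apply: (parity_homogeneous charK) => x; apply: (span_stable (f := @parity_inv K G V)) => y /bin [u ku ->].
    have [u' ku' e] := kostant_parity gc V_rat ku.
    have UZ (c : K) (z : V) : Uact u' (c *: z) = c *: Uact u' z.
      by rewrite -[c *: z]addr0 UactD' Uact0 addr0.
    by rewrite /= e (parity_invE v0_par) UZ memvZ // Nb //; exists u'.
  move=> z x; apply: (span_stable (f := act z)) => y /bin Ny /=.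
  apply: (ch_ind (B := B) (P := fun z => act z y \in <<b>>%VS)) => [c t w ht' hw||i|a ra].
  - by rewrite actDl actZl memvD ?memvZ.
  - by rewrite act0l mem0v.
  - by rewrite -Uact_in; apply/Nb/NK => //; apply: kostant_H.
  - by rewrite -Uact_in; apply/Nb/NK => //; apply: kostant_X.
have bW : (<<b>> <= W)%VS by apply/span_subvP => x /bin /NW.
have v0b : v0 \in <<b>>%VS by apply: Nb; exists 1; [exact: kostant_one | rewrite Uact1].
exists b; last by move=> u x ku /bN Nx; apply/bN/NK.
rewrite /basis_of fb andbT; have [b0|-> //] := W_simple bsub bW.
by move: v0b; rewrite b0 memv0 (negPf v0_neq0).
Qed.
End SimpleModule.

Lemma simple_module_lattice (K : fieldType) (charK : [pchar K] =i pred0) (G : lieSuperalg K)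
    (h : {vspace G}) (D : rootData h) (pos : pred (rlat D)) (B : chevalley_basis pos)
    (gc : good_chevalley B) (V : superModule G) (V_rat : rational B V) (faith : faithful V)
    (W : {vspace V}) : submodule W -> W != 0%VS ->
  (forall W' : {vspace V}, submodule W' -> (W' <= W)%VS -> W' = 0%VS \/ W' = W) ->
  exists2 b : seq V, basis_of W b &
    forall u x, kostant B u -> zspan (fun y => y \in b) x -> zspan (fun y => y \in b) (Uact u x).
Proof.
move=> Ws W0 Wm; have [rho [ht [hrho htP]]] := regular_element charK gc.
have [v [mu [p [d [vW v0 vm [vp md] vmax]]]]] := highest_weight charK gc V_rat Ws W0 hrho.
exact: (simple_module_lattice_aux charK gc V_rat faith Ws W0 Wm hrho htP vW v0 vm vp md vmax).
Qed.


(** * Admissible lattices *)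

Section Lattices.
Variables (K : fieldType) (charK : [pchar K] =i pred0) (G : lieSuperalg K) (h : {vspace G}).
Variables (D : rootData h) (pos : pred (rlat D)) (B : chevalley_basis pos).
Variables (V : superModule G).
Local Notation X := (ch_X B).

Lemma semisimple_lattice (gc : good_chevalley B) (V_rat : rational B V) : faithful V ->
  semisimple V -> exists M : V -> Prop, admissible B M.
Proof.
move=> faith [n [W [WP dW WE]]].
have /choice [b bP] : forall i : 'I_n, exists b : seq V, basis_of (W i) b /\
    forall u x, kostant B u -> zspan (fun y => y \in b) x -> zspan (fun y => y \in b) (Uact u x).
  move=> i; have [Ws W0 Wm] := WP i.
  by have [b bW bK] := simple_module_lattice charK gc V_rat faith Ws W0 Wm; exists b.
pose bb := \big[cat/[::]]_(i < n) b i.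
have bb_basis : basis_of fullv bb.
  by rewrite -WE; apply: bigcat_basis => // i _; case: (bP i).
have bb_in i x : x \in b i -> x \in bb.
  move=> xb; rewrite /bb; have : i \in index_enum 'I_n by exact: mem_index_enum.
  elim: (index_enum _) => // j s IH; rewrite big_cons mem_cat inE => /predU1P [<-|/IH ->].
    by rewrite xb.
  by rewrite orbT.
exists (zspan (fun y => y \in bb)); split; first by exists bb.
move=> u m ku; apply: (@zspan_additive _ _ (Uact u)) => [x y||x xb].
- exact: Uact_subB.
- exact: zspan_closed.
have [i xi] : exists i, x \in b i.
  move: xb; rewrite /bb; elim/big_rec: _ => //= i s _ IH; rewrite mem_cat => /orP [xi|/IH //].
  by exists i.
apply: zspan_mono (bb_in i) _ _; case: (bP i) => _; apply=> //.
exact: (@zspan_in _ (fun y => y \in b i)).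
Qed.

Lemma trivial_lattice : (forall (x : G) (v : V), act x v = 0) ->
  exists M : V -> Prop, admissible B M.
Proof.
move=> act0; pose M (v : V) := zspan (fun y : V => y \in (vbasis fullv : seq V)) v.
have Mc : zclosed M by exact: zspan_closed.
exists M; split; first by exists (vbasis fullv : seq V); [exact: vbasisP|].
move=> u v ku; elim: ku v => [a n ra|a ra|i n||u1 u2 _ IH1 _ IH2|u1 u2 _ IH1 _ IH2] v Mv.
- rewrite Uact_dpow; case: n => [|n]; first by rewrite dpow0.
  by rewrite /dpow /= act0 scaler0; apply: zclosed0.
- by rewrite Uact_in act0; apply: zclosed0.
- rewrite (Uact_binomial_eigen (z := 0)) ?Uact_in ?act0 ?scale0r //.
  by apply: zclosedZ => //; apply: binK_int => //; exists 0.
- by rewrite Uact1.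
- by rewrite Uact_sub; apply: zclosedB; [exact: Mc|exact: IH1|exact: IH2].
- by rewrite UactM; apply: IH1; apply: IH2.
Qed.

Lemma faithful_or_trivial : classical G -> faithful V \/ forall (x : G) (v : V), act x v = 0.
Proof.
case=> _ simple_root _.
have [J JP] : exists J : {vspace G}, forall x, x \in J <-> forall v : V, act x v = 0.
  by apply: vspace_comprehension => [v|a x y hx hy v]; [exact: act0l|
    rewrite actDl actZl hx hy scaler0 addr0].
have Jpart x : x \in J -> exists2 u, u \in J /\ u \in lpart G false &
    exists2 w, w \in J /\ w \in lpart G true & x = u + w.
  move=> /JP xJ; have [u u0 [w w1 xE]] := lpart_decomp x.
  (* On a homogeneous vector the two components of [x] take values of opposite parity, so both
     values vanish: the kernel of the action is a homogeneous ideal. *)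
  have H (v : V) : act u v = 0 /\ act w v = 0.
    have [v0 v00 [v1 v11 ->]] := mpart_decomp v.
    have e0 := xJ v0; have e1 := xJ v1; rewrite xE !actDl in e0 e1.
    have [e00 e01] : act u v0 = 0 /\ act w v0 = 0.
      apply: mpart_inj; rewrite ?mem0v //; last by rewrite addr0.
        exact: (act_graded u0 v00).
      exact: (act_graded w1 v00).
    have [e10 e11] : act w v1 = 0 /\ act u v1 = 0.
      apply: mpart_inj; rewrite ?mem0v //; last by rewrite addr0 addrC.
        exact: (act_graded w1 v11).
      exact: (act_graded u0 v11).
    by rewrite !linearD /= e00 e01 e10 e11 addr0.
  by exists u; [split=> //; apply/JP => v; case: (H v) | exists w => //; split=> //; apply/JP => v; case: (H v)].
have Jh : homogeneous_sub (lpart G) J.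
  apply/eqP; rewrite eqEsubv subv_add !capvSl /=; apply/subvP => x /Jpart [u [uJ u0] [w [wJ w1] ->]].
  by rewrite memv_add // memv_cap ?uJ ?wJ.
have Jbr (i j : bool) x y (v : V) : x \in lpart G i -> y \in lpart G j -> y \in J ->
    act (br x y) v = 0 /\ act (br y x) v = 0.
  move=> xi yj /JP yJ; rewrite (act_br v xi yj) (act_br v yj xi) !yJ (linear0 (act x)) !scaler0 subrr.
  by split.
have Ji : ideal J.
  move=> x y /Jpart [u [uJ u0] [w [wJ w1] ->]]; have [x0 x00 [x1 x11 ->]] := lpart_decomp x.
  split; apply/JP => v; rewrite !(brDl, linearD) /= !(brDl, actDl).
    rewrite (Jbr _ _ _ _ v x00 u0 uJ).1 (Jbr _ _ _ _ v x11 u0 uJ).1.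
    by rewrite (Jbr _ _ _ _ v x00 w1 wJ).1 (Jbr _ _ _ _ v x11 w1 wJ).1 !addr0.
  rewrite (Jbr _ _ _ _ v x00 u0 uJ).2 (Jbr _ _ _ _ v x11 u0 uJ).2.
  by rewrite (Jbr _ _ _ _ v x00 w1 wJ).2 (Jbr _ _ _ _ v x11 w1 wJ).2 !addr0.
have [J0|Jf] := simple_root J Jh Ji; [left | right].
  by move=> x /JP; rewrite J0 memv0 => /eqP.
by move=> x; apply/JP; rewrite Jf memvf.
Qed.

Lemma binomial_elt_pascal (A : algType K) (x : A) n :
  binomial_elt (x + 1) n.+1 = binomial_elt x n.+1 + binomial_elt x n.
Proof.
rewrite /binomial_elt -!/(ffall _ _) ffall_pascal scalerDr; congr (_ + _).
rewrite mulr_natl -scaler_nat scalerA factS natrM invfM mulrAC mulVf ?mul1r //.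
exact: natK_neq0.
Qed.

(** The Pascal rule moves [c] up and down from 0. The shifts are needed to place a zero of the
    binomial at a prescribed weight. *)
Lemma kostant_shifted i (c : int) n : kostant B (binomial_elt (Uin (vsval (ch_H B i)) + c%:~R) n).
Proof.
have b0 (t : Uenv G) : binomial_elt t 0 = 1.
  by rewrite /binomial_elt big_ord0 invr1 scale1r.
have kD u w : kostant B u -> kostant B w -> kostant B (u + w).
  by move=> ku kw; rewrite -[w]opprK; apply: kostant_sub => //; apply: kostantN.
elim: n c => [|n IHn] c; first by rewrite b0; apply: kostant_one.
set H := Uin _.
have up (k : int) : kostant B (binomial_elt (H + k%:~R) n.+1) -> kostant B (binomial_elt (H + (k + 1)%:~R) n.+1).
  by move=> kk; rewrite intrD addrA binomial_elt_pascal; apply: kD.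
have down (k : int) : kostant B (binomial_elt (H + (k + 1)%:~R) n.+1) -> kostant B (binomial_elt (H + k%:~R) n.+1).
  move=> kk; rewrite -[binomial_elt _ _](addrK (binomial_elt (H + k%:~R) n)) -binomial_elt_pascal.
  by move: kk; rewrite intrD addrA => kk; apply: kostant_sub.
elim/int_rect: c => [|k IHk|k IHk].
- by rewrite addr0; apply: kostant_cartan.
- by rewrite -addn1 PoszD; apply: up.
- by apply: down; rewrite -addn1 PoszD opprD subrK.
Qed.

Lemma lattice_weight_sum (V_rat : rational B V) (M : V -> Prop) : admissible B M ->
  internal_dsum M (fun (mu : 'Hom(subvs_of h, K^o)) (v : V) => M v /\ weight_vector mu v).
Proof.
move=> [[b bb bM] MK].
have Mc : zclosed M.
  have zc := zspan_closed (fun w => w \in b).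
  by split; [apply/bM; apply: zclosed0 | move=> x y /bM xb /bM yb; apply/bM; apply: zclosedB].
have [[dec indep] wint] := V_rat.
split; last by move=> s w us wP; apply: indep => // i /wP [].
move=> v; split=> [Mv|[s [w [us wP ->]]]]; last first.
  by apply: zclosed_sum_seq => // i /wP [].
have [s0 [w [us0 wP0 vE0]]] := (dec v).1 I.
(* Zero components are dropped, because integrality on the H_i is given only for weights with a
   nonzero vector. *)
pose s := [seq i <- s0 | w i != 0].
have us : uniq s by rewrite filter_uniq.
have wP i : i \in s -> w i != 0 /\ weight_vector i (w i).
  by rewrite mem_filter => /andP [wi /wP0].
have vE : v = \sum_(i <- s) w i.
  rewrite vE0 big_filter [RHS]big_mkcond /=; apply: eq_bigr => i _; by case: eqP => //= ->.
exists s, w; split=> // i si; split; last by case: (wP i si).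
have sep1 j : j \in s -> i != j -> exists u (c : _ -> K), [/\ kostant B u,
    forall k, k \in s -> Uact u (w k) = c k *: w k, c i = 1 & c j = 0].
  move=> sj ij.
  have [k kne] : exists k, i (ch_H B k) != j (ch_H B k).
    apply: contrapT => nk; case/eqP: ij; apply/lfunP => y.
    apply: (hspan_ind (B := B) (P := fun y => i y = j y)) => [|c y1 y2 h1 h2|k].
    - by rewrite !linear0.
    - by rewrite !linearP /= h1 h2.
    - by apply: contrapT => /eqP e; apply: nk; exists k.
  have [a aE] := wint i (ex_intro2 _ _ (w i) (wP i si).1 (wP i si).2) k.
  have [d dE] := wint j (ex_intro2 _ _ (w j) (wP j sj).1 (wP j sj).2) k.
  have ad : a != d by apply: contraNneq kne => e; rewrite aE dE e.
  pose T (c : int) n := binomial_elt (Uin (vsval (ch_H B k)) + c%:~R) n.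
  have TP c n mu (x : V) : weight_vector mu x -> Uact (T c n) x = binK (mu (ch_H B k) + c%:~R) n *: x.
    move=> xm; apply: Uact_binomial_eigen; rewrite UactD Uact_in xm scalerDl; congr (_ + _).
    case: c => m; first exact: Uact_nat.
    by rewrite NegzE !mulrNz Uact_opp scaleNr; congr (- _); exact: (Uact_nat m.+1 _).
  have bin0 n : (0 < n)%N -> binK (0 : K) n = 0.
    by case: n => // n _; rewrite -[0]/(0%N%:R : K) binK_nat.
  have binn n : binK (n%:R : K) n = 1 by rewrite binK_nat // binn.
  have shift0 (z : K) (m : int) : z = m%:~R -> z + (- m)%:~R = 0 by move=> ->; rewrite -intrD subrr.
  have shiftn (z : K) (m m' : int) : z = m%:~R -> (m' <= m)%R -> z + (- m')%:~R = `|m - m'|%N%:R.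
    by move=> -> mm; rewrite -intrD pmulrn; congr (_%:~R); lia.
  (* With m the smaller of a and d, the element bin(H_k - m, |a - d|) is 0 at m and 1 at the other
     value; it serves directly if m = d, and its complement to 1 serves if m = a. Products of such
     elements isolate the weight [i]. *)
  case: (ltrgtP a d) ad => // ad _.
    exists (1 - T (- a) `|d - a|%N), (fun mu : 'Hom(subvs_of h, K^o) => 1 - binK (mu (ch_H B k) + (- a)%:~R) `|d - a|%N); split.
    - by apply: kostant_sub; [exact: kostant_one | exact: kostant_shifted].
    - by move=> l /wP [_ lw]; rewrite Uact_sub Uact1 (TP _ _ _ _ lw) scalerBl scale1r.
    - by rewrite /= (shift0 _ _ aE) -[RHS]subr0; congr (1 - _); apply: bin0; lia.
    - rewrite /= (shiftn _ _ _ dE (ltW ad)); apply/eqP; rewrite subr_eq0 eq_sym; apply/eqP; exact: binn.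
  exists (T (- d) `|a - d|%N), (fun mu : 'Hom(subvs_of h, K^o) => binK (mu (ch_H B k) + (- d)%:~R) `|a - d|%N); split.
  - exact: kostant_shifted.
  - by move=> l /wP [_ lw]; rewrite (TP _ _ _ _ lw).
  - by rewrite /= (shiftn _ _ _ aE (ltW ad)); exact: binn.
  - by rewrite /= (shift0 _ _ dE); apply: bin0; lia.
have sep (t : seq _) : {subset t <= s} -> i \notin t -> exists u (c : _ -> K), [/\ kostant B u,
    forall k, k \in s -> Uact u (w k) = c k *: w k, c i = 1 & forall j, j \in t -> c j = 0].
  elim: t => [|j t IHt] ts it.
    by exists 1, (fun=> 1); split=> [|k _||//]; [exact: kostant_one | rewrite Uact1 scale1r | ].
  move: it; rewrite inE negb_or => /andP [ij it].
  have [|u [c [ku uc ci ct]]] := IHt _ it; first by move=> k kt; apply: ts; rewrite inE kt orbT.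
  have [u' [c' [ku' uc' ci' cj']]] := sep1 j (ts j (mem_head _ _)) ij.
  exists (u * u'), (fun k => c k * c' k); split.
  - exact: kostant_mul.
  - by move=> k ks; rewrite UactM uc' // Uact_scale uc // scalerA mulrC.
  - by rewrite ci ci' mulr1.
  - by move=> k; rewrite inE => /predU1P [->|/ct ->]; rewrite ?cj' ?mulr0 ?mul0r.
have irem : i \notin rem i s by rewrite mem_rem_uniq // inE eqxx.
have [u [c [ku uc ci ct]]] := sep _ (@mem_rem _ i s) irem.
suff -> : w i = Uact u v by apply: MK.
have USum (r : seq 'Hom(subvs_of h, K^o)) : Uact u (\sum_(k <- r) w k) = \sum_(k <- r) Uact u (w k).
  elim: r => [|k r IHr]; first by rewrite !big_nil; have := Uact_scale u 0 (0 : V); rewrite !scale0r.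
  have := @Uact_linear K G V u 1 (w k) (\sum_(j <- r) w j).
  by rewrite !big_cons !scale1r => ->; rewrite IHr.
rewrite vE USum (big_rem i) //= uc // ci scale1r big_seq big1 ?addr0 // => k kr.
by rewrite uc ?(mem_rem kr) // ct // scale0r.
Qed.
End Lattices.


Lemma eq_sgn_zint (R : fieldType) (c d : R) : zint d -> eq_sgn c d -> zint c.
Proof. by move=> zd [->|->] //; apply: (zclosedN (zint_closed R)). Qed.

(** * Root data *)

Section RootVectors.
Variables (K : fieldType) (charK : [pchar K] =i pred0) (G : lieSuperalg K) (h : {vspace G}).
Variables (D : rootData h) (pos : pred (rlat D)) (B : chevalley_basis pos).
Implicit Types (a b : rlat D).
Hypothesis rwt_inj : forall a b, isroot a -> isroot b -> rwt a = rwt b -> a = b.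
Hypothesis rwt_neq0 : forall a, isroot a -> rwt a != 0.
Hypothesis root_vec : forall p a, proot p a ->
  exists x : G, [/\ x \in lpart G p, x != 0 & root_vector (rwt a) x].

Lemma proot_isroot p a : proot p a -> isroot a.
Proof. by case: p; [right | left]. Qed.

Lemma ch_X_part p a : proot p a -> ch_X B a \in lpart G p.
Proof.
move=> ra; have [x [xp x0 xa]] := root_vec ra.
have [c xE] := ch_root_space B rwt_inj rwt_neq0 (proot_isroot ra) xa.
have c0 : c != 0 by apply: contraNneq x0 => c0; rewrite xE c0 scale0r.
suff -> : ch_X B a = c^-1 *: x by apply: memvZ.
by rewrite xE scalerA mulVf // scale1r.
Qed.

Lemma ch_X_part_proot p a : isroot a -> ch_X B a \in lpart G p -> proot p a.
Proof.
move=> ra xp; have x0 := ch_X_neq0 B ra.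
by case: ra => ra; have := lpart_both (ch_X_part ra) xp x0 => <-.
Qed.
End RootVectors.

(** * Root data from an invariant form *)

Section FormCase.
Variables (K : fieldType) (charK : [pchar K] =i pred0) (G : lieSuperalg K) (h : {vspace G}).
Hypothesis h_even : (h <= lpart G false)%VS.
Variables (form : G -> G -> K) (H : 'Hom(subvs_of h, K^o) -> subvs_of h).
Hypothesis form_inv : invariant_form form.
Local Notation D := (form_roots form H).
Hypothesis coroots : form_coroots D.
Variables (pos : pred (rlat D)) (B : chevalley_basis pos).
Variables (V : superModule G) (V_rat : rational B V) (faith : faithful V).
Local Notation X := (ch_X B).
Implicit Types (a b : 'Hom(subvs_of h, K^o)).
Local Notation isr := (@isroot K G h D).
Local Notation prt := (@proot K G h D).

Lemma form_coroot_neq0 a : isr a -> sqnorm (D := D) a = 0 -> H a != 0.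
Proof.
move=> ra sq; apply/eqP => Ha0; have [_ _ /(_ sq) [zs _]] := coroots ra.
have : zspan (fun w : K => exists2 b : rlat D, isroot b & w = rwt b (coroot (r := D) a)) 1.
  by apply/zs; exists 1.
move/(zspan_sub (P := fun w : K => w = 0)) => one0.
have /eqP : (1 : K) = 0.
  apply: one0; first by split=> // x y -> ->; rewrite subr0.
  by move=> _ [b _ ->]; rewrite /= Ha0 linear0.
by rewrite oner_eq0.
Qed.

Lemma form_coroot_sqnorm a : isr a -> exists c : K, a (H a) = c * sqnorm (D := D) a.
Proof.
move=> ra; have [[c cE] _ _] := coroots ra; exists c.
by rewrite -[H a]/(coroot (r := D) a) cE linearZ.
Qed.

(** By definition only an odd root could be 0, as happens for Q(n). Its coroot, a multiple of the
    dual element 0, would vanish, and the pairings with it would not generate Z. *)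
Lemma form_root_neq0 a : isr a -> a != 0.
Proof.
move=> ra; apply/eqP => a0; rewrite a0 in ra.
have d0 : dual_elt (@hform K G h D) (0 : 'Hom(subvs_of h, K^o)) = 0 by exact: linear0.
have sq : sqnorm (D := D) (0 : 'Hom(subvs_of h, K^o)) = 0 by rewrite /sqnorm /= d0 linear0.
have := form_coroot_neq0 ra sq; have [[c cE] _ _] := coroots ra.
by rewrite -[H 0]/(coroot (r := D) 0) cE /= d0 scaler0 eqxx.
Qed.

Lemma form_part p a : prt p a -> X a \in lpart G p.
Proof.
apply: ch_X_part => [b c _ _ //|b|q b [_ [x [xq x0 xb]]]]; first exact: form_root_neq0.
by exists x.
Qed.

Lemma form_part_proot p a : isr a -> X a \in lpart G p -> prt p a.
Proof.
apply: ch_X_part_proot => [b c _ _ //|b|q b [_ [x [xq x0 xb]]]]; first exact: form_root_neq0.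
by exists x.
Qed.

(** By invariance X_a is orthogonal to h and to every X_b with b different from -a; nondegeneracy
    then yields X_{-a}, and evenness of the form gives it the parity of X_a. *)
Lemma form_opp p a : prt p a -> prt p (- a).
Proof.
move=> ra; have r : isr a by apply: proot_isroot ra.
have [[fl fr] f01 fsym fass fnd] := form_inv.
have fZr x c y z : form x (c *: y + z) = c * form x y + form x z by rewrite fr.
have f0r x : form x 0 = 0.
  by have := fZr x 1 0 0; rewrite scaler0 addr0 mul1r => /(congr1 (fun v => v - form x 0)); rewrite subrr addrK.
have fZl c x y : form (c *: x) y = c * form x y.
  have f0l : form 0 y = 0.
    by have := fl y 1 0 0; rewrite scaler0 addr0 scale1r => /(congr1 (fun v => v - form 0 y)); rewrite subrr addrK.
  by have := fl y c x 0; rewrite f0l !addr0.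
have brXh y : br (X a) (vsval y) = (- (a y : K)) *: X a.
  have y0 : vsval y \in lpart G false by exact: (subvP h_even _ (subvsP y)).
  by rewrite -[LHS]opprK -(br_skew_even _ y0) (ch_weight B y r) scaleNr.
have X0 := ch_X_neq0 B r.
have nz (f : 'Hom(subvs_of h, K^o)) : f != 0 -> exists y, f y != 0.
  move=> f0; apply: contrapT => ny; case/eqP: f0; apply/lfunP => y; rewrite zero_lfunE.
  by apply: contrapT => /eqP fy; apply: ny; exists y.
have fH i : form (X a) (vsval (ch_H B i)) = 0.
  have [y ay] := nz _ (form_root_neq0 r).
  have := fass (X a) (vsval y) (vsval (ch_H B i)).
  rewrite brXh (ch_comm B) f0r fZl => /eqP; rewrite mulf_eq0 oppr_eq0 (negPf ay).
  by move/eqP.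
have fX b : isr b -> form (X a) (X b) != 0 -> b = - a.
  move=> rb fab; apply/eqP; rewrite -subr_eq0 opprK; apply/eqP/lfunP => y; rewrite zero_lfunE.
  have := fass (X a) (vsval y) (X b).
  rewrite brXh (ch_weight B y rb) fZl -[_ *: X b]addr0 fZr f0r addr0 => /eqP.
  rewrite -subr_eq0 -mulrBl mulf_eq0 (negPf fab) orbF -opprD oppr_eq0 add_lfunE addrC.
  by move/eqP.
have [b [rb fab]] : exists b, isr b /\ form (X a) (X b) != 0.
  apply: contrapT => nb; case/eqP: X0; apply: fnd => y.
  apply: (ch_ind (B := B) (P := fun y => form (X a) y = 0)) => [c u w hu hw||i|b rb].
  - by rewrite fZr hu hw mulr0 addr0.
  - exact: f0r.
  - exact: fH.
  - by apply: contrapT => /eqP fab; apply: nb; exists b.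
have bE := fX b rb fab; rewrite -bE; apply: form_part_proot => //.
have Xa := form_part ra.
case: (rb) => rb'; have Xb := form_part rb'; case: p ra Xa => // ra Xa.
  by case/eqP: fab; rewrite (fsym _ _ _ _ Xa Xb) (f01 _ _ Xb Xa) mulr0.
by case/eqP: fab; rewrite (f01 _ _ Xa Xb).
Qed.

Lemma form_isroot_opp a : isr a -> isr (- a).
Proof. by case=> /form_opp; [left | right]. Qed.

(** If (a, a) = 0 then a(H_a) = 0, so the trace norm of H_a, a multiple of a(H_a), is 0. Then H_a
    acts by 0 and faithfulness gives H_a = 0, which the normalization of isotropic coroots
    forbids. *)
Lemma form_sqnorm_even a : prt false a -> sqnorm (D := D) a != 0.
Proof.
move=> ra; have r : isr a by left.
have rN := form_isroot_opp r; have raN := form_opp ra.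
apply/eqP => sq; have Ha0 := form_coroot_neq0 r sq.
have [kap [kC kL kN k0 kT]] := trace_form charK h_even V_rat.
have hH : hZ B (H a).
  by apply/(ch_H_span B); apply: zspan_in; exists a; split.
have brE : br (X a) (X (- a)) = vsval (H a).
  rewrite (ch_XXopp B r rN) asboolF ?scale1r // => ra1.
  by have := lpart_both (form_part ra) (form_part ra1) (ch_X_neq0 B r).
have [t tP] := kT _ _ _ a (form_part ra) (form_part raN) brE (fun y => ch_weight B y r).
have [c cE] := form_coroot_sqnorm r.
have kHH : kap (H a) (H a) = 0 by rewrite tP cE sq mulr0 mul0r.
case/eqP: Ha0; apply: subvs_inj; rewrite linear0; apply: faith; exact: k0.
Qed.

Lemma form_string_const a b c : isr a -> isr b -> structure_constant (D := D) a b c ->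
  (sqnorm (D := D) a != 0 \/ sqnorm (D := D) b != 0) ->
  exists2 r, string_left (D := D) a b r & eq_sgn c r.+1%:R.
Proof. by move=> ra rb [sc _ _] sq; apply: sc. Qed.

(** For isotropic [a] the structure constant is a(H_a) = 0 up to sign. Otherwise, when 2a is a root,
    the string through [a] descends through a, 0, -a, -2a and stops, so r = 3, the constant is 4 up
    to sign and m is 2 up to sign. *)
Lemma form_odd_square a : prt true a ->
  exists2 m : int, br (X a) (X a) = (2 * m)%:~R *: X (a + a) & m = 0 \/ prt false (a + a).
Proof.
move=> ra; have r : isr a by right.
have a0 := form_root_neq0 r.
have an0 n : (0 < n)%N -> a *+ n != 0.
  by move=> n0; rewrite -scaler_nat scaler_eq0 negb_or (natK_neq0 charK n0).
have ne1 : a <> - a.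
  by move=> e; have /eqP := an0 2 isT; apply; rewrite mulr2n {2}e subrr.
have [r2|nr2] := pselect (isr (a + a)); last first.
  by exists 0; [rewrite (ch_XX0 B r r ne1 nr2) mulr0 scale0r | left].
have [c sc cE] := ch_XX B r r ne1 r2.
have [sq|sq] := eqVneq (sqnorm (D := D) a) 0.
  have [_ _ /(_ sq sq) cv] := sc; have [d dE] := form_coroot_sqnorm r.
  have c0 : c = 0.
    by case: cv => ->; rewrite /= dE sq mulr0 ?oppr0.
  by exists 0; [rewrite cE c0 ?mulr0 !scale0r | left].
have [k sl ck] := form_string_const r r sc (or_introl sq).
have ck0 : c != 0.
  by case: ck => ->; rewrite ?oppr_eq0 natK_neq0.
have X2 : X (a + a) \in lpart G false.
  suff -> : X (a + a) = c^-1 *: br (X a) (X a).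
    by apply: memvZ; apply: (br_graded (form_part ra) (form_part ra)).
  by rewrite cE scalerA mulVf // scale1r.
have p2 := form_part_proot r2 X2.
(* The Jacobi identity gives 3 [x, [x, x]] = 0 for odd x, whereas 3a being a root would make this
   bracket a nonzero multiple of X_3a. *)
have nr3 : ~ isr (a + (a + a)).
  move=> r3; have ne2 : a <> - (a + a).
    move=> e; have /eqP := an0 3 isT; apply.
    by rewrite mulrS mulr2n {1}e addNr.
  have [c' sc' cE'] := ch_XX B r r2 ne2 r3.
  have [k' _ ck'] := form_string_const r r2 sc' (or_introl sq).
  have c'0 : c' != 0 by case: ck' => ->; rewrite ?oppr_eq0 natK_neq0.
  have X1 := form_part ra.
  have x3 : br (X a) (br (X a) (X a)) = 0.
    have j := br_jacobi (X a) X1 X1; rewrite /= expr1 scaleN1r in j.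
    have B0 : br (X a) (X a) \in lpart G false := br_graded X1 X1.
    rewrite (br_skew_even (X a) B0) in j.
    have : 3%:R *: br (X a) (br (X a) (X a)) = 0.
      by rewrite scaler_nat !mulrS mulr0n addr0 {1}j addrA subrK addNr.
    by move/eqP; rewrite scaler_eq0 (negPf (natK_neq0 charK (ltn0Sn 2))) => /eqP.
  move: x3; rewrite cE linearZ /= cE' scalerA => /eqP.
  by rewrite scaler_eq0 mulf_eq0 (negPf ck0) (negPf c'0) (negPf (ch_X_neq0 B r3)).
have k3 : k = 3%N.
  have e1 : a - a *+ 1 = 0 by rewrite subrr.
  have e2 : a - a *+ 2 = - a by rewrite mulr2n opprD addrA subrr add0r.
  have e3 : a - a *+ 3 = - (a + a) by rewrite mulrS mulr2n opprD addrA subrr add0r.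
  have e4 : a - a *+ 4 = - (a + (a + a)) by rewrite mulrS opprD addrA subrr add0r mulrS mulr2n.
  have [s1 s2] := sl.
  have rN := form_isroot_opp r; have rN2 := form_isroot_opp r2.
  case: k s1 s2 {sl ck} => [|[|[|[|k]]]] s1 s2 //.
  - by case: s2; right; exact: e1.
  - by case: s2; left; rewrite -[X in isroot X]e2 in rN *.
  - by case: s2; left; rewrite -[X in isroot X]e3 in rN2 *.
  have [] := s1 4%N isT.
    move=> r4; case: nr3; rewrite -[a + (a + a)]opprK; apply: form_isroot_opp.
    by rewrite -e4.
  move=> z4; have /eqP := an0 3 isT; case.
  by rewrite mulrS mulr2n -[LHS]opprK -e4 z4 oppr0.
case: ck => cv; [exists 2 | exists (-2)]; try by right.
  by rewrite cE cv k3.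
by rewrite cE cv k3.
Qed.

Lemma form_good : good_chevalley B.
Proof.
split=> //.
- by move=> a; apply: form_root_neq0.
- by move=> p a; apply: form_part.
- by move=> p a; apply: form_part_proot.
- by move=> a; apply: form_opp.
- move=> a ra; have [_ sq _] := coroots (or_introl ra); apply: sq; exact: form_sqnorm_even.
- by move=> a; apply: form_sqnorm_even.
- by move=> a b _ [].
- move=> a b c ra rb _ _ sc.
  have [sq|sq] := pselect (sqnorm (D := D) a != 0 \/ sqnorm (D := D) b != 0).
    have [r _] := form_string_const ra rb sc sq; exact: eq_sgn_zint (zint_nat _ _).
  have sa : sqnorm (D := D) a = 0 by apply: contrapT => /eqP sa; apply: sq; left.
  have sb : sqnorm (D := D) b = 0 by apply: contrapT => /eqP sb; apply: sq; right.
  have [_ _ /(_ sa sb)] := sc; apply: eq_sgn_zint.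
  have [_ _ /(_ sa) [zs _]] := coroots ra.
  by apply/zs; apply: zspan_in; exists b.
- by move=> a; apply: form_odd_square.
- by move=> a i; apply: (faithful_weight_int h_even V_rat).
Qed.
End FormCase.


(** * Root data of P(n) *)

Section MxParts.
Variables (K : fieldType) (m n : nat).
Implicit Types (X Y : 'M[K]_(m + n)).

Lemma mx_partD b X Y : mx_part b (X + Y) = mx_part b X + mx_part b Y.
Proof.
by case: b; rewrite /mx_part add_block_mx /ulsubmx /ursubmx /dlsubmx /drsubmx !linearD /= ?addr0.
Qed.

Lemma mx_part_part b c X : mx_part b (mx_part c X) = if b == c then mx_part b X else 0.
Proof.
case: b c => [] []; rewrite /mx_part /= ?(block_mxKul, block_mxKur, block_mxKdl, block_mxKdr) //.
  by rewrite -[RHS](@block_mx_const _ m n m n).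
by rewrite -[RHS](@block_mx_const _ m n m n).
Qed.

Lemma mx_br_even b X Y : mx_part false X = X -> mx_part b Y = Y -> mx_br X Y = X *m Y - Y *m X.
Proof.
move=> Xe Yb; have X1 : mx_part true X = 0 by rewrite -Xe mx_part_part.
have Y1 : mx_part (~~ b) Y = 0 by rewrite -Yb mx_part_part; case: (b).
rewrite /mx_br big_bool !big_bool X1 !mul0mx !mulmx0 !scaler0 !subr0 Xe.
case: b Yb Y1 => Yb Y1; rewrite ?Yb (_ : mx_part _ Y = 0) // mul0mx mulmx0 scaler0 subr0;
  by rewrite /= ?Yb !addr0 ?add0r expr0 scale1r.
Qed.
End MxParts.

Section PCase.
Variables (K : fieldType) (charK : [pchar K] =i pred0) (G : lieSuperalg K) (h : {vspace G}).
Hypothesis h_even : (h <= lpart G false)%VS.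
Variables (n : nat) (n1 : (1 < n)%N) (n3 : n != 3%N).
Variables (phi : 'Hom(G, 'M[K]_(n.+1 + n.+1))) (phiP : P_iso phi) (h_diag : P_cartan h phi).
Variables (H : 'rV[int]_n.+1 -> subvs_of h) (Hco : P_coroots phi H).
Local Notation D := (P_roots phi H).
Variables (pos : pred (rlat D)) (B : chevalley_basis pos).
Variables (V : superModule G) (V_rat : rational B V) (faith : faithful V).
Implicit Types (a b : 'rV[int]_n.+1) (y : subvs_of h).
Local Notation isr := (@isroot K G h D).
Local Notation prt := (@proot K G h D).
Local Notation rw := (@rwt K G h D).

Definition pdiag y (k : 'I_n.+1) : K := ulsubmx (phi (vsval y)) k k.

Lemma P_rwtE a y : rw a y = \sum_k (a 0 k)%:~R * pdiag y k.
Proof.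
have lin : linear (fun x : subvs_of h =>
    \sum_k (a 0 k)%:~R * phi (vsval x) (lshift _ k) (lshift _ k) : K^o).
  move=> c u v; rewrite scaler_sumr -big_split /=; apply: eq_bigr => k _.
  by rewrite !linearP !mxE mulrDr /GRing.scale /= mulrCA.
pose L : {linear subvs_of h -> K^o} := HB.pack (fun x : subvs_of h =>
    \sum_k (a 0 k)%:~R * phi (vsval x) (lshift _ k) (lshift _ k) : K^o)
    (GRing.isLinear.Build K _ _ _ _ lin).
rewrite /= -[LHS]/(linfun L y) lfunE /=; apply: eq_bigr => k _.
by rewrite /pdiag /ulsubmx !mxE.
Qed.

Lemma P_rwtD a b : rw (a + b) = rw a + rw b.
Proof.
apply/lfunP => y; rewrite add_lfunE !P_rwtE -big_split /=; apply: eq_bigr => k _.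
by rewrite !mxE intrD mulrDl.
Qed.

Lemma P_h_matrix y : exists A : 'M[K]_n.+1,
  [/\ phi (vsval y) = block_mx A 0 0 (- A^T), is_diag_mx A, \tr A = 0 & forall k, pdiag y k = A k k].
Proof.
have y0 : vsval y \in lpart G false by exact: (subvP h_even _ (subvsP y)).
have [_ par _ im] := phiP.
have [A [B0 [C [trA _ _ E]]]] : P_matrix (phi (vsval y)) by apply/im; exists (vsval y).
have := par false _ y0; rewrite E /mx_part block_mxKul block_mxKdr => e.
exists A; split=> //.
- by have := (h_diag y0).1 (subvsP y); rewrite E block_mxKul.
- by move=> k; rewrite /pdiag E block_mxKul.
Qed.

Lemma P_trace0 y : \sum_k pdiag y k = 0.
Proof. by have [A [_ _ trA dA]] := P_h_matrix y; rewrite (eq_bigr (fun k => A k k)). Qed.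

Lemma P_pdiag_inj y : (forall k, pdiag y k = 0) -> y = 0.
Proof.
move=> y0; have [A [E /is_diag_mxP dA _ yA]] := P_h_matrix y.
have A0 : A = 0.
  apply/matrixP => i j; rewrite !mxE; have [<-|ij] := eqVneq i j; first by rewrite -yA y0.
  exact: dA.
have [_ _ inj _] := phiP; apply/subvs_inj/inj.
rewrite E A0 !linear0 ?oppr0; exact: block_mx_const.
Qed.

Lemma P_pdiag_coroot i j k : i != j -> pdiag (H (P_alpha i j)) k = (k == i)%:R - (k == j)%:R.
Proof.
by move=> ij; rewrite /pdiag Hco.1 // !mxE !andbb.
Qed.

Lemma P_rwt_coroot a i j : i != j -> rw a (H (P_alpha i j)) = (a 0 i - a 0 j)%:~R.
Proof.
move=> ij; rewrite P_rwtE intrB.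
under eq_bigr do rewrite P_pdiag_coroot // mulrBr.
rewrite sumrB; congr (_ - _).
  by rewrite (bigD1 i) //= eqxx mulr1 big1 ?addr0 // => k /negPf ->; rewrite mulr0.
by rewrite (bigD1 j) //= eqxx mulr1 big1 ?addr0 // => k /negPf ->; rewrite mulr0.
Qed.

(** Restriction to h, where traces are 0, determines an integer vector only up to constant vectors.
    The coordinate sum supplies the missing information: it is 0 on even roots and 2 or -2 on odd
    ones. *)
Definition csum a : int := \sum_k a 0 k.
Lemma csumD a b : csum (a + b) = csum a + csum b.
Proof. by rewrite /csum -big_split; apply: eq_bigr => k _; rewrite mxE. Qed.
Lemma csumN a : csum (- a) = - csum a.
Proof. by rewrite /csum -sumrN; apply: eq_bigr => k _; rewrite mxE. Qed.
Lemma csum_eps (i : 'I_n.+1) : csum (P_eps i) = 1.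
Proof.
rewrite /csum (bigD1 i) //= big1 ?addr0 => [|k ki]; first by rewrite !mxE !eqxx.
by rewrite !mxE (negPf ki).
Qed.

Lemma csum_root p a : prt p a -> csum a = 0 /\ p = false \/ (csum a = 2 \/ csum a = -2) /\ p = true.
Proof.
case: p => /= [[[i [j ->]]|[i [j [_ ->]]]]|[i [j [_ ->]]]]; rewrite /P_beta /P_alpha ?csumN csumD ?csumN !csum_eps; auto.
Qed.

Lemma P_const a : (forall i j, a 0 i = a 0 j) -> csum a = n.+1%:Z * a 0 ord0.
Proof.
move=> ac; rewrite /csum (eq_bigr (fun=> a 0 ord0)) => [|k _]; last exact: ac.
by rewrite sumr_const card_ord -mulr_natl natz.
Qed.

Lemma P_rwt_eq a b : rw a = rw b -> forall i j, (a - b) 0 i = (a - b) 0 j.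
Proof.
move=> ab i j; have [->//|ij] := eqVneq i j.
have := congr1 (fun f : 'Hom(subvs_of h, K^o) => f (H (P_alpha i j))) ab.
have Hz (p q r s : int) : p - q = r - s -> p - r = q - s by lia.
by rewrite /= !P_rwt_coroot // => /(intK_inj charK) /Hz e; rewrite !mxE.
Qed.

Lemma P_isroot_csum a : isr a -> csum a = 0 \/ csum a = 2 \/ csum a = -2.
Proof. by case=> /csum_root; lia. Qed.

(** Equal restrictions force a - b to be a constant vector z, with (n + 1) z among 0, 2, -2, 4, -4;
    so z = 0 for n > 1, n != 3. For n = 3 the roots eps_1 + eps_2 and -(eps_3 + eps_4) do have the
    same restriction. *)
Lemma P_inj a b : isr a -> isr b -> rw a = rw b -> a = b.
Proof.
move=> /P_isroot_csum sa /P_isroot_csum sb ab.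
have c := P_rwt_eq ab; have := P_const c; rewrite csumD csumN.
set z := (a - b) 0 ord0 => e.
have z0 : z = 0 by nia.
apply/rowP => k; by have := c k ord0; rewrite -/z z0 !mxE => /eqP; rewrite subr_eq0 => /eqP ->.
Qed.

Lemma P_root_neq0 a : isr a -> rw a != 0.
Proof.
move=> ra; apply/eqP => a0; have sa := P_isroot_csum ra.
have r0 : rw 0 = 0 by apply/lfunP => y; rewrite P_rwtE zero_lfunE big1 // => k _; rewrite mxE mul0r.
have c := P_rwt_eq (etrans a0 (esym r0)); rewrite subr0 in c.
have := P_const c; set z := a 0 ord0 => e.
have z0 : z = 0 by nia.
have az : a = 0 by apply/rowP => k; have := c k ord0; rewrite -/z z0 !mxE.
case: ra => ra; have := csum_root ra; rewrite {1 2 3}az.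
  case: ra => i [j [ij aE]] _; have := congr1 (fun v : 'rV[int]_n.+1 => v 0 i) (esym aE).
  by rewrite az !mxE !eqxx (negPf ij).
by rewrite /csum big1 => [|k _]; [lia | rewrite mxE].
Qed.

Lemma P_lift (b : bool) (X : 'M[K]_(n.+1 + n.+1)) : P_matrix X -> mx_part b X = X ->
  exists2 x, x \in lpart G b & phi x = X.
Proof.
have [_ par inj im] := phiP.
move=> /im [x xX] Xb; have [u u0 [w w1 xE]] := lpart_decomp x.
have e0 := par _ _ u0; have e1 := par _ _ w1.
have XE : X = phi u + phi w by rewrite -xX xE linearD.
have other : mx_part (~~ b) (phi u + phi w) = 0 by rewrite -XE -Xb mx_part_part; case: (b).
have k0 : mx_part true (phi u) = 0 by rewrite -e0 mx_part_part.
have k1 : mx_part false (phi w) = 0 by rewrite -e1 mx_part_part.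
rewrite mx_partD in other; case: b Xb other => Xb.
  rewrite (_ : ~~ true = false) // e0 k1 addr0 => u00; exists w => //.
  by rewrite XE u00 add0r.
rewrite (_ : ~~ false = true) // e1 k0 add0r => w00; exists u => //.
by rewrite XE w00 addr0.
Qed.

Lemma P_root_vector_of (b : bool) a (X : 'M[K]_(n.+1 + n.+1)) : P_matrix X -> mx_part b X = X -> X != 0 ->
  (forall y (A : 'M[K]_n.+1), is_diag_mx A -> (forall k, pdiag y k = A k k) ->
     block_mx A 0 0 (- A^T) *m X - X *m block_mx A 0 0 (- A^T) = (rw a y : K) *: X) ->
  exists x : G, [/\ x \in lpart G b, x != 0 & root_vector (rw a) x].
Proof.
move=> XP Xb X0 Xw; have [x xb xX] := P_lift XP Xb; exists x; split=> //.
  by apply: contraNneq X0 => x0; rewrite -xX x0 linear0.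
have [hom par inj _] := phiP; move=> y; apply: inj.
have [A [E dA _ yA]] := P_h_matrix y.
have y0 : vsval y \in lpart G false by exact: (subvP h_even _ (subvsP y)).
have ye := par _ _ y0; have xe := par _ _ xb.
by rewrite hom (mx_br_even ye xe) linearZ /= E xX; apply: Xw.
Qed.

Lemma diag_mul_l (A Y : 'M[K]_n.+1) i j : is_diag_mx A -> (A *m Y) i j = A i i * Y i j.
Proof.
move=> /is_diag_mxP dA; rewrite mxE (bigD1 i) //= big1 ?addr0 // => k ki.
by rewrite dA ?mul0r // eq_sym.
Qed.

Lemma diag_mul_r (A Y : 'M[K]_n.+1) i j : is_diag_mx A -> (Y *m A) i j = Y i j * A j j.
Proof.
move=> /is_diag_mxP dA; rewrite mxE (bigD1 j) //= big1 ?addr0 // => k kj.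
by rewrite dA ?mulr0.
Qed.

Lemma diag_trN (A : 'M[K]_n.+1) : is_diag_mx A -> is_diag_mx (- A^T).
Proof.
move=> /is_diag_mxP dA; apply/is_diag_mxP => i j ij; rewrite !mxE dA ?oppr0 //.
by rewrite eq_sym.
Qed.

Lemma rw_eps (i : 'I_n.+1) y : rw (P_eps i) y = pdiag y i.
Proof.
rewrite P_rwtE (bigD1 i) //= big1 ?addr0 => [|k ki]; first by rewrite !mxE !eqxx mul1r.
by rewrite !mxE (negPf ki) mul0r.
Qed.

Lemma rwN a y : rw (- a) y = - rw a y.
Proof.
rewrite !P_rwtE -sumrN; apply: eq_bigr => k _; by rewrite mxE mulrNz mulNr.
Qed.

Lemma mxB_entry (P Q : 'M[K]_n.+1) i j : (P - Q) i j = P i j - Q i j.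
Proof. by rewrite !mxE. Qed.

Let dm (i j : 'I_n.+1) : 'M[K]_n.+1 := delta_mx i j.

Lemma delta_scale_row (f : 'I_n.+1 -> K) i j k l : f k * dm i j k l = f i * dm i j k l.
Proof. by rewrite mxE; case: eqP => [->//|_]; rewrite !mulr0. Qed.

Lemma delta_scale_col (f : 'I_n.+1 -> K) i j k l : f l * dm i j k l = f j * dm i j k l.
Proof. by rewrite mxE; case: (l =P j) => [->//|_]; rewrite andbF !mulr0. Qed.

(** The witnesses are E_ij + E_ji in the block B, E_ij - E_ji in C, and E_ij in A together with
    minus its transpose. For i = j the first is 2 E_ii, nonzero in characteristic 0. *)
Lemma P_root_vec p a : prt p a ->
  exists x : G, [/\ x \in lpart G p, x != 0 & root_vector (rw a) x].
Proof.
have two : (2 : K) != 0 by apply: natK_neq0.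
have nz (P Q R S : 'M[K]_n.+1) : (P != 0) || (Q != 0) || (R != 0) -> block_mx P Q R S != 0.
  apply: contraTneq => e; have e0 : block_mx P Q R S = block_mx 0 0 0 0.
    by rewrite e; apply/esym; exact: block_mx_const.
  by have [-> -> -> _] := eq_block_mx e0; rewrite eqxx.
have trD i j : (dm i j)^T = dm j i by rewrite trmx_delta.
have rwD a' b' y : rw (a' + b') y = rw a' y + rw b' y :> K by rewrite P_rwtD add_lfunE.
case: p => [[[i [j ->]]|[i [j [ij ->]]]]|[i [j [ij ->]]]].
- apply: (P_root_vector_of (X := block_mx 0 (dm i j + dm j i) 0 0)).
  + exists 0, (dm i j + dm j i), 0; split; rewrite ?linear0 ?oppr0 //.
    by rewrite linearD /= !trD addrC.
  + by rewrite /mx_part block_mxKur block_mxKdl.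
  + apply: nz; apply/orP; left; apply/orP; right; apply/eqP => /matrixP /(_ i j).
    rewrite !mxE !eqxx /=; case: (eqVneq i j) => [_|ij] /=.
      by move/eqP; rewrite -natrD (negPf two).
    by rewrite addr0 => /eqP; rewrite oner_eq0.
  move=> y A dA yA; have dN := diag_trN dA.
  rewrite !mulmx_block !(mul0mx, mulmx0, addr0, add0r) opp_block_mx add_block_mx scale_block_mx.
  rewrite !scaler0 !oppr0 !addr0; congr block_mx; apply/matrixP => k l.
  rewrite rwD !rw_eps !yA mxB_entry (diag_mul_l _ _ _ dA) (diag_mul_r _ _ _ dN).
  rewrite [in RHS]mxE [(dm i j + dm j i) k l]mxE [(- A^T) l l]mxE [A^T l l]mxE.
  have e1 := delta_scale_row (fun k => A k k) i j k l.
  have e2 := delta_scale_row (fun k => A k k) j i k l.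
  have e3 := delta_scale_col (fun k => A k k) i j k l.
  have e4 := delta_scale_col (fun k => A k k) j i k l.
  move: (dm i j k l) (dm j i k l) e1 e2 e3 e4 => u v e1 e2 e3 e4.
  transitivity (A k k * u + A k k * v + (A l l * u + A l l * v)); first by ring.
  by rewrite e1 e2 e3 e4; ring.
- apply: (P_root_vector_of (X := block_mx 0 0 (dm i j - dm j i) 0)).
  + exists 0, 0, (dm i j - dm j i); split; rewrite ?linear0 ?oppr0 //.
    by rewrite linearB /= !trD opprB.
  + by rewrite /mx_part block_mxKur block_mxKdl.
  + apply: nz; apply/orP; right; apply/eqP => /matrixP /(_ i j).
    by rewrite !mxE !eqxx (negPf ij) /= subr0 => /eqP; rewrite oner_eq0.
  move=> y A dA yA; have dN := diag_trN dA.
  rewrite !mulmx_block !(mul0mx, mulmx0, addr0, add0r) opp_block_mx add_block_mx scale_block_mx.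
  rewrite !scaler0 !oppr0 !addr0; congr block_mx; apply/matrixP => k l.
  rewrite rwN rwD !rw_eps !yA mxB_entry (diag_mul_r _ _ _ dA) (diag_mul_l _ _ _ dN).
  rewrite [in RHS]mxE [(dm i j - dm j i) k l]mxE [(- dm j i) k l]mxE [(- A^T) k k]mxE [A^T k k]mxE.
  have e1 := delta_scale_row (fun k => A k k) i j k l.
  have e2 := delta_scale_row (fun k => A k k) j i k l.
  have e3 := delta_scale_col (fun k => A k k) i j k l.
  have e4 := delta_scale_col (fun k => A k k) j i k l.
  move: (dm i j k l) (dm j i k l) e1 e2 e3 e4 => u v e1 e2 e3 e4.
  transitivity (- (A k k * u) + A k k * v - (A l l * u) + A l l * v); first by ring.
  by rewrite e1 e2 e3 e4; ring.
apply: (P_root_vector_of (X := block_mx (dm i j) 0 0 (- (dm i j)^T))).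
+ exists (dm i j), 0, 0; split; rewrite ?linear0 ?oppr0 //.
  by rewrite /mxtrace big1 // => k _; rewrite mxE; case: eqP => // ->; rewrite (negPf ij).
+ by rewrite /mx_part block_mxKul block_mxKdr.
+ apply: nz; apply/orP; left; apply/orP; left; apply/eqP => /matrixP /(_ i j).
  by rewrite !mxE !eqxx => /eqP; rewrite oner_eq0.
move=> y A dA yA; have dN := diag_trN dA.
rewrite !mulmx_block !(mul0mx, mulmx0, addr0, add0r) opp_block_mx add_block_mx scale_block_mx.
rewrite !scaler0 !oppr0 !addr0 trD rwD rwN !rw_eps !yA; congr block_mx; apply/matrixP => k l.
  rewrite mxB_entry (diag_mul_r _ _ _ dA) (diag_mul_l _ _ _ dA) [in RHS]mxE.
  have e1 := delta_scale_row (fun k => A k k) i j k l.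
  have e3 := delta_scale_col (fun k => A k k) i j k l.
  move: (dm i j k l) e1 e3 => u e1 e3.
  by rewrite e1 [u * _]mulrC e3; ring.
rewrite mxB_entry (diag_mul_r _ _ _ dN) (diag_mul_l _ _ _ dN) [in RHS]mxE.
rewrite [(- dm j i) k l]mxE [(- A^T) k k]mxE [A^T k k]mxE [(- A^T) l l]mxE [A^T l l]mxE.
have e1 := delta_scale_row (fun k => A k k) j i k l.
have e3 := delta_scale_col (fun k => A k k) j i k l.
move: (dm j i k l) e1 e3 => u e1 e3.
transitivity (A k k * u - A l l * u); first by ring.
by rewrite e1 e3; ring.
Qed.

Lemma P_dual_elt a y : @hform K G h D (dual_elt (@hform K G h D) (rw a)) y = rw a y.
Proof.
have hE u v : @hform K G h D u v = \sum_k pdiag u k * pdiag v k.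
  have [A [EA dA _ uA]] := P_h_matrix u; have [A' [EA' dA' _ vA]] := P_h_matrix v.
  rewrite /= EA EA' !block_mxKul /mxtrace; apply: eq_bigr => k _.
  by rewrite (diag_mul_l _ _ _ dA) uA vA.
have pdD c u v k : pdiag (c *: u + v) k = c * pdiag u k + pdiag v k.
  by rewrite -!rw_eps linearP.
apply: dual_eltP.
- move=> v c u u'; rewrite !hE scaler_sumr -big_split /=; apply: eq_bigr => k _.
  by rewrite pdD mulrDl -mulrA.
- move=> v c u u'; rewrite !hE scaler_sumr -big_split /=; apply: eq_bigr => k _.
  by rewrite pdD mulrDr mulrCA.
move=> x x0; have eq_ij i j : pdiag x i = pdiag x j.
  have [->//|ij] := eqVneq i j.
  have := x0 (H (P_alpha i j)); rewrite hE; under eq_bigr do rewrite P_pdiag_coroot // mulrBr.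
  rewrite sumrB (bigD1 i) //= eqxx mulr1 big1 => [|k /negPf ->]; last by rewrite mulr0.
  rewrite (bigD1 j) //= eqxx mulr1 big1 => [|k /negPf ->]; last by rewrite mulr0.
  by rewrite !addr0 => /subr0_eq.
apply: P_pdiag_inj => k; have := P_trace0 x.
rewrite (eq_bigr (fun=> pdiag x k)) => [|l _]; last exact: eq_ij.
rewrite sumr_const card_ord -mulr_natl => /eqP; rewrite mulf_eq0 (negPf (natK_neq0 charK (ltn0Sn n))).
by move/eqP.
Qed.

(** The dual element has diagonal entries a_k + c, and trace 0 gives c = -csum(a)/(n + 1). So (a, a)
    = 0 would mean (n + 1) times the sum of the a_k^2 equals csum(a)^2, which is 0 or 4; with n > 1
    and n != 3 this leaves only a = 0. *)
Lemma P_sqnorm_neq0 a : isr a -> sqnorm (D := D) a != 0.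
Proof.
move=> ra; apply/eqP; rewrite /sqnorm -/(rw a).
set t := dual_elt _ _ => sq.
have tij i j : pdiag t i - (a 0 i)%:~R = pdiag t j - (a 0 j)%:~R.
  have [->//|ij] := eqVneq i j.
  have := P_dual_elt a (H (P_alpha i j)); rewrite -/t P_rwt_coroot //.
  have hE u v : @hform K G h D u v = \sum_k pdiag u k * pdiag v k.
    have [A [EA dA _ uA]] := P_h_matrix u; have [A' [EA' dA' _ vA]] := P_h_matrix v.
    rewrite /= EA EA' !block_mxKul /mxtrace; apply: eq_bigr => k _.
    by rewrite (diag_mul_l _ _ _ dA) uA vA.
  rewrite hE; under eq_bigr do rewrite P_pdiag_coroot // mulrBr.
  rewrite sumrB (bigD1 i) //= eqxx mulr1 big1 => [|k /negPf ->]; last by rewrite mulr0.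
  rewrite (bigD1 j) //= eqxx mulr1 big1 => [|k /negPf ->]; last by rewrite mulr0.
  rewrite !addr0 intrB => /eqP; rewrite subr_eq => /eqP ->; ring.
set c := pdiag t ord0 - (a 0 ord0)%:~R.
have tE k : pdiag t k = (a 0 k)%:~R + c by rewrite /c -(tij k) addrC subrK.
have s1 : (csum a)%:~R + n.+1%:R * c = 0 :> K.
  rewrite -(P_trace0 t) (eq_bigr _ (fun k _ => tE k)) big_split /= sumr_const card_ord mulr_natl.
  by rewrite rmorph_sum.
have s2 : (\sum_k a 0 k ^+ 2)%:~R + c * (csum a)%:~R = 0 :> K.
  rewrite -sq P_rwtE (eq_bigr (fun k => (a 0 k ^+ 2)%:~R + c * (a 0 k)%:~R)) => [|k _].
    by rewrite big_split /= -mulr_sumr /csum !rmorph_sum.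
  by rewrite tE mulrDr -intrM -expr2 [c * _]mulrC.
have key : n.+1%:Z * (\sum_k a 0 k ^+ 2) = csum a * csum a.
  apply: (intK_inj charK); rewrite /= !intrM -pmulrn.
  have -> : (\sum_k a 0 k ^+ 2)%:~R = - (c * (csum a)%:~R) :> K by apply/eqP; rewrite -addr_eq0 s2.
  have -> : n.+1%:R * - (c * (csum a)%:~R) = - (n.+1%:R * c) * (csum a)%:~R :> K by ring.
  by congr (_ * _); apply/eqP; rewrite eq_sym -addr_eq0 s1.
have sq0 : (0 <= \sum_k a 0 k ^+ 2)%R by apply: sumr_ge0 => k _; apply: sqr_ge0.
have Q0 : \sum_k a 0 k ^+ 2 = 0.
  move: key sq0 (P_isroot_csum ra); move: (\sum_k _) (csum a) => q s key q0 [s0|[s0|s0]]; subst s.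
  - nia.
  - have : n.+1%:Z * q = 4 by rewrite key.
    move: n1 n3; nia.
  - have : n.+1%:Z * q = 4 by rewrite key.
    move: n1 n3; nia.
have a0 : a = 0.
  apply/rowP => k; rewrite mxE; apply/eqP; rewrite -sqrf_eq0.
  move/eqP: Q0; rewrite psumr_eq0 => [/allP /(_ k (mem_index_enum _)) //|l _]; exact: sqr_ge0.
by have := P_root_neq0 ra; rewrite a0 (_ : rw 0 = 0) ?eqxx //; apply/lfunP => y; rewrite P_rwtE zero_lfunE big1 // => k _; rewrite mxE mul0r.
Qed.

Lemma P_good : good_chevalley B.
Proof.
split=> //.
- exact: P_rwtD.
- exact: P_inj.
- exact: P_root_neq0.
- by move=> p a; apply: (ch_X_part B P_inj P_root_neq0 P_root_vec).
- by move=> p a; apply: (ch_X_part_proot (B := B) P_inj P_root_neq0 P_root_vec).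
- by move=> a [i [j [ij ->]]]; exists j, i; rewrite eq_sym opprB.
- move=> a [i [j [ij ->]]]; rewrite -/(rw _) P_rwt_coroot // !mxE !eqxx [j == i]eq_sym (negPf ij).
  by rewrite /= subr0 sub0r opprK.
- by move=> a ra; apply: P_sqnorm_neq0; left.
- move=> a b /csum_root sa [i [j [_ aE _]]]; move: sa.
  by rewrite aE /P_beta csumD !csum_eps; lia.
- move=> a b c ra _ _ _ [s1 s2 _].
  have sq := P_sqnorm_neq0 ra.
  have [ex|nex] := pselect (exceptional (r := D) a b).
    by have [r _] := s2 (or_introl sq) ex; apply: eq_sgn_zint; apply: zint_nat.
  by have [r _] := s1 (or_introl sq) nex; apply: eq_sgn_zint; apply: zint_nat.
(* Twice an odd root has coordinate sum 4 or -4, which no root has, so odd root vectors square to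
   0. *)
- move=> a ra; exists 0; last by left.
  have s := csum_root ra.
  have ne : a <> - a.
    by move=> e; have := csumN a; rewrite -e; lia.
  rewrite ch_XX0 ?mulr0 ?scale0r //; [by right|by right|].
  by move=> /P_isroot_csum; rewrite csumD; lia.
- by move=> a i; apply: (faithful_weight_int h_even V_rat).
Qed.
End PCase.


Lemma root_setting_good (K : fieldType) (charK : [pchar K] =i pred0) (G : lieSuperalg K)
    (h : {vspace G}) (D : rootData h) (pos : pred (rlat D)) (B : chevalley_basis pos)
    (V : superModule G) : ~ type_P 3 G -> cartan_subalg h -> root_setting pos ->
  rational B V -> faithful V -> good_chevalley B.
Proof.
move=> nP3 [h_even _ _ _] Ds; case: Ds B => {D pos} [form H pos _ inv _ co|n phi H pos n1 iso dg co _] B.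
  by move=> V_rat faith; exact: (form_good charK h_even inv co V_rat faith).
move=> V_rat faith; have n3 : n != 3%N.
  by apply/eqP => n3; apply: nP3; rewrite -n3; exists phi.
exact: (P_good charK h_even n1 n3 iso dg co V_rat faith).
Qed.

Theorem theorem5p1p3 (K : closedFieldType) (charK : [pchar K] =i pred0)
    (G : lieSuperalg K) (G_classical : classical G)
    (G_notA11 : ~ type_A11 G) (G_notP3 : ~ type_P 3 G)
    (G_notQ : forall n, (1 < n)%N -> ~ type_Q n G)
    (G_D21 : forall a : K, type_D21 a G ->
       exists z : int, type_D21 (z%:~R : K) G)
    (h : {vspace G}) (h_cartan : cartan_subalg h)
    (D : rootData h) (pos : pred (rlat D)) (Pi : seq (rlat D))
    (D_roots : root_setting pos) (Pi_simple : distinguished pos Pi)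
    (B : chevalley_basis pos) :
  (forall V : superModule G, rational B V -> semisimple V ->
     exists M : V -> Prop, admissible B M) /\
  (forall V : superModule G, rational B V -> semisimple V ->
     forall M : V -> Prop, admissible B M ->
       internal_dsum M
         (fun (mu : 'Hom(subvs_of h, K^o)) (v : V) =>
            M v /\ weight_vector mu v)).
Proof.
split=> [V V_rat V_ss|V V_rat _ M MA]; last exact: (lattice_weight_sum charK V_rat MA).
have [faith|act0] := faithful_or_trivial V G_classical; last exact: trivial_lattice.
have gc := root_setting_good charK G_notP3 h_cartan D_roots V_rat faith.
exact: (semisimple_lattice charK gc V_rat faith V_ss).
Qed.
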